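(* Let $\lambda',\lambda''>1$, $l\in\mathbb{N}$ and $\lambda'''=\lambda'+\lambda''+2l$. For $g\in\widetilde{SL_2(\mathbb{R})}$ let $$\tau(g)=T_\iota\circ\widehat{\pi_{\lambda',\lambda''}(g)}\circ T_\iota^{-1}\quad\text{acting on } L^2_{\lambda',\lambda''}(\mathbb{R}^+\times(-1,1)),\qquad \tau_l(g)=\Theta\circ\widehat{\pi_{\lambda'''}(g)}\circ\Theta^{-1}\quad\text{acting on }V_l^{\lambda',\lambda''}.$$ Then the orthogonal projection $\mathcal{J}_l^{\lambda',\lambda''}:L^2_{\lambda',\lambda''}(\mathbb{R}^+\times(-1,1))\to V_l^{\lambda',\lambda''}$ is a symmetry breaking operator for the $\widetilde{SL_2(\mathbb{R})}$-action, i.e. $\mathcal{J}_l^{\lambda',\lambda''}\circ\tau(g)=\tau_l(g)\circ\mathcal{J}_l^{\lambda',\lambda''}$ for all $g\in\widetilde{SL_2(\mathbb{R})}$, and the canonical injection $\mathrm{inj}:V_l^{\lambda',\lambda''}\hookrightarrow L^2_{\lambda',\lambda''}(\mathbb{R}^+\times(-1,1))$ is the associated holographic operator, i.e. $\mathrm{inj}\circ\tau_l(g)=\tau(g)\circ\mathrm{inj}$ for all $g\in\widetilde{SL_2(\mathbb{R})}$.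
   Context: $\mathbb{N}=\{0,1,2,\dots\}$, $\mathbb{R}^+=(0,\infty)$, $\Pi$ is the upper half-plane. Holomorphic discrete series. For $\lambda>1$, $H^2_\lambda(\Pi)$ is the space of holomorphic functions on $\Pi$ in $L^2(\Pi,y^{\lambda-2}dx\,dy)$. For $g\in SL_2(\mathbb{R})$ with $g^{-1}=\begin{pmatrix}a&b\\c&d\end{pmatrix}$, $(\pi_\lambda(g)f)(z)=(cz+d)^{-\lambda}f\left(\frac{az+b}{cz+d}\right)$; for real $\lambda>1$ this is a unitary irreducible representation of the universal covering group $\widetilde{SL_2(\mathbb{R})}$ with the appropriate determination of the power. Concretely, an element of $\widetilde{SL_2(\mathbb{R})}$ is a pair $(g,\varphi)$ with $g\in SL_2(\mathbb{R})$ and $\varphi$ holomorphic on $\Pi$ with $e^{\varphi(z)}=cz+d$, the product is $(g_1,\varphi_1)(g_2,\varphi_2)=(g_1g_2,\ \varphi_1+\varphi_2\circ g_1^{-1})$, and $(cz+d)^{-\lambda}:=e^{-\lambda\varphi(z)}$. Let $H^2_{\lambda',\lambda''}(\Pi\times\Pi)=H^2_{\lambda'}(\Pi)\hat\otimes H^2_{\lambda''}(\Pi)$ (completed Hilbert tensor product). $L^2$-model. $L^2_\lambda(\mathbb{R}^+)=L^2(\mathbb{R}^+,t^{1-\lambda}dt)$. The Laplace transform $\mathcal{F}h(z)=\int_0^\infty h(t)e^{izt}dt$ is (known to be) a bijection, isometric up to a constant, $L^2_\lambda(\mathbb{R}^+)\to H^2_\lambda(\Pi)$. Let $L^2_{\lambda',\lambda''}(\mathbb{R}^+\times\mathbb{R}^+)=L^2(\mathbb{R}^+\times\mathbb{R}^+,x^{1-\lambda'}y^{1-\lambda''}dx\,dy)$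 and $\mathcal{F}_2=\mathcal{F}\otimes\mathcal{F}:L^2_{\lambda',\lambda''}(\mathbb{R}^+\times\mathbb{R}^+)\to H^2_{\lambda',\lambda''}(\Pi\times\Pi)$. Put $\widehat{\pi_{\lambda'''}(g)}=\mathcal{F}^{-1}\circ\pi_{\lambda'''}(g)\circ\mathcal{F}$ on $L^2_{\lambda'''}(\mathbb{R}^+)$ and $\widehat{\pi_{\lambda',\lambda''}(g)}=\mathcal{F}_2^{-1}\circ(\pi_{\lambda'}(g)\hat\otimes\pi_{\lambda''}(g))\circ\mathcal{F}_2$ on $L^2_{\lambda',\lambda''}(\mathbb{R}^+\times\mathbb{R}^+)$. Stratified model. Let $\iota:\mathbb{R}^+\times(-1,1)\to\mathbb{R}^+\times\mathbb{R}^+$, $\iota(t,v)=\left(\frac t2(1-v),\frac t2(1+v)\right)$, $d\mu_{\lambda',\lambda''}(v)=(1-v)^{\lambda'-1}(1+v)^{\lambda''-1}dv$ on $(-1,1)$, and $L^2_{\lambda',\lambda''}(\mathbb{R}^+\times(-1,1))=L^2(\mathbb{R}^+\times(-1,1),t^{\lambda'+\lambda''-1}dt\,d\mu_{\lambda',\lambda''}(v))$. The bijection $T_\iota:L^2_{\lambda',\lambda''}(\mathbb{R}^+\times\mathbb{R}^+)\to L^2_{\lambda',\lambda''}(\mathbb{R}^+\times(-1,1))$ is $$T_\iota f(t,v)=\left(\tfrac t2\right)^{2-\lambda'-\lambda''}(1-v)^{1-\lambda'}(1+v)^{1-\lambda''}f(\iota(t,v)),\qquad T_\iota^{-1}h(x,y)=x^{\lambda'-1}y^{\lambda''-1}h(\iota^{-1}(x,y)).$$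 Jacobi polynomials: $P_l^{\alpha,\beta}(v)=\frac{(-1)^l}{2^ll!}(1-v)^{-\alpha}(1+v)^{-\beta}\frac{d^l}{dv^l}\left[(1-v)^{\alpha+l}(1+v)^{\beta+l}\right]$; $\|P_l^{\lambda'-1,\lambda''-1}\|$ denotes the norm in $L^2((-1,1),d\mu_{\lambda',\lambda''})$. $V_l^{\lambda',\lambda''}=L^2(\mathbb{R}^+,t^{\lambda'+\lambda''-1}dt)\hat\otimes\mathbb{C}\cdot P_l^{\lambda'-1,\lambda''-1}(v)$, a closed subspace of $L^2_{\lambda',\lambda''}(\mathbb{R}^+\times(-1,1))$. The bijective isometry $\Theta:L^2_{\lambda'''}(\mathbb{R}^+)\to V_l^{\lambda',\lambda''}$ is $$\Theta(h)(t,v)=t^{-(\lambda'+\lambda''+l-1)}\frac{P_l^{\lambda'-1,\lambda''-1}(v)}{\|P_l^{\lambda'-1,\lambda''-1}\|}h(t).$$ The orthogonal projection onto $V_l^{\lambda',\lambda''}$ is $$\mathcal{J}_l^{\lambda',\lambda''}(h)(t,v)=\frac{P_l^{\lambda'-1,\lambda''-1}(v)}{\|P_l^{\lambda'-1,\lambda''-1}\|^2}\int_{-1}^1h(t,u)P_l^{\lambda'-1,\lambda''-1}(u)\,d\mu_{\lambda',\lambda''}(u).$$ A symmetry breaking operator is a continuous linear map from the big representation space to the small one intertwining the actions; a holographic operator is a continuous linear intertwining map in the opposite direction. *)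

(* Defs.v *)
From HB Require Import structures.
From mathcomp Require Import all_boot all_order all_algebra.
From mathcomp Require Import complex.
From mathcomp Require Import all_classical all_reals all_analysis.

Set Implicit Arguments.
Unset Strict Implicit.
Unset Printing Implicit Defensive.

Import Order.TTheory GRing.Theory Num.Theory.
Import numFieldNormedType.Exports.

Local Open Scope classical_set_scope.
Local Open Scope ring_scope.
Local Open Scope complex_scope.

Section complex_analysis.
Context {R : realType}.

Definition cexp (z : R[i]) : R[i] :=
  (expR (complex.Re z))%:C * (cos (complex.Im z) +i* sin (complex.Im z)).

Definition cintegral d (T : measurableType d) (mu : {measure set T -> \bar R})
    (D : set T) (f : T -> R[i]) : R[i] :=
  Rintegral mu D (fun x => complex.Re (f x)) +i*
  Rintegral mu D (fun x => complex.Im (f x)).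

Definition upper_half_plane : set R[i] := [set z | 0 < complex.Im z].

Definition holomorphic_on (D : set R[i]) (f : R[i] -> R[i]) : Prop :=
  forall z, D z -> derivable (f : R[i]^o -> R[i]^o) z 1.

End complex_analysis.

(* The elements of the weighted space L^2(D, w d mu) are functions; equality in
   that space is [eq_ae] below. Values outside of D are irrelevant. *)
Section weighted_L2.
Context d (T : measurableType d) (R : realType).
Variables (mu : {measure set T -> \bar R}) (D : set T) (w : T -> R).

Definition L2norm (f : T -> R[i]) : \bar R :=
  ((\int[mu]_(x in D)
     ((complex.Re (f x) ^+ 2 + complex.Im (f x) ^+ 2) * w x)%:E) `^ 2^-1)%E.

Definition L2 : set (T -> R[i]) := [set f |
  [/\ measurable_fun D (fun x => complex.Re (f x)),
      measurable_fun D (fun x => complex.Im (f x)) &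
      (L2norm f < +oo)%E]].

Definition eq_ae (f g : T -> R[i]) : Prop :=
  {ae mu, forall x, D x -> f x = g x}.

End weighted_L2.

(* The inverse of [F], seen as a map from the set [A] to a space whose equality
   is [eqY]. *)
Definition inverse_on (X : Type) (Y : Type) (R : realType)
    (A : set (X -> R[i])) (eqY : Y -> Y -> Prop) (F : (X -> R[i]) -> Y)
    (y : Y) : X -> R[i] :=
  xget (fun=> 0) [set h | A h /\ eqY (F h) y].

(* Completed tensor product of two operators on function spaces, where
   functions of two variables realize the completed tensor product of spaces of
   functions of one variable: [A] acts on the first variable and [B] on the
   second one, so that f1 (x) f2 is sent to A f1 (x) B f2. *)
Definition tensor_op (X1 X2 Y1 Y2 C : Type)
    (A : (X1 -> C) -> (Y1 -> C)) (B : (X2 -> C) -> (Y2 -> C))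
    (f : X1 * X2 -> C) : Y1 * Y2 -> C :=
  fun y => A (fun x1 => B (fun x2 => f (x1, x2)) y.2) y.1.

Section discrete_series.
Context {R : realType}.
Implicit Types (lambda : R) (z : R[i]).

(* Elements (g, phi) of the universal cover of SL_2(R); here (c d) is the
   second row of the inverse of g. Only the restriction of phi to the upper
   half-plane matters. *)
Record universal_SL2 := UniversalSL2 {
  SL2_mx : 'M[R]_2;
  SL2_log : R[i] -> R[i];
  SL2_det : \det SL2_mx = 1;
  SL2_log_holomorphic : holomorphic_on upper_half_plane SL2_log;
  SL2_logP : forall z, upper_half_plane z ->
    cexp (SL2_log z) =
      (invmx SL2_mx 1 0)%:C * z + (invmx SL2_mx 1 1)%:C }.

Definition mobius (A : 'M[R]_2) z : R[i] :=
  ((A 0 0)%:C * z + (A 0 1)%:C) / ((A 1 0)%:C * z + (A 1 1)%:C).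

Definition disc_series lambda (g : universal_SL2) (f : R[i] -> R[i]) z : R[i] :=
  cexp (- (lambda%:C * SL2_log g z)) * f (mobius (invmx (SL2_mx g)) z).

Definition disc_series2 (lambda1 lambda2 : R) (g : universal_SL2) :
    (R[i] * R[i] -> R[i]) -> (R[i] * R[i] -> R[i]) :=
  tensor_op (disc_series lambda1 g) (disc_series lambda2 g).

Lemma disc_series2_tensor lambda1 lambda2 g f1 f2 (z : R[i] * R[i]) :
  disc_series2 lambda1 lambda2 g (fun x => f1 x.1 * f2 x.2) z =
  disc_series lambda1 g f1 z.1 * disc_series lambda2 g f2 z.2.
Proof. by rewrite /disc_series2 /tensor_op /disc_series /= mulrA mulrACA. Qed.

End discrete_series.

Arguments universal_SL2 : clear implicits.

Section L2_model.
Context {R : realType}.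
Implicit Types (lambda : R) (g : universal_SL2 R).

Definition leb : {measure set (measurableTypeR R) -> \bar R} :=
  @lebesgue_measure R.

Definition leb2 :
    {measure set (measurableTypeR R * measurableTypeR R) -> \bar R} :=
  (@lebesgue_measure R \x @lebesgue_measure R)%E.

Definition halfline : set R := `]0, +oo[.

Definition L2R lambda : set (R -> R[i]) :=
  L2 leb halfline (fun t => t `^ (1 - lambda)).

Definition L2R2 (lambda1 lambda2 : R) : set (R * R -> R[i]) :=
  L2 leb2 (halfline `*` halfline)
    (fun p => p.1 `^ (1 - lambda1) * p.2 `^ (1 - lambda2)).

Definition laplace (h : R -> R[i]) (z : R[i]) : R[i] :=
  cintegral leb halfline (fun t => h t * cexp ('i%C * z * t%:C)).

Definition laplace2 : (R * R -> R[i]) -> (R[i] * R[i] -> R[i]) :=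
  tensor_op laplace laplace.

(* [laplace] is a bijection from L2R lambda onto the space of holomorphic
   functions on the upper half-plane that are square integrable for
   y^(lambda - 2) dx dy; likewise for [laplace2]. *)
Definition laplace_inv lambda : (R[i] -> R[i]) -> (R -> R[i]) :=
  inverse_on (L2R lambda)
    (fun f1 f2 => forall z, upper_half_plane z -> f1 z = f2 z) laplace.

Definition laplace2_inv (lambda1 lambda2 : R) :
    (R[i] * R[i] -> R[i]) -> (R * R -> R[i]) :=
  inverse_on (L2R2 lambda1 lambda2)
    (fun f1 f2 => forall z, (upper_half_plane `*` upper_half_plane) z ->
       f1 z = f2 z) laplace2.

Definition hat_pi lambda g : (R -> R[i]) -> (R -> R[i]) :=
  laplace_inv lambda \o disc_series lambda g \o laplace.

Definition hat_pi2 (lambda1 lambda2 : R) g : (R * R -> R[i]) -> (R * R -> R[i]) :=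
  laplace2_inv lambda1 lambda2 \o disc_series2 lambda1 lambda2 g \o laplace2.

End L2_model.

Section stratified_model.
Context {R : realType}.
Variables lambda1 lambda2 : R.

Definition strat : set (R * R) := halfline `*` `]-1, 1[%classic.

Definition iota_strat (p : R * R) : R * R :=
  (p.1 / 2 * (1 - p.2), p.1 / 2 * (1 + p.2)).

Definition iota_strat_inv (q : R * R) : R * R :=
  (q.1 + q.2, (q.2 - q.1) / (q.1 + q.2)).

Definition jacobi_weight (v : R) : R :=
  (1 - v) `^ (lambda1 - 1) * (1 + v) `^ (lambda2 - 1).

Definition strat_weight (p : R * R) : R :=
  p.1 `^ (lambda1 + lambda2 - 1) * jacobi_weight p.2.

Definition L2strat : set (R * R -> R[i]) := L2 leb2 strat strat_weight.

Definition T_iota (f : R * R -> R[i]) (p : R * R) : R[i] :=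
  ((p.1 / 2) `^ (2 - lambda1 - lambda2) *
   (1 - p.2) `^ (1 - lambda1) * (1 + p.2) `^ (1 - lambda2))%:C *
  f (iota_strat p).

Definition T_iota_inv (h : R * R -> R[i]) (q : R * R) : R[i] :=
  (q.1 `^ (lambda1 - 1) * q.2 `^ (lambda2 - 1))%:C * h (iota_strat_inv q).

Definition tau (g : universal_SL2 R) : (R * R -> R[i]) -> (R * R -> R[i]) :=
  T_iota \o hat_pi2 lambda1 lambda2 g \o T_iota_inv.

(* P_l^{alpha, beta} by its Rodrigues formula, meaningful on (-1, 1). *)
Definition jacobi (alpha beta : R) (l : nat) (v : R) : R :=
  (-1) ^+ l / (2 ^+ l * l`!%:R) *
  (1 - v) `^ (- alpha) * (1 + v) `^ (- beta) *
  derive1n l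
    (fun u : R => (1 - u) `^ (alpha + l%:R) * (1 + u) `^ (beta + l%:R)) v.

Variable l : nat.

Let P : R -> R := jacobi (lambda1 - 1) (lambda2 - 1) l.

Definition jacobi_norm : R :=
  Num.sqrt (Rintegral leb `]-1, 1[ (fun v => P v ^+ 2 * jacobi_weight v)).

Definition V_l : set (R * R -> R[i]) := [set f | L2strat f /\
  exists k : R -> R[i],
    L2 leb halfline (fun t => t `^ (lambda1 + lambda2 - 1)) k /\
    eq_ae leb2 strat f (fun p => k p.1 * (P p.2)%:C)].

Definition Theta (h : R -> R[i]) (p : R * R) : R[i] :=
  (p.1 `^ (- (lambda1 + lambda2 + l%:R - 1)) * (P p.2 / jacobi_norm))%:C *
  h p.1.

Definition Theta_inv (lambda3 : R) : (R * R -> R[i]) -> (R -> R[i]) :=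
  inverse_on (L2R lambda3) (eq_ae leb2 strat) Theta.

Definition tau_l (lambda3 : R) (g : universal_SL2 R) :
    (R * R -> R[i]) -> (R * R -> R[i]) :=
  Theta \o hat_pi lambda3 g \o Theta_inv lambda3.

Definition J_l (h : R * R -> R[i]) (p : R * R) : R[i] :=
  (P p.2 / jacobi_norm ^+ 2)%:C *
  cintegral leb `]-1, 1[ (fun u => h (p.1, u) * (P u * jacobi_weight u)%:C).

End stratified_model.

Section intertwiners.
Context {R : realType}.
Variables lambda1 lambda2 : R.

Let norm : (R * R -> R[i]) -> \bar R :=
  L2norm leb2 strat (strat_weight lambda1 lambda2).

(* [A] is a continuous linear map from [E] to [F] that intertwines the actions
   [tauE] and [tauF], where [E] and [F] are subspaces of
   [L2strat lambda1 lambda2]. *)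
Definition intertwining_operator
    (E : set (R * R -> R[i]))
    (tauE : universal_SL2 R -> (R * R -> R[i]) -> (R * R -> R[i]))
    (F : set (R * R -> R[i]))
    (tauF : universal_SL2 R -> (R * R -> R[i]) -> (R * R -> R[i]))
    (A : (R * R -> R[i]) -> (R * R -> R[i])) : Prop :=
  [/\ forall f, E f -> F (A f),
      forall (a : R[i]) f1 f2, E f1 -> E f2 ->
        eq_ae leb2 strat (A (fun p => a * f1 p + f2 p))
          (fun p => a * A f1 p + A f2 p),
      forall f, E f -> forall e : R, 0 < e -> exists2 r : R, 0 < r &
        forall f', E f' -> (norm (fun p => (f' p - f p)%R) < r%:E)%E ->
          (norm (fun p => (A f' p - A f p)%R) < e%:E)%E &
      forall g f, E f -> eq_ae leb2 strat (A (tauE g f)) (tauF g (A f))].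

End intertwiners.

(* Main.v *)
(** The functions k_u(t) = t^(lambda-1) conj(e^(iut)), u in the upper half-plane,
   represent the Laplace transform on L^2_lambda: laplace h u = <h, k_u>. Their
   Gram matrix is Gamma(lambda) (-i(z - conj u))^(-lambda), which the discrete
   series action preserves; since the k_u are total, this yields both the
   unitary operators [hat_pi g] and the principle that <[hat_pi g] F, p> = <F, q>
   as soon as the Laplace transform of p is the image under g of that of q.
   Put lambda3 = lambda1 + lambda2 + 2l, and let A be the adjoint of Theta, so
   that A Theta = 1 and J_l = Theta A. Expanding the Jacobi polynomial in powers
   of (1 - v)/2 and (1 + v)/2 expresses T_iota^-1 (Theta k_u) as a sum of
   products of kernels, whence by the binomial formula
     laplace2 (T_iota^-1 (Theta k_u)) (z1, z2) = C (z1 - z2)^l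
       (-i(z1 - conj u))^(-lambda1-l) (-i(z2 - conj u))^(-lambda2-l).
   This function of z and u is covariant, so A (tau g f) and hat_pi g (A f) have
   the same Laplace transform: this is the intertwining property of J_l. The
   one of the inclusion of V_l follows because tau g and hat_pi g preserve norms. *)
Require Import Defs.
From mathcomp Require Import all_boot all_order all_algebra.
From mathcomp Require Import complex.
From mathcomp Require Import all_classical all_reals all_analysis.
From mathcomp Require Import measurable_realfun.
From mathcomp Require Import ring lra.
Import Order.TTheory GRing.Theory Num.Theory.
Import numFieldNormedType.Exports.
Import Normc.
Local Open Scope ring_scope.
Set Implicit Arguments.
Unset Strict Implicit.
Unset Printing Implicit Defensive.

(** * Real semi-Hilbert spaces and unitary transport *)

(** [hat_pi], [hat_pi2] and [Theta_inv] are defined by choosing a preimage, so nothing is known of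
    them until a preimage is exhibited. For the Laplace transform one would usually invoke a
    Paley-Wiener theorem. It is avoided here: only transforms moved by g need a preimage, and these
    come from carrying a vector along the isometry between the closed spans of two families with the
    same Gram matrix. The same isometry gives adjoint relations without inverting g. Equality being
    almost everywhere, the pairings are only semi-definite, and the abstract part is set up for
    that. Two points are analytic. The power in the Gram matrix must be the branch dictated by
    [SL2_log]: exponentials alone leave a multiple of 2 pi i undetermined, which a continuity
    argument in the half-plane removes. And totality of the kernels is injectivity of the Laplace
    transform, proved from its values at i, 2i, 3i, ... only. The binomial formula appears because
    the coefficients of the Jacobi polynomial carry in their denominators exactly the Gamma factors
    of the Gram matrices. *)

Section semi_hilbert.
Local Open Scope classical_set_scope.
Context {R : realType} {V : Type}.
Variables (add : V -> V -> V) (sc : R -> V -> V) (E : set V).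
Variable ip : V -> V -> R.

Definition sub_by (x y : V) : V := add x (sc (-1) y).

(** [V] carries no vector space laws and [ip] may vanish on nonzero vectors, so that functions can
    be used without a quotient by almost everywhere equality. Completeness is asked only of
    sequences with norm increments at most 4^-n, a rate which the minimizing sequence below attains
    and which the pointwise convergence argument in weighted L2 exploits. *)
Definition semi_hilbert : Prop :=
  [/\ forall x y, E x -> E y -> E (add x y),
      forall a x, E x -> E (sc a x),
      forall x y, E x -> E y -> ip x y = ip y x,
      (forall x y z, E x -> E y -> E z -> ip (add x y) z = ip x z + ip y z) /\
      (forall a x z, E x -> E z -> ip (sc a x) z = a * ip x z) &
      (forall x, E x -> 0 <= ip x x) /\
      (forall u : nat -> V, (forall n, E (u n)) ->
        (forall n, ip (sub_by (u n.+1) (u n)) (sub_by (u n.+1) (u n))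
           <= 16^-1 ^+ n) ->
        exists2 v, E v &
          ip (sub_by (u n) v) (sub_by (u n) v) @[n --> \oo] --> 0)].

Hypothesis sH : semi_hilbert.

Let Eadd x y : E x -> E y -> E (add x y). Proof. by case: sH => + _ _ _ _; exact. Qed.
Let Esc a x : E x -> E (sc a x). Proof. by case: sH => _ + _ _ _; exact. Qed.
Let Esub x y : E x -> E y -> E (sub_by x y).
Proof. by move=> Ex Ey; apply: Eadd => //; exact: Esc. Qed.
Let ipC x y : E x -> E y -> ip x y = ip y x.
Proof. by case: sH => _ _ + _ _; exact. Qed.
Let ipDl x y z : E x -> E y -> E z -> ip (add x y) z = ip x z + ip y z.
Proof. by case: sH => _ _ _ [+ _] _; exact. Qed.
Let ipZl a x z : E x -> E z -> ip (sc a x) z = a * ip x z.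
Proof. by case: sH => _ _ _ [_ +] _; exact. Qed.
Let ip_ge0 x : E x -> 0 <= ip x x. Proof. by case: sH => _ _ _ _ [+ _]; exact. Qed.
Let ipDr x y z : E x -> E y -> E z -> ip z (add x y) = ip z x + ip z y.
Proof. by move=> Ex Ey Ez; rewrite ipC ?ipDl ?(ipC Ez)//; exact: Eadd. Qed.
Let ipZr a x z : E x -> E z -> ip z (sc a x) = a * ip z x.
Proof. by move=> Ex Ez; rewrite ipC ?ipZl ?(ipC Ez)//; exact: Esc. Qed.
Let ipBl x y z : E x -> E y -> E z -> ip (sub_by x y) z = ip x z - ip y z.
Proof. by move=> *; rewrite ipDl ?ipZl ?mulN1r//; exact: Esc. Qed.
Let ipBr x y z : E x -> E y -> E z -> ip z (sub_by x y) = ip z x - ip z y.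
Proof. by move=> *; rewrite ipDr ?ipZr ?mulN1r//; exact: Esc. Qed.

Lemma semi_hilbert_CS x y : E x -> E y -> ip x y ^+ 2 <= ip x x * ip y y.
Proof.
move=> Ex Ey.
have q a b : 0 <= a ^+ 2 * ip x x + 2 * a * b * ip x y + b ^+ 2 * ip y y.
  have Eax := Esc a Ex; have Eby := Esc b Ey.
  have := ip_ge0 (Eadd Eax Eby).
  rewrite ipDl ?ipDr ?ipZl ?ipZr// ?(ipC Ey Ex); last exact: Eadd.
  by congr (0 <= _); ring.
have xx := ip_ge0 Ex; have yy := ip_ge0 Ey.
have [y0|y0] := eqVneq (ip y y) 0; last first.
  have y1 : 0 < ip y y by rewrite lt_neqAle eq_sym y0.
  (* With these coefficients the form is [ip y y] times the difference of the two sides. *)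
  have := q (ip y y) (- ip x y) => h.
  rewrite -subr_ge0 -(pmulr_rge0 _ y1); apply: le_trans h _.
  by rewrite le_eqVlt; apply/orP; left; apply/eqP; ring.
rewrite y0 mulr0.
have [->|c0] := eqVneq (ip x y) 0; first by rewrite expr0n.
(* Here the form has no b^2 term, and this b makes it equal to [- ip x y ^+ 2]. *)
have := q (ip x y) (- (ip x x + 1) / 2).
rewrite y0 mulr0 addr0.
have -> : ip x y ^+ 2 * ip x x + 2 * ip x y * (- (ip x x + 1) / 2) * ip x y
  = - ip x y ^+ 2 by field.
by rewrite oppr_ge0.
Qed.

Lemma semi_hilbert_ip_eq0 x y : E x -> E y -> ip x x = 0 -> ip x y = 0.
Proof.
move=> Ex Ey x0; have := semi_hilbert_CS Ex Ey; rewrite x0 mul0r => h.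
by apply/eqP; rewrite -sqrf_eq0 eq_le h sqr_ge0.
Qed.

Lemma semi_hilbert_cvg_ip (u : nat -> V) v x :
  (forall n, E (u n)) -> E v -> E x ->
  ip (sub_by (u n) v) (sub_by (u n) v) @[n --> \oo] --> 0 ->
  ip (u n) x @[n --> \oo] --> ip v x.
Proof.
move=> Eu Ev Ex uv.
have h : ip (sub_by (u n) v) x ^+ 2 @[n --> \oo] --> 0.
  apply: (@squeeze_cvgr _ _ _ _ (fun=> 0)
      (fun n => ip (sub_by (u n) v) (sub_by (u n) v) * ip x x)) => /=.
  - near=> n; rewrite sqr_ge0/=; apply: semi_hilbert_CS => //; exact: Esub.
  - exact: cvg_cst.
  - by rewrite -(mul0r (ip x x)); apply: cvgM => //; exact: cvg_cst.
have h2 : `|ip (sub_by (u n) v) x| @[n --> \oo] --> 0.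
  under eq_fun do rewrite -sqrtr_sqr.
  by rewrite -(@sqrtr0 R); apply: cvg_comp h _; exact: sqrt_continuous.
apply/cvgrPdist_lt => e e0; move/cvgrPdist_lt : h2 => /(_ e e0).
apply: filterS => n; rewrite sub0r normrN normr_id ipBl// distrC.
by [].
Unshelve. all: by end_near.
Qed.

Section transport.
Variables (I : Type) (k k' : I -> V) (i0 : I).
Hypothesis Ek : forall i, E (k i).
Hypothesis Ek' : forall i, E (k' i).
Hypothesis gram : forall i j, ip (k i) (k j) = ip (k' i) (k' j).

(** The graph of the linear map from the span of [k'] to that of [k]. A relation is used because a
    vector may have several expressions as a combination; equality of the Gram matrices makes the
    relation isometric. *)
Inductive span_pair : V -> V -> Prop :=
| span_pair_gen i : span_pair (k' i) (k i)
| span_pair_add x y x' y' : span_pair x y -> span_pair x' y' ->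
    span_pair (add x x') (add y y')
| span_pair_sc a x y : span_pair x y -> span_pair (sc a x) (sc a y).

Let spanE x y : span_pair x y -> E x /\ E y.
Proof.
elim=> // [x1 y1 x2 y2 _ [? ?] _ [? ?]|a x1 y1 _ [? ?]]; split; by [exact: Eadd|exact: Esc].
Qed.

Let span_ip x y x' y' : span_pair x y -> span_pair x' y' -> ip x x' = ip y y'.
Proof.
move=> s s'; elim: s => {x y}.
- move=> i; elim: s' => {x' y'}.
  + by move=> j; rewrite gram.
  + move=> x1 y1 x2 y2 s1 h1 s2 h2.
    have [? ?] := spanE s1; have [? ?] := spanE s2.
    by rewrite !ipDr// h1 h2.
  + by move=> a x1 y1 s1 h1; have [? ?] := spanE s1; rewrite !ipZr// h1.
- have [? ?] := spanE s'.
  move=> x1 y1 x2 y2 s1 h1 s2 h2.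
  have [? ?] := spanE s1; have [? ?] := spanE s2.
  by rewrite !ipDl// h1 h2.
- have [? ?] := spanE s'.
  by move=> a x1 y1 s1 h1; have [? ?] := spanE s1; rewrite !ipZl// h1.
Qed.

Variable p : V.
Hypothesis Ep : E p.

(** The squared distance from x to [p] minus the constant [ip p p]; minimizing it over the span of
    [k'] yields the orthogonal projection of [p] on the closed span. *)
Let phi x := ip x x - 2 * ip p x.
Let Phi : set R := [set r | exists x y, span_pair x y /\ r = phi x].
Let m := inf Phi.

Let phi_lb x : E x -> - ip p p <= phi x.
Proof.
move=> Ex; have := ip_ge0 (Esub Ex Ep).
by rewrite ipBl ?ipBr//; [rewrite (ipC Ex Ep) /phi; lra|exact: Esub].
Qed.

Let Phi_inf : has_inf Phi.
Proof.
split; first by exists (phi (k' i0)), (k' i0), (k i0); split => //; exact: span_pair_gen.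
exists (- ip p p) => r [x [y [/spanE [Ex _] ->]]]; exact: phi_lb.
Qed.

Let m_le x y : span_pair x y -> m <= phi x.
Proof. by move=> s; apply: (ge_inf (proj2 Phi_inf)); exists x, y. Qed.

(** The tolerance is fixed by the parallelogram law: near minimizers at levels n and n + 1 then
    differ by at most 2 (1 + 1/16) / 4 times 16^-n in squared norm. *)
Let seq_ex n : exists xy : V * V,
  span_pair xy.1 xy.2 /\ phi xy.1 < m + 16^-1 ^+ n / 4.
Proof.
have e0 : 0 < 16^-1 ^+ n / 4 :> R by rewrite divr_gt0// exprn_gt0// invr_gt0.
by have [r [x [y [s ->]]] h] := inf_adherent e0 Phi_inf; exists (x, y).
Qed.

Let xy n := projT1 (cid (seq_ex n)).
Let X n := (xy n).1.
Let Y n := (xy n).2.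
Let sXY n : span_pair (X n) (Y n).
Proof. by rewrite /X /Y /xy; case: cid => ? []. Qed.
Let pX n : phi (X n) < m + 16^-1 ^+ n / 4.
Proof. by rewrite /X /xy; case: cid => ? []. Qed.
Let EX n : E (X n). Proof. by case: (spanE (sXY n)). Qed.
Let EY n : E (Y n). Proof. by case: (spanE (sXY n)). Qed.

Let span_sub x y x' y' : span_pair x y -> span_pair x' y' ->
  span_pair (sub_by x x') (sub_by y y').
Proof. by move=> s s'; apply: span_pair_add => //; exact: span_pair_sc. Qed.

Let cauchyX n : ip (sub_by (X n.+1) (X n)) (sub_by (X n.+1) (X n)) <= 16^-1 ^+ n.
Proof.
(* The midpoint of two near minimizers lies in the span, so [phi] is at least [m] there; the
   parallelogram law then bounds their distance. *)
have sm : span_pair (sc 2^-1 (add (X n.+1) (X n))) (sc 2^-1 (add (Y n.+1) (Y n))).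
  by apply: span_pair_sc; exact: span_pair_add.
have := m_le sm; have := pX n; have := pX n.+1.
rewrite /phi.
have Ea : E (add (X n.+1) (X n)) by exact: Eadd.
have Eb : E (sub_by (X n.+1) (X n)) by exact: Esub.
rewrite !(ipBl, ipBr)// !(ipZl, ipZr)//; last exact: Esc.
rewrite !(ipDl, ipDr)//.
rewrite (ipC (EX n.+1) (EX n)) exprS.
have e0 : 0 < 16^-1 ^+ n :> R by rewrite exprn_gt0// invr_gt0.
move: e0; set e := 16^-1 ^+ n.
set a := ip (X n.+1) (X n.+1); set b := ip (X n) (X n).
set c := ip (X n) (X n.+1); set d := ip p (X n); set f := ip p (X n.+1).
lra.
Qed.

(** [p'] is the projection of [p] on the closed span of [k'], and [q] is its image under the
    isometry extending [k' i |-> k i]: the images of a Cauchy sequence are Cauchy. The last clause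
    is an adjoint relation; it passes from generators to the span by linearity and to [p'] by
    continuity. *)
Lemma semi_hilbert_transport : exists p' q, [/\ E p', E q,
  forall i, ip p' (k' i) = ip p (k' i),
  forall i, ip q (k i) = ip p (k' i) &
  forall F H, E F -> E H ->
    (forall i, ip H (k' i) = ip F (k i)) -> ip H p' = ip F q].
Proof.
have [_ _ _ _ [_ cpl]] := sH.
have [p' Ep' Xp'] := cpl _ EX cauchyX.
have cauchyY n : ip (sub_by (Y n.+1) (Y n)) (sub_by (Y n.+1) (Y n)) <= 16^-1 ^+ n.
  rewrite -(span_ip (span_sub (sXY n.+1) (sXY n))
    (span_sub (sXY n.+1) (sXY n))).
  exact: cauchyX.
have [q Eq Yq] := cpl _ EY cauchyY.
(* Orthogonality of [p - p'] to the span: otherwise moving the minimizing sequence along [k' i]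
   would push [phi] below its infimum. *)
have key i : ip p' (k' i) = ip p (k' i).
  set x := k' i; set N := ip x x; set c := ip p' x - ip p x.
  have hc t : 0 <= 2 * t * c + t ^+ 2 * N.
    have cl : 2 * t * (ip (X n) x - ip p x) + t ^+ 2 * N + 16^-1 ^+ n / 4
        @[n --> \oo] --> 2 * t * c + t ^+ 2 * N + 0 / 4.
      apply: cvgD; last first.
        apply: cvgM; last exact: cvg_cst.
        by apply: cvg_expr; rewrite ger0_norm ?invr_ge0// invf_lt1// ltr1n.
      apply: cvgD; last exact: cvg_cst.
      apply: cvgM; first exact: cvg_cst.
      apply: cvgB; last exact: cvg_cst.
      exact: (semi_hilbert_cvg_ip EX Ep' (Ek' i) Xp').
    rewrite mul0r addr0 in cl.
    apply: (cvgr_to_ge cl); near=> n.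
    have Etx : E (sc t x) by apply: Esc; exact: Ek'.
    have sn : span_pair (add (X n) (sc t x)) (add (Y n) (sc t (k i))).
      by apply: span_pair_add => //; apply: span_pair_sc; exact: span_pair_gen.
    have := m_le sn; have := pX n; rewrite /phi.
    have Ex : E x := Ek' i.
    have Ea : E (add (X n) (sc t x)) by exact: Eadd.
    rewrite !(ipDl, ipDr)// !(ipZl, ipZr)// (ipC Ex (EX n)) -/N.
    set e := _ ^+ n / 4.
    have -> : t * (t * N) = t ^+ 2 * N by ring.
    set s := t ^+ 2 * N; set a := ip (X n) x; set b := ip p x.
    rewrite (_ : 2 * t * (a - b) = 2 * (t * a) - 2 * (t * b)); last by ring.
    set A := t * a; set B := t * b.
    lra.
  suff : c = 0 by move/eqP; rewrite subr_eq0 => /eqP.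
  apply/eqP/negPn/negP => c0.
  have N0 : 0 <= N by apply: ip_ge0; exact: Ek'.
  have c2 : 0 < c ^+ 2 by rewrite exprn_even_gt0.
  have N1 : 0 < N + 1 by rewrite ltr_wpDl.
  (* The optimal step is - c / N, but N may be zero; with N + 1 the value is still negative when c
     is nonzero. *)
  have := hc (- c / (N + 1)).
  have -> : 2 * (- c / (N + 1)) * c + (- c / (N + 1)) ^+ 2 * N
    = - (c ^+ 2 / (N + 1) ^+ 2 * (N + 2)) by field; rewrite gt_eqF.
  rewrite oppr_ge0 leNgt => /negP; apply.
  by apply: mulr_gt0; [apply: divr_gt0 => //; exact: exprn_gt0|exact: ltr_wpDl].
have lim F H : E F -> E H -> (forall i, ip H (k' i) = ip F (k i)) -> ip H p' = ip F q.
  move=> EF EH HF.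
  have sHF x y : span_pair x y -> ip H x = ip F y.
    elim=> // [x1 y1 x2 y2 s1 h1 s2 h2|a x1 y1 s1 h1];
      have [? ?] := spanE s1.
    - by have [? ?] := spanE s2; rewrite !ipDr// h1 h2.
    - by rewrite !ipZr// h1.
  have l1 := semi_hilbert_cvg_ip EX Ep' EH Xp'.
  have l2 := semi_hilbert_cvg_ip EY Eq EF Yq.
  rewrite (ipC EH Ep') (ipC EF Eq).
  have XY : (fun n => ip (X n) H) = (fun n => ip (Y n) F).
    by apply/funext => n; rewrite ipC// (ipC (EY n) EF) (sHF _ _ (sXY n)).
  rewrite XY in l1; apply: (cvg_unique _ l1) => //.
exists p', q; split => // i.
rewrite -key (ipC Eq (Ek i)) (ipC Ep' (Ek' i)); apply/esym.
(* The adjoint relation for F = [k i] and H = [k' i]; its premise is the equality of the Gram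
   matrices. *)
by apply: lim => // j; rewrite gram.
Unshelve. all: by end_near.
Qed.

End transport.

(* The hypotheses say that [H |-> F] and [p |-> q] are the unitary map sending
   each [k' i] to [k i]. *)
Lemma semi_hilbert_covariant (I : Type) (k k' : I -> V) (i0 : I) :
  (forall i, E (k i)) -> (forall i, E (k' i)) ->
  (forall i j, ip (k i) (k j) = ip (k' i) (k' j)) ->
  (forall x, E x -> (forall i, ip x (k i) = 0) -> ip x x = 0) ->
  (forall x, E x -> (forall i, ip x (k' i) = 0) -> ip x x = 0) ->
  forall F H p q, E F -> E H -> E p -> E q ->
  (forall i, ip H (k' i) = ip F (k i)) ->
  (forall i, ip p (k' i) = ip q (k i)) -> ip H p = ip F q.
Proof.
move=> Ek Ek' gram tk tk' F H p q EF EH Ep Eq HF pq.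
have [p' [q' [Ep' Eq' p'k q'k lim]]] :=
  semi_hilbert_transport i0 Ek Ek' gram Ep.
have Bp : E (sub_by p' p) by exact: Esub.
have Bq : E (sub_by q' q) by exact: Esub.
(* By totality [p' - p] is a null vector, hence invisible to H by Cauchy-Schwarz; likewise [q' - q]
   for F. *)
have p0 : ip (sub_by p' p) H = 0.
  apply: semi_hilbert_ip_eq0 => //; apply: tk' => // i.
  by rewrite ipBl// p'k subrr.
have q0 : ip (sub_by q' q) F = 0.
  apply: semi_hilbert_ip_eq0 => //; apply: tk => // i.
  by rewrite ipBl// q'k pq subrr.
have := lim _ _ EF EH HF.
move: p0 q0; rewrite !ipBl// => /eqP + /eqP.
rewrite !subr_eq0 => /eqP h1 /eqP h2.
by rewrite (ipC EH Ep') (ipC EF Eq') h1 h2 (ipC Ep EH) (ipC Eq EF).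
Qed.

End semi_hilbert.

(** * Complex-valued integrals *)

Section complex_numbers.
Local Open Scope complex_scope.
Context {R : realType}.
Implicit Types z w : R[i].

Lemma ReD z w : complex.Re (z + w) = complex.Re z + complex.Re w.
Proof. by case: z w => [? ?] [? ?]. Qed.

Lemma ImD z w : complex.Im (z + w) = complex.Im z + complex.Im w.
Proof. by case: z w => [? ?] [? ?]. Qed.

Lemma ReN z : complex.Re (- z) = - complex.Re z.
Proof. by case: z. Qed.

Lemma ImN z : complex.Im (- z) = - complex.Im z.
Proof. by case: z. Qed.

Lemma ReM z w : complex.Re (z * w) =
  complex.Re z * complex.Re w - complex.Im z * complex.Im w.
Proof. by case: z w => [? ?] [? ?]. Qed.

Lemma ImM z w : complex.Im (z * w) =
  complex.Re z * complex.Im w + complex.Im z * complex.Re w.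
Proof. by case: z w => [? ?] [? ?]. Qed.

Lemma ReJ z : complex.Re (conjc z) = complex.Re z.
Proof. by case: z. Qed.

Lemma ImJ z : complex.Im (conjc z) = - complex.Im z.
Proof. by case: z. Qed.

Lemma complex_eqP z w : complex.Re z = complex.Re w ->
  complex.Im z = complex.Im w -> z = w.
Proof. by case: z w => [? ?] [? ?] /= -> ->. Qed.

Definition cplxE := (ReD, ImD, ReN, ImN, ReM, ImM, ReJ, ImJ).

Definition csqn z : R := complex.Re z ^+ 2 + complex.Im z ^+ 2.

Lemma csqn_ge0 z : 0 <= csqn z.
Proof. by rewrite addr_ge0 ?sqr_ge0. Qed.

Lemma csqnM z w : csqn (z * w) = csqn z * csqn w.
Proof. by rewrite /csqn !cplxE; ring. Qed.

Lemma csqn_normc z : csqn z = normc z ^+ 2.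
Proof. by case: z => a b; rewrite /= sqr_sqrtr// addr_ge0 ?sqr_ge0. Qed.

Lemma csqnD_le z w : csqn (z + w) <= 2 * csqn z + 2 * csqn w.
Proof.
rewrite /csqn !cplxE.
move: (complex.Re z) (complex.Im z) (complex.Re w) (complex.Im w) => a b c d.
by have := sqr_ge0 (a - c); have := sqr_ge0 (b - d); rewrite !expr2; nra.
Qed.

Lemma csqnJ z : csqn (conjc z) = csqn z.
Proof. by rewrite /csqn !cplxE !sqrrN. Qed.

Lemma csqn_eq0 z : (csqn z == 0) = (z == 0).
Proof.
case: z => a b; rewrite /csqn/= paddr_eq0 ?sqr_ge0// !sqrf_eq0.
by rewrite eq_complex.
Qed.

Lemma csqnC (a : R) : csqn a%:C = a ^+ 2.
Proof. by rewrite /csqn/= expr0n addr0. Qed.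

Lemma normr_Re_le z : `|complex.Re z| <= normc z.
Proof.
by case: z => a b /=; rewrite -sqrtr_sqr ler_wsqrtr// lerDl sqr_ge0.
Qed.

Lemma normr_Im_le z : `|complex.Im z| <= normc z.
Proof.
by case: z => a b /=; rewrite -sqrtr_sqr ler_wsqrtr// lerDr sqr_ge0.
Qed.

Lemma normc_ge0 z : 0 <= normc z. Proof. by case: z => a b /=. Qed.

Lemma normcC (a : R) : normc a%:C = `|a|.
Proof. by rewrite /= expr0n addr0 sqrtr_sqr. Qed.

Lemma mulcJ z : z * conjc z = (csqn z)%:C.
Proof. by apply: complex_eqP; rewrite !cplxE/= /csqn; ring. Qed.

Lemma conjcM z w : conjc (z * w) = conjc z * conjc w.
Proof. by rewrite rmorphM. Qed.

Lemma conjcD z w : conjc (z + w) = conjc z + conjc w.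
Proof. by rewrite rmorphD. Qed.

End complex_numbers.

Section complex_integral.
Local Open Scope complex_scope.
Local Open Scope classical_set_scope.
Context d (T : measurableType d) (R : realType).
Variables (mu : {measure set T -> \bar R}) (D : set T).
Hypothesis mD : measurable D.
Implicit Types (f g : T -> R[i]) (c : R[i]).

Definition cmeasurable f := measurable_fun D (fun x => complex.Re (f x)) /\
  measurable_fun D (fun x => complex.Im (f x)).

Definition cintegrable f :=
  mu.-integrable D (fun x => (complex.Re (f x))%:E) /\
  mu.-integrable D (fun x => (complex.Im (f x))%:E).

Lemma cintegrable_measurable f : cintegrable f -> cmeasurable f.
Proof. by move=> [/measurable_int/measurable_EFinP ? /measurable_int/measurable_EFinP ?]. Qed.

Lemma cmeasurableM f g : cmeasurable f -> cmeasurable g ->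
  cmeasurable (fun x => f x * g x).
Proof.
move=> [f1 f2] [g1 g2]; split.
  under eq_fun do rewrite ReM.
  by apply: measurable_funB; exact: measurable_funM.
under eq_fun do rewrite ImM.
by apply: measurable_funD; exact: measurable_funM.
Qed.

Lemma cmeasurableD f g : cmeasurable f -> cmeasurable g ->
  cmeasurable (fun x => f x + g x).
Proof.
move=> [f1 f2] [g1 g2]; split.
  by under eq_fun do rewrite ReD; exact: measurable_funD.
by under eq_fun do rewrite ImD; exact: measurable_funD.
Qed.

Lemma cmeasurable_cst c : cmeasurable (fun=> c).
Proof. by split; exact: measurable_cst. Qed.

Lemma cmeasurableC (a : T -> R) : measurable_fun D a -> cmeasurable (fun x => (a x)%:C).
Proof. by move=> ma; split => //=; exact: measurable_cst. Qed.

Lemma cmeasurable_conj f : cmeasurable f -> cmeasurable (fun x => conjc (f x)).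
Proof.
move=> [f1 f2]; split; first by under eq_fun do rewrite ReJ.
under eq_fun do rewrite ImJ; exact: measurableT_comp.
Qed.

Lemma cmeasurable_csqn f : cmeasurable f -> measurable_fun D (fun x => csqn (f x)).
Proof. by move=> [f1 f2]; apply: measurable_funD; exact: measurable_funX. Qed.

Lemma eq_cmeasurable f g : {in D, f =1 g} -> cmeasurable f -> cmeasurable g.
Proof.
move=> fg [f1 f2]; split.
  by apply: eq_measurable_fun f1 => x xD; rewrite fg.
by apply: eq_measurable_fun f2 => x xD; rewrite fg.
Qed.

Lemma cintegrable_le f (g : T -> R) : cmeasurable f ->
  mu.-integrable D (EFin \o g) -> (forall x, D x -> normc (f x) <= g x) ->
  cintegrable f.
Proof.
move=> [f1 f2] gi fg; split; apply: (le_integrable mD _ _ gi) => //=.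
- exact/measurable_EFinP.
- move=> x Dx; rewrite lee_fin (le_trans (normr_Re_le _))// (le_trans (fg _ Dx))//.
  exact: ler_norm.
- exact/measurable_EFinP.
- move=> x Dx; rewrite lee_fin (le_trans (normr_Im_le _))// (le_trans (fg _ Dx))//.
  exact: ler_norm.
Qed.

Lemma cintegrableD f g : cintegrable f -> cintegrable g ->
  cintegrable (fun x => f x + g x).
Proof.
move=> [f1 f2] [g1 g2]; split.
  by under eq_fun do rewrite ReD EFinD; exact: integrableD.
by under eq_fun do rewrite ImD EFinD; exact: integrableD.
Qed.

Lemma cintegralD f g : cintegrable f -> cintegrable g ->
  cintegral mu D (fun x => f x + g x) = cintegral mu D f + cintegral mu D g.
Proof.
move=> [f1 f2] [g1 g2]; apply: complex_eqP; rewrite cplxE/=.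
  by rewrite -RintegralD//; apply: eq_Rintegral => x _; rewrite ReD.
by rewrite -RintegralD//; apply: eq_Rintegral => x _; rewrite ImD.
Qed.

Let intZ (a : R) (h : T -> R) : mu.-integrable D (fun x => (h x)%:E) ->
  mu.-integrable D (fun x => (a * h x)%:E).
Proof. by move=> hi; under eq_fun do rewrite EFinM; exact: integrableZl. Qed.

Lemma cintegrableZ c f : cintegrable f -> cintegrable (fun x => c * f x).
Proof.
move=> [f1 f2]; split.
  by under eq_fun do rewrite ReM EFinB; apply: integrableB => //; exact: intZ.
by under eq_fun do rewrite ImM EFinD; apply: integrableD => //; exact: intZ.
Qed.

Lemma cintegralZ c f : cintegrable f ->
  cintegral mu D (fun x => c * f x) = c * cintegral mu D f.
Proof.
move=> [f1 f2]; apply: complex_eqP; rewrite cplxE/=.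
  rewrite -!RintegralZl// -RintegralB//; last 2 first.
  - exact: intZ.
  - exact: intZ.
  by apply: eq_Rintegral => x _; rewrite ReM.
rewrite -!RintegralZl// -RintegralD//; last 2 first.
- exact: intZ.
- exact: intZ.
by apply: eq_Rintegral => x _; rewrite ImM.
Qed.

Lemma cintegral_conj f : cintegrable f ->
  cintegral mu D (fun x => conjc (f x)) = conjc (cintegral mu D f).
Proof.
move=> [f1 f2]; apply: complex_eqP; rewrite cplxE/=.
  by apply: eq_Rintegral => x _; rewrite ReJ.
rewrite -mulN1r -RintegralZl//.
by apply: eq_Rintegral => x _; rewrite ImJ mulN1r.
Qed.

Lemma eq_cintegral f g : {in D, f =1 g} -> cintegral mu D f = cintegral mu D g.
Proof.
by move=> fg; apply: complex_eqP => /=; apply: eq_Rintegral => x xD; rewrite fg.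
Qed.

Lemma eq_cintegrable f g : {in D, f =1 g} -> cintegrable f -> cintegrable g.
Proof.
move=> fg [f1 f2]; split.
  by apply: eq_integrable f1 => // x xD; rewrite fg.
by apply: eq_integrable f2 => // x xD; rewrite fg.
Qed.

Lemma ae_eq_cintegral f g : cmeasurable f -> cmeasurable g -> eq_ae mu D f g ->
  cintegral mu D f = cintegral mu D g.
Proof.
move=> [f1 f2] [g1 g2] fg; apply: complex_eqP; rewrite /= /Rintegral.
- congr fine; apply: ae_eq_integral => //; try exact/measurable_EFinP.
  by apply: filterS fg => x h Dx; rewrite h.
- congr fine; apply: ae_eq_integral => //; try exact/measurable_EFinP.
  by apply: filterS fg => x h Dx; rewrite h.
Qed.

End complex_integral.

(** * Tonelli and Fubini over a measurable rectangle *)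

Section fubini_rectangle.
Local Open Scope complex_scope.
Local Open Scope classical_set_scope.
Context d1 d2 (T1 : measurableType d1) (T2 : measurableType d2) (R : realType).
Variables (m1 : {sigma_finite_measure set T1 -> \bar R})
  (m2 : {sigma_finite_measure set T2 -> \bar R}).
Variables (D1 : set T1) (D2 : set T2).
Hypotheses (mD1 : measurable D1) (mD2 : measurable D2).
Local Notation m12 := (m1 \x m2)%E.

Let mD : measurable (D1 `*` D2). Proof. exact: measurableX. Qed.

Let sectionE (F : T1 * T2 -> \bar R) : (fun x => \int[m2]_y (F \_ (D1 `*` D2)) (x, y))%E =
  (fun x => \int[m2]_(y in D2) F (x, y))%E \_ D1.
Proof.
apply/funext => x; rewrite patchE; case: ifPn => xD1.
  rewrite [RHS]integral_mkcond; apply: eq_integral => y _.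
  by rewrite !patchE in_setX/= xD1.
by rewrite integral0_eq// => y _; rewrite patchE in_setX/= (negbTE xD1).
Qed.

Let sectionE2 (F : T1 * T2 -> \bar R) : (fun y => \int[m1]_x (F \_ (D1 `*` D2)) (x, y))%E =
  (fun y => \int[m1]_(x in D1) F (x, y))%E \_ D2.
Proof.
apply/funext => y; rewrite patchE; case: ifPn => xD2.
  rewrite [RHS]integral_mkcond; apply: eq_integral => x _.
  by rewrite !patchE in_setX/= xD2 andbT.
by rewrite integral0_eq// => x _; rewrite patchE in_setX/= (negbTE xD2) andbF.
Qed.

Let mR (F : T1 * T2 -> \bar R) : measurable_fun (D1 `*` D2) F ->
  measurable_fun setT (F \_ (D1 `*` D2)).
Proof. by move=> mF; apply/(measurable_restrictT F mD). Qed.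

Let R0 (F : T1 * T2 -> \bar R) : (forall p, (D1 `*` D2) p -> (0 <= F p)%E) ->
  forall p, (0 <= (F \_ (D1 `*` D2)) p)%E.
Proof. by move=> F0 p; rewrite patchE; case: ifPn => // /set_mem /F0. Qed.

Lemma tonelli_measurable1 F : measurable_fun (D1 `*` D2) F ->
  (forall p, (D1 `*` D2) p -> (0 <= F p)%E) ->
  measurable_fun D1 (fun x => \int[m2]_(y in D2) F (x, y))%E.
Proof.
move=> mF F0; apply/(measurable_restrictT _ mD1); rewrite -sectionE.
exact: (@measurable_fun_fubini_tonelli_F _ _ _ _ _ m2 _ (mR mF) (R0 F0)).
Qed.

Lemma tonelli1 F : measurable_fun (D1 `*` D2) F ->
  (forall p, (D1 `*` D2) p -> (0 <= F p)%E) ->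
  (\int[m12]_(p in D1 `*` D2) F p = \int[m1]_(x in D1) \int[m2]_(y in D2) F (x, y))%E.
Proof.
move=> mF F0; rewrite integral_mkcond fubini_tonelli1; [|exact: mR|exact: R0].
by rewrite [RHS]integral_mkcond -sectionE.
Qed.

Lemma measurable_section1 d3 (T3 : measurableType d3)
    (F : T1 * T2 -> T3) x : measurable_fun (D1 `*` D2) F -> D1 x ->
  measurable_fun D2 (fun y => F (x, y)).
Proof.
move=> mF D1x mD2' Y mY.
have := mF mD _ mY => /(measurable_xsection x); congr measurable.
apply/seteqP; split => y; rewrite /xsection/=.
- by move=> /set_mem [[_ ?] ?].
- by move=> [? ?]; rewrite inE.
Qed.

(** The inner integral in Fubini's theorem is extended real valued, whereas [Rintegral] takes its
    [fine] part; an integrable function is finite off a null set, so the two agree there. *)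
Lemma integrable_fine d (T : measurableType d) (mu : {measure set T -> \bar R}) (D : set T)
  (F : T -> \bar R) : measurable D -> mu.-integrable D F ->
  mu.-integrable D (EFin \o (fine \o F)) /\
  (\int[mu]_(x in D) (fine (F x))%:E = \int[mu]_(x in D) F x)%E.
Proof.
move=> mD' iF; have ae : ae_eq mu D (EFin \o (fine \o F)) F.
  apply: filterS (integrable_ae mD' iF) => x h Dx /=.
  by rewrite fineK// h.
have mF := measurable_int _ iF.
have mf : measurable_fun D (EFin \o (fine \o F)).
  by apply/measurable_EFinP; apply: measurableT_comp => //.
split; last exact: ae_eq_integral.
apply/integrableP; split => //; move/integrableP : iF => [_].
congr (_ < _)%E; apply: ae_eq_integral => //; try exact: measurableT_comp.
by apply: filterS ae => x h Dx; rewrite h.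
Qed.

Lemma fubini_Rintegral (g : T1 * T2 -> R) :
  m12.-integrable (D1 `*` D2) (EFin \o g) ->
  [/\ m1.-integrable D1 (EFin \o (fun x => Rintegral m2 D2 (fun y => g (x, y)))),
    {ae m1, forall x, D1 x -> m2.-integrable D2 (fun y => (g (x, y))%:E)} &
    Rintegral m12 (D1 `*` D2) g =
    Rintegral m1 D1 (fun x => Rintegral m2 D2 (fun y => g (x, y)))].
Proof.
move=> gi; have gi' := gi; move: gi'; rewrite integrable_mkcond// => gi'.
have iF := integrable_fubini_F gi'.
have FE := sectionE (EFin \o g); rewrite /= in FE.
move: iF; rewrite /fubini_F FE -integrable_mkcond// => iF.
have [i1 e1] := integrable_fine mD1 iF.
split => //.
  apply: filterS (ae_integrable1 gi') => x h D1x.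
  have -> : (fun y => (g (x, y))%:E) = (fun y => (EFin \o g) (x, y)) by [].
  rewrite integrable_mkcond//; move: h; congr (integrable _ _ _).
  apply/funext => y /=; rewrite !patchE in_setX/= (mem_set D1x)//.
rewrite /Rintegral integral_mkcond -(integral12_prod_meas1 gi') /fubini_F FE.
by congr fine; rewrite e1 [RHS]integral_mkcond.
Qed.

Lemma fubini_cintegral (g : T1 * T2 -> R[i]) :
  cintegrable m12 (D1 `*` D2) g ->
  [/\ cintegrable m1 D1 (fun x => cintegral m2 D2 (fun y => g (x, y))),
    {ae m1, forall x, D1 x -> cintegrable m2 D2 (fun y => g (x, y))} &
    cintegral m12 (D1 `*` D2) g =
    cintegral m1 D1 (fun x => cintegral m2 D2 (fun y => g (x, y)))].
Proof.
move=> [/fubini_Rintegral[a1 b1 c1] /fubini_Rintegral[a2 b2 c2]]; split => //.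
  by apply: filterS2 b1 b2 => x h1 h2 Dx; split; [exact: h1|exact: h2].
by apply: complex_eqP; rewrite /= ?c1 ?c2.
Qed.

Lemma tonelli_integrable F : measurable_fun (D1 `*` D2) F ->
  (\int[m1]_(x in D1) \int[m2]_(y in D2) `|F (x, y)| < +oo)%E ->
  m12.-integrable (D1 `*` D2) F.
Proof.
move=> mF iF; apply/integrableP; split => //.
by rewrite tonelli1//; exact: measurableT_comp.
Qed.

End fubini_rectangle.

(** * Weighted square-integrable functions *)

Section geometric_cauchy.
Local Open Scope classical_set_scope.
Context {R : realType}.

(** The increments from n on sum to at most 2 M 2^-n. Subtracting this tail from a gives a
    nondecreasing sequence, adding it a nonincreasing one, so monotone convergence yields both the
    limit and the error bound. *)
Lemma geometric_cauchy_cvg (a : nat -> R) (M : R) :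
  (forall n, `|a n.+1 - a n| <= M * 2^-1 ^+ n) ->
  exists2 L, a n @[n --> \oo] --> L &
    forall n, `|L - a n| <= 2 * M * 2^-1 ^+ n.
Proof.
move=> aM.
pose b n := a n - 2 * M * 2^-1 ^+ n.
pose c n := a n + 2 * M * 2^-1 ^+ n.
have half n : 2 * M * 2^-1 ^+ n.+1 = M * 2^-1 ^+ n by rewrite exprS; field.
have nb : nondecreasing_seq b.
  apply/nondecreasing_seqP => n; rewrite /b half.
  have := aM n; rewrite ler_norml => /andP[+ _].
  by set e := 2^-1 ^+ n; rewrite -mulrA; set f := M * e; lra.
have nc : nonincreasing_seq c.
  apply/nonincreasing_seqP => n; rewrite /c half.
  have := aM n; rewrite ler_norml => /andP[_].
  by set e := 2^-1 ^+ n; rewrite -mulrA; set f := M * e; lra.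
have M0 : 0 <= M by have := aM 0; rewrite expr0 mulr1; apply: le_trans.
have bc n m : b n <= c m.
  have bcn k : b k <= c k.
    rewrite /b /c lerD2l lerNl (le_trans (y := 0)) ?oppr_le0 ?mulr_ge0 ?exprn_ge0 ?invr_ge0//.
  apply: (le_trans (nb _ _ (leq_maxl n m))); apply: (le_trans (bcn _)).
  exact: (nc _ _ (leq_maxr n m)).
have cvb : cvgn b.
  apply: nondecreasing_is_cvgn => //; exists (c 0) => _ [n _ <-]; exact: bc.
have v0 : 2 * M * 2^-1 ^+ n @[n --> \oo] --> (0 : R).
  rewrite -(mulr0 (2 * M)); apply: cvgM; first exact: cvg_cst.
  by apply: cvg_expr; rewrite ger0_norm ?invr_ge0// invf_lt1// ltr1n.
have cva : a n @[n --> \oo] --> limn b.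
  have -> : a = (fun n => b n + 2 * M * 2^-1 ^+ n).
    by apply/funext => n; rewrite /b subrK.
  by rewrite -[limn b]addr0; apply: cvgD.
exists (limn b) => // n.
have h1 : b n <= limn b by apply: nondecreasing_cvgn_le.
have h2 : limn b <= c n by apply: limr_le => //; apply: nearW => k; exact: bc.
by move: h1 h2; rewrite /b /c ler_norml; lra.
Qed.

End geometric_cauchy.

Section weighted_L2_theory.
Local Open Scope complex_scope.
Local Open Scope classical_set_scope.
Context d (T : measurableType d) (R : realType).
Variables (mu : {measure set T -> \bar R}) (D : set T) (w : T -> R).
Hypotheses (mD : measurable D) (mw : measurable_fun D w)
  (w_gt0 : forall x, D x -> 0 < w x).
Implicit Types (f g : T -> R[i]) (c : R[i]).
Local Notation L2 := (L2 mu D w).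

Definition L2sq f : R := Rintegral mu D (fun x => csqn (f x) * w x).

Definition cip f g : R[i] :=
  cintegral mu D (fun x => f x * conjc (g x) * (w x)%:C).

Definition rip f g : R := complex.Re (cip f g).

Let w_ge0 x : D x -> 0 <= w x. Proof. by move/w_gt0/ltW. Qed.

Let msqn f : cmeasurable D f -> measurable_fun D (fun x => csqn (f x) * w x).
Proof. by move=> mf; apply: measurable_funM => //; exact: cmeasurable_csqn. Qed.

Let sqn0 f x : D x -> (0 <= (csqn (f x) * w x)%:E)%E.
Proof. by move=> Dx; rewrite lee_fin mulr_ge0 ?csqn_ge0 ?w_ge0. Qed.

(** [L2norm] is a square root in the extended reals; it is finite exactly when the integral is. *)
Lemma L2P f : L2 f <-> cmeasurable D f /\
  mu.-integrable D (fun x => (csqn (f x) * w x)%:E).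
Proof.
have E : cmeasurable D f -> (L2norm mu D w f < +oo)%E <->
    mu.-integrable D (fun x => (csqn (f x) * w x)%:E).
  move=> mf; rewrite /L2norm /=.
  have -> : (\int[mu]_(x in D) ((complex.Re (f x) ^+ 2 + complex.Im (f x) ^+ 2) * w x)%:E =
     \int[mu]_(x in D) `|(csqn (f x) * w x)%:E|)%E.
    apply: eq_integral => x /set_mem Dx; rewrite gee0_abs//; exact: sqn0.
  have I0 : (0 <= \int[mu]_(x in D) `|(csqn (f x) * w x)%:E|)%E by exact: integral_ge0.
  split => [h|/integrableP[_ h]].
    apply/integrableP; split; first exact/measurable_EFinP/msqn.
    move: h I0; case: (integral _ _ _) => [r _ _|/=|//]; first exact: ltry.
    by rewrite invr_eq0 pnatr_eq0.
  by apply: poweR_lty.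
split=> [[f1 f2 h]|[[f1 f2] h]].
  by split => //; apply/E.
by split => //; apply/E.
Qed.

Lemma L2_cmeasurable f : L2 f -> cmeasurable D f.
Proof. by move=> /L2P[]. Qed.

Lemma L2norm_sq f : L2 f -> L2norm mu D w f = (Num.sqrt (L2sq f))%:E.
Proof.
move=> /L2P[mf fi]; rewrite /L2norm -/(csqn _).
have -> : (\int[mu]_(x in D) ((complex.Re (f x) ^+ 2 + complex.Im (f x) ^+ 2) * w x)%:E =
     (L2sq f)%:E)%E.
  by rewrite /L2sq /Rintegral fineK//; exact: integrable_fin_num.
rewrite poweR_EFin powR12_sqrt//.
by apply: Rintegral_ge0 => x Dx; have := @sqn0 f x Dx; rewrite lee_fin.
Qed.

Lemma L2sq_ge0 f : 0 <= L2sq f.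
Proof. by apply: Rintegral_ge0 => x Dx; have := @sqn0 f x Dx; rewrite lee_fin. Qed.

Lemma L2D f g : L2 f -> L2 g -> L2 (fun x => f x + g x).
Proof.
move=> /L2P[mf fi] /L2P[mg gi]; apply/L2P; split; first exact: cmeasurableD.
have i : mu.-integrable D (fun x => (2 * (csqn (f x) * w x) + 2 * (csqn (g x) * w x))%:E).
  under eq_fun do rewrite EFinD EFinM (EFinM 2).
  by apply: integrableD => //; exact: integrableZl.
apply: (le_integrable mD _ _ i).
  exact/measurable_EFinP/msqn/cmeasurableD.
move=> x Dx; have wx := w_ge0 Dx.
rewrite lee_fin !ger0_norm ?addr_ge0 ?mulr_ge0 ?csqn_ge0//.
by rewrite !mulrA -mulrDl ler_wpM2r// csqnD_le.
Qed.

Lemma L2Z c f : L2 f -> L2 (fun x => c * f x).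
Proof.
move=> /L2P[mf fi]; apply/L2P; split.
  by apply: cmeasurableM => //; exact: cmeasurable_cst.
under eq_fun do rewrite csqnM -mulrA EFinM.
exact: integrableZl.
Qed.

Lemma L2B f g : L2 f -> L2 g -> L2 (fun x => f x - g x).
Proof.
move=> Lf Lg; have := L2D Lf (L2Z (-1) Lg); congr (Defs.L2 _ _ _).
by apply/funext => x; rewrite mulN1r.
Qed.

Lemma L2_dominated f (h : T -> R) : cmeasurable D f ->
  mu.-integrable D (EFin \o h) -> (forall x, D x -> csqn (f x) * w x <= h x) -> L2 f.
Proof.
move=> mf hi fh; apply/L2P; split => //; apply: (le_integrable mD _ _ hi).
  exact/measurable_EFinP/msqn.
move=> x Dx; rewrite lee_fin ger0_norm ?mulr_ge0 ?csqn_ge0 ?w_ge0//.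
by rewrite (le_trans (fh _ Dx))// ler_norm.
Qed.

Lemma L2_cintegrable f g : L2 f -> L2 g ->
  cintegrable mu D (fun x => f x * conjc (g x) * (w x)%:C).
Proof.
move=> /L2P[mf fi] /L2P[mg gi].
apply: (@cintegrable_le _ _ _ _ _ mD _
  (fun x => csqn (f x) * w x + csqn (g x) * w x)).
- apply: cmeasurableM; last exact: cmeasurableC.
  by apply: cmeasurableM => //; exact: cmeasurable_conj.
- by apply: (@integrableD _ _ _ mu D mD (fun x => (csqn (f x) * w x)%:E)
     (fun x => (csqn (g x) * w x)%:E)).
- move=> x Dx; rewrite !normcM normcC ger0_norm ?w_ge0// -mulrDl.
  rewrite ler_wpM2r ?w_ge0//.
  have -> : normc (conjc (g x)) = normc (g x) by case: (g x) => a b; rewrite /= sqrrN.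
  rewrite !csqn_normc.
  move: (normc_ge0 (f x)) (normc_ge0 (g x)); set a := normc _; set b := normc _.
  by move=> a0 b0; have := sqr_ge0 (a - b); rewrite !expr2; nra.
Qed.

Lemma eq_cip f f' g g' : {in D, f =1 f'} -> {in D, g =1 g'} -> cip f g = cip f' g'.
Proof. by move=> ff gg; apply: eq_cintegral => x xD; rewrite ff// gg. Qed.

Lemma ae_eq_cip f f' g : cmeasurable D f -> cmeasurable D f' -> cmeasurable D g ->
  eq_ae mu D f f' -> cip f g = cip f' g.
Proof.
have m h : cmeasurable D h -> cmeasurable D g ->
    cmeasurable D (fun x => h x * conjc (g x) * (w x)%:C).
  move=> mh mg; apply: cmeasurableM; last exact: cmeasurableC.
  by apply: cmeasurableM => //; exact: cmeasurable_conj.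
move=> mf mf' mg ff; apply: ae_eq_cintegral => //; try exact: m.
by apply: filterS ff => x h Dx; rewrite h.
Qed.

Lemma cipC f g : L2 f -> L2 g -> cip g f = conjc (cip f g).
Proof.
move=> Lf Lg; rewrite -cintegral_conj//; last exact: L2_cintegrable.
by apply: eq_cintegral => x _; rewrite !conjcM conjcK conjc_real mulrAC mulrC mulrA mulrAC.
Qed.

Lemma cipDl f g h : L2 f -> L2 g -> L2 h ->
  cip (fun x => f x + g x) h = cip f h + cip g h.
Proof.
move=> Lf Lg Lh; rewrite -cintegralD//; try exact: L2_cintegrable.
by apply: eq_cintegral => x _; rewrite !mulrDl.
Qed.

Lemma cipZl c f h : L2 f -> L2 h -> cip (fun x => c * f x) h = c * cip f h.
Proof.
move=> Lf Lh; rewrite -cintegralZ//; last exact: L2_cintegrable.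
by apply: eq_cintegral => x _; rewrite !mulrA.
Qed.

Lemma cipZr c f h : L2 f -> L2 h -> cip f (fun x => c * h x) = conjc c * cip f h.
Proof.
move=> Lf Lh; rewrite -cintegralZ//; last exact: L2_cintegrable.
by apply: eq_cintegral => x _; rewrite conjcM; ring.
Qed.

Lemma cip_sq f : L2 f -> cip f f = (L2sq f)%:C.
Proof.
move=> Lf; apply: complex_eqP => /=.
  by apply: eq_Rintegral => x _; rewrite mulcJ !cplxE/= mulr0 subr0.
rewrite (@eq_Rintegral _ _ _ _ _ (fun=> 0)) ?/Rintegral ?integral0//.
by move=> x _; rewrite mulcJ !cplxE/= mulr0 mul0r addr0.
Qed.

Lemma L2sq_eq0 f : L2 f -> L2sq f = 0 -> eq_ae mu D f (fun=> 0).
Proof.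
move=> /L2P[mf fi] h.
have m1 := measurable_int _ fi.
have [+ _] := @ae_eq_integral_abs _ _ _ mu D mD _ m1.
have -> : (\int[mu]_(x in D) `|(csqn (f x) * w x)%:E| = 0)%E.
  rewrite -[RHS]/(0%:E) -h /L2sq /Rintegral fineK; last exact: integrable_fin_num.
  by apply: eq_integral => x /set_mem Dx; rewrite gee0_abs//; exact: sqn0.
move=> /(_ erefl); apply: filterS => x hx Dx; apply/eqP; rewrite -csqn_eq0.
have := hx Dx => /= -[] /eqP; rewrite mulf_eq0 => /orP[//|/eqP w0].
by have := w_gt0 Dx; rewrite w0 ltxx.
Qed.

(** Riesz-Fischer. The squared increments are weighted by 4^n: their sum [S] has integral at most
    the sum of 4^n 16^-n, so it is finite almost everywhere, and where it is finite the values
    [u n x] converge geometrically. *)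
Lemma L2_complete (u : nat -> T -> R[i]) : (forall n, L2 (u n)) ->
  (forall n, L2sq (fun x => u n.+1 x - u n x) <= 16^-1 ^+ n) ->
  exists2 f, L2 f & L2sq (fun x => u n x - f x) @[n --> \oo] --> 0.
Proof.
move=> Lu hu.
have mu_ n : cmeasurable D (u n) by exact: L2_cmeasurable.
pose dn n x := u n.+1 x - u n x.
have Ld n : L2 (dn n) by exact: L2B.
pose t n x : \bar R := (4 ^+ n * (csqn (dn n x) * w x))%:E.
have t0 n x : D x -> (0 <= t n x)%E.
  by move=> Dx; rewrite lee_fin !mulr_ge0 ?exprn_ge0 ?csqn_ge0 ?w_ge0.
have mt n : measurable_fun D (t n).
  apply/measurable_EFinP/measurable_funM; first exact: measurable_cst.
  exact/msqn/L2_cmeasurable.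
pose S x := (\sum_(n <oo) t n x)%E.
have S0 x : D x -> (0 <= S x)%E.
  by move=> Dx; apply: nneseries_ge0 => n _ _; exact: t0.
have mS : measurable_fun D S.
  by apply: ge0_emeasurable_sum => // n x Dx _; exact: t0.
have IS : (\int[mu]_(x in D) S x < +oo)%E.
  rewrite integral_nneseries//.
  apply: (@le_lt_trans _ _ (\sum_(n <oo) (4^-1 ^+ n)%:E)%E).
    apply: lee_nneseries => n ?; first by move=> _; apply: integral_ge0 => x Dx; exact: t0.
    have /L2P[md di] := Ld n.
    rewrite /t; under eq_integral do rewrite EFinM.
    rewrite integralZl//.
    have -> : (\int[mu]_(x in D) (csqn (dn n x) * w x)%:E = (L2sq (dn n))%:E)%E.
      by rewrite /L2sq /Rintegral fineK//; exact: integrable_fin_num.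
    rewrite -EFinM lee_fin (le_trans (ler_wpM2l _ (hu n))) ?exprn_ge0//.
    by rewrite -exprMn (_ : 4 * 16^-1 = 4^-1 :> R)//; field.
  apply: (@le_lt_trans _ _ (1 / (1 - 4^-1) : R)%:E); last exact: ltry.
  apply: lime_le.
    by apply: is_cvg_nneseries => n _ _; rewrite lee_fin exprn_ge0 ?invr_ge0.
  apply: nearW => n; rewrite sumEFin lee_fin.
  apply: le_trans (@geometric_le_lim _ n 1 4^-1 _ _ _) => //.
  - rewrite /series/= le_eqVlt; apply/orP; left; apply/eqP.
    by apply: eq_bigr => i _; rewrite /geometric/= mul1r.
  - by rewrite ger0_norm ?invr_ge0// invf_lt1// ltr1n.
(* An upper limit exists at every point, so the limit function is measurable without singling out an
   exceptional set. *)
pose reu x := fine (limn_esup (fun n => (complex.Re (u n x))%:E)).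
pose imu x := fine (limn_esup (fun n => (complex.Im (u n x))%:E)).
pose f x := reu x +i* imu x.
have mlim (v : nat -> T -> R) : (forall n, measurable_fun D (v n)) ->
    measurable_fun D (fun x => fine (limn_esup (fun n => (v n x)%:E))).
  move=> mv.
  have := @measurable_fun_limn_esup _ _ _ D (fun n x => (v n x)%:E) _.
  by move=> h; apply: measurableT_comp => //; apply: h => n; exact/measurable_EFinP.
have mf : cmeasurable D f.
  by split => /=; apply: mlim => n; case: (mu_ n).
(* Where [S] is infinite the bound is trivial. Elsewhere the real and the imaginary part are each
   within 2 M 2^-n of their limits, with M^2 = S / w; the two squares add up to 8 M^2 4^-n. *)
have key n x : D x -> ((csqn (u n x - f x) * w x)%:E <= (8 * 4^-1 ^+ n)%:E * S x)%E.
  move=> Dx; have wx := w_gt0 Dx; have := S0 _ Dx.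
  case Sx : (S x) => [s| |]// s0; last first.
    by rewrite gt0_muley ?leey// lte_fin mulr_gt0// exprn_gt0// invr_gt0.
  rewrite lee_fin in s0.
  have ts k : 4 ^+ k * (csqn (dn k x) * w x) <= s.
    rewrite -lee_fin -Sx.
    apply: le_trans (@nneseries_lim_ge _ _ xpredT 0 k.+1 _); last first.
      by move=> m _ _; exact: t0.
    rewrite big_nat_recr//= leeDr//; apply: sume_ge0 => m _; exact: t0.
  pose M := Num.sqrt (s / w x).
  have MM : M ^+ 2 = s / w x by rewrite sqr_sqrtr// divr_ge0// ltW.
  have dM k : csqn (dn k x) <= (M * 2^-1 ^+ k) ^+ 2.
    rewrite exprMn MM -exprM mulnC exprM.
    rewrite (_ : 2^-1 ^+ 2 = 4^-1 :> R); last by field.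
    rewrite exprVn ler_pdivlMr ?exprn_gt0// ler_pdivlMr//.
    by have := ts k; congr (_ <= _); ring.
  have M0 : 0 <= M by exact: sqrtr_ge0.
  have e0 k : 0 <= M * 2^-1 ^+ k by rewrite mulr_ge0// exprn_ge0// invr_ge0.
  have hre k : `|complex.Re (u k.+1 x) - complex.Re (u k x)| <= M * 2^-1 ^+ k.
    rewrite -(@ler_pXn2r _ 2)// ?nnegrE// real_normK ?num_real//.
    apply: le_trans (dM k); rewrite /csqn /dn !cplxE lerDl; exact: sqr_ge0.
  have him k : `|complex.Im (u k.+1 x) - complex.Im (u k x)| <= M * 2^-1 ^+ k.
    rewrite -(@ler_pXn2r _ 2)// ?nnegrE// real_normK ?num_real//.
    apply: le_trans (dM k); rewrite /csqn /dn !cplxE lerDr; exact: sqr_ge0.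
  have [a ca ha] := geometric_cauchy_cvg hre.
  have [b cb hb] := geometric_cauchy_cvg him.
  have -> : f x = a +i* b.
    rewrite /f /reu /imu.
    have /cvg_limn_einf_sup[_ ->] : (complex.Re (u n x))%:E @[n --> \oo] --> a%:E.
      by apply: cvg_EFin => //; exact: nearW.
    have /cvg_limn_einf_sup[_ ->] : (complex.Im (u n x))%:E @[n --> \oo] --> b%:E.
      by apply: cvg_EFin => //; exact: nearW.
    by [].
  rewrite -EFinM lee_fin.
  rewrite -ler_pdivlMr// -[_ * s / _]mulrA -MM /csqn !cplxE/=.
  have sq y : `|y| <= 2 * M * 2^-1 ^+ n -> y ^+ 2 <= 4 * (M ^+ 2 * 4^-1 ^+ n).
    move=> hy; rewrite -real_normK ?num_real//.
    apply: (@le_trans _ _ ((2 * M * 2^-1 ^+ n) ^+ 2)).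
      by rewrite ler_pXn2r// ?nnegrE// (le_trans _ hy).
    rewrite !exprMn -[(_ ^+ n) ^+ 2]exprM mulnC exprM.
    rewrite (_ : 2^-1 ^+ 2 = 4^-1 :> R); last by field.
    by rewrite -mulrA (_ : 2 ^+ 2 = 4 :> R)//; ring.
  have := sq _ (ha n); have := sq _ (hb n).
  rewrite -![(_ - complex.Re _) ^+ 2]sqrrN -![(_ - complex.Im _) ^+ 2]sqrrN !opprB.
  by set q := M ^+ 2; set e := 4^-1 ^+ n; lra.
have Sfin : (\int[mu]_(x in D) S x)%E \is a fin_num.
  by rewrite ge0_fin_numE//; exact: integral_ge0.
have Luf n : L2 (fun x => u n x - f x).
  apply/L2P; split.
    have := cmeasurableD (mu_ n) (cmeasurableM (cmeasurable_cst D (-1)) mf).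
    by apply: eq_cmeasurable => x _; rewrite mulN1r.
  apply/integrableP; split.
    apply/measurable_EFinP/msqn.
    have := cmeasurableD (mu_ n) (cmeasurableM (cmeasurable_cst D (-1)) mf).
    by apply: eq_cmeasurable => x _; rewrite mulN1r.
  apply: (@le_lt_trans _ _ (\int[mu]_(x in D) ((8 * 4^-1 ^+ n)%:E * S x))%E).
    apply: ge0_le_integral => //.
    - apply: measurableT_comp => //; apply/measurable_EFinP/msqn.
      have := cmeasurableD (mu_ n) (cmeasurableM (cmeasurable_cst D (-1)) mf).
      by apply: eq_cmeasurable => x _; rewrite mulN1r.
    - by apply: measurable_funeM.
    - by move=> x Dx; rewrite gee0_abs; [exact: key|exact: (@sqn0 (fun x => u n x - f x) x)].
  rewrite ge0_integralZl// ?lee_fin ?mulr_ge0 ?exprn_ge0 ?invr_ge0//.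
  by rewrite -(fineK Sfin) -EFinM ltry.
have Lf : L2 f.
  have := L2B (Lu 0) (Luf 0); congr (Defs.L2 _ _ _).
  by apply/funext => x; rewrite opprB addrC subrK.
exists f => //.
apply: (@squeeze_cvgr _ _ _ _ (fun=> 0)
  (fun n => 8 * 4^-1 ^+ n * fine (\int[mu]_(x in D) S x)%E)).
- near=> n; rewrite L2sq_ge0/=.
  have /L2P[md di] := Luf n.
  have fi := integrable_fin_num mD di.
  rewrite -lee_fin EFinM /L2sq /Rintegral (fineK fi) (fineK Sfin).
  rewrite -ge0_integralZl// ?lee_fin ?mulr_ge0 ?exprn_ge0 ?invr_ge0//.
  apply: ge0_le_integral => //.
  - by move=> x Dx; exact: (@sqn0 (fun x => u n x - f x) x).
  - exact/measurable_EFinP/msqn.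
  - by apply: measurable_funeM.
  - by move=> x Dx; exact: key.
- exact: cvg_cst.
- rewrite -[X in _ --> X](mul0r (fine (\int[mu]_(x in D) S x)%E)).
  apply: cvgM; last exact: cvg_cst.
  rewrite -(mulr0 8); apply: cvgM; first exact: cvg_cst.
  by apply: cvg_expr; rewrite ger0_norm ?invr_ge0// invf_lt1// ltr1n.
Unshelve. all: by end_near.
Qed.

End weighted_L2_theory.

(** * Families of functions with equal Gram matrices *)

Section weighted_L2_unitary.
Local Open Scope complex_scope.
Local Open Scope classical_set_scope.
Context d (T : measurableType d) (R : realType).
Variables (mu : {measure set T -> \bar R}) (D : set T) (w : T -> R).
Hypotheses (mD : measurable D) (mw : measurable_fun D w)
  (w_gt0 : forall x, D x -> 0 < w x).
Local Notation L2 := (L2 mu D w).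
Local Notation cip := (cip mu D w).
Local Notation rip := (rip mu D w).

Lemma L2_semi_hilbert : semi_hilbert (fun (f g : T -> R[i]) x => f x + g x)
  (fun (a : R) f x => a%:C * f x) L2 rip.
Proof.
split.
- by move=> f g; exact: L2D.
- by move=> a f; exact: L2Z.
- by move=> f g Lf Lg; rewrite /rip [cip g f]cipC// ReJ.
- split=> [f g h Lf Lg Lh|a f h Lf Lh]; rewrite /rip.
    by rewrite cipDl// ReD.
  by rewrite cipZl// ReM/= mul0r subr0.
- have sqE f : L2 f -> rip f f = L2sq mu D w f by move=> Lf; rewrite /rip cip_sq.
  split=> [f Lf|u Lu hu]; first by rewrite sqE// L2sq_ge0.
  have E (f g : T -> R[i]) : sub_by (fun f g x => f x + g x) (fun a f x => a%:C * f x) f g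
      = (fun x => f x - g x).
    by apply/funext => x; rewrite /sub_by (_ : (-1)%:C = -1 :> R[i]) ?mulN1r ?rmorphN1.
  have [|f Lf uf] := @L2_complete _ _ _ mu D w mD mw w_gt0 u Lu.
    by move=> n; have := hu n; rewrite E sqE//; exact: L2B.
  exists f => //.
  rewrite (_ : (fun n => _) = (fun n => L2sq mu D w (fun x => u n x - f x)))//.
  by apply/funext => n; rewrite E sqE//; exact: L2B.
Qed.

Let re_eq (z z' : R[i]) :
  (forall c : R[i], complex.Re (conjc c * z) = complex.Re (conjc c * z')) -> z = z'.
Proof.
move=> h; apply: complex_eqP; first by have := h 1; rewrite conjc1 !mul1r.
by have := h 'i; rewrite !cplxE/= !mul0r !sub0r !mulN1r !opprK.
Qed.

Section families.
Variables (I : Type) (k k' : I -> T -> R[i]) (i0 : I).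
Hypotheses (Lk : forall i, L2 (k i)) (Lk' : forall i, L2 (k' i)).
Hypothesis gram : forall i j, cip (k i) (k j) = cip (k' i) (k' j).

(** The abstract theory is real. Adding a complex scalar c to the index lets the real pairings with
    c k_i determine the complex pairing with k_i. *)
Let K (k : I -> T -> R[i]) (ic : I * R[i]) : T -> R[i] := fun x => ic.2 * k ic.1 x.

Let ripK f (k0 : I -> T -> R[i]) i c : L2 f -> (forall i, L2 (k0 i)) ->
  rip f (K k0 (i, c)) = complex.Re (conjc c * cip f (k0 i)).
Proof. by move=> Lf Lk0; rewrite /rip /K cipZr. Qed.

Let LK k0 : (forall i, L2 (k0 i)) -> forall ic, L2 (K k0 ic).
Proof. by move=> Lk0 ic; apply: L2Z. Qed.

Let gramK : forall i j, rip (K k i) (K k j) = rip (K k' i) (K k' j).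
Proof.
move=> [i a] [j b]; rewrite !ripK//; [|exact: LK|exact: LK].
by rewrite /K !cipZl// gram.
Qed.

(** Existence of a vector with prescribed pairings; for the Laplace kernels this is a function with
    prescribed transform, obtained without any description of the range. *)
Lemma L2_transport p : L2 p ->
  exists2 q, L2 q & forall i, cip q (k i) = cip p (k' i).
Proof.
move=> Lp; have [p' [q [Lp' Lq _ h _]]] :=
  semi_hilbert_transport L2_semi_hilbert (i0, 0) (LK Lk) (LK Lk') gramK Lp.
exists q => // i; apply: re_eq => c.
by rewrite -!ripK.
Qed.

Hypotheses
  (tk : forall f, L2 f -> (forall i, cip f (k i) = 0) -> L2sq mu D w f = 0)
  (tk' : forall f, L2 f -> (forall i, cip f (k' i) = 0) -> L2sq mu D w f = 0).

(** The families being total, matching pairings say that H and p are the images of F and q under one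
    unitary map. The complex statement follows from the real one applied to all complex multiples of
    p and q. *)
Lemma L2_covariant F H p q : L2 F -> L2 H -> L2 p -> L2 q ->
  (forall i, cip H (k' i) = cip F (k i)) ->
  (forall i, cip p (k' i) = cip q (k i)) -> cip H p = cip F q.
Proof.
move=> LF LH Lp Lq HF pq.
have tot k0 : (forall i, L2 (k0 i)) ->
   (forall f, L2 f -> (forall i, cip f (k0 i) = 0) -> L2sq mu D w f = 0) ->
   forall f, L2 f -> (forall i, rip f (K k0 i) = 0) -> rip f f = 0.
  move=> Lk0 t f Lf h; rewrite /rip cip_sq//= t// => i.
  by apply: re_eq => c; rewrite -ripK// h mulr0.
have cov p1 q1 : L2 p1 -> L2 q1 -> (forall i, cip p1 (k' i) = cip q1 (k i)) ->
    rip H p1 = rip F q1.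
  move=> Lp1 Lq1 pq1; apply: (semi_hilbert_covariant L2_semi_hilbert (i0, 0)
    (LK Lk) (LK Lk') gramK (tot _ Lk tk) (tot _ Lk' tk') LF LH Lp1 Lq1).
  - by move=> [i c]; rewrite !ripK// HF.
  - by move=> [i c]; rewrite !ripK// pq1.
apply: re_eq => c.
rewrite -!cipZr//; apply: cov; [exact: L2Z|exact: L2Z|move=> i].
by rewrite !cipZl// pq.
Qed.

End families.
End weighted_L2_unitary.

(** * Injectivity of the Laplace transform *)

Section affine_substitution.
Local Open Scope classical_set_scope.
Context {R : realType}.
Local Notation mu := (@lebesgue_measure R).
Variables a b : R.
Hypothesis a0 : a != 0.

Let phi (x : R) : R := a * x + b.

Let mphi : measurable_fun [set: measurableTypeR R] (phi : measurableTypeR R -> measurableTypeR R).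
Proof. by apply: measurable_funD => //; exact: measurable_funM. Qed.

Let image_measure : {measure set (measurableTypeR R) -> \bar R} :=
  measure_function_pushforward__canonical__measure_function_Measure mu mphi.

Let nu : {measure set (measurableTypeR R) -> \bar R} :=
  mscale `|a|%:nng image_measure.

(** Lebesgue measure is determined by its values on the intervals ]x, y]. For negative [a] the
    preimage is closed on the left and open on the right, with the same length. *)
Let mu_nu A : measurable A -> mu A = nu A.
Proof.
apply: lebesgue_measure_unique => _ [[x y] _ <-] /=.
rewrite /nu /image_measure /= /mscale /= /pushforward.
have [an|ap] := ltP a 0.
- have -> : phi @^-1` `]x, y] = `[(y - b) / a, (x - b) / a[%classic.
    apply/seteqP; split => z; rewrite /phi /= !in_itv/= => /andP[h1 h2]; apply/andP.
      by split; [rewrite ler_ndivrMr// mulrC lerBrDr|rewrite ltr_ndivlMr// mulrC ltrBlDr].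
    move: h1 h2; rewrite ler_ndivrMr// ltr_ndivlMr// mulrC => h1 h2.
    by split; [rewrite -ltrBlDr|rewrite -lerBrDr].
  rewrite !lebesgue_measure_itv/= !lte_fin ltr_nM2r ?invr_lt0// ltrD2r.
  case: ifPn => xy; last by rewrite mule0.
  by rewrite -!EFinD -EFinM ltr0_norm//; congr (_%:E); field.
- have {}ap : 0 < a by rewrite lt_neqAle eq_sym a0.
  have -> : phi @^-1` `]x, y] = `](x - b) / a, (y - b) / a]%classic.
    apply/seteqP; split => z; rewrite /phi /= !in_itv/= => /andP[h1 h2]; apply/andP.
      by split; [rewrite ltr_pdivrMr// mulrC ltrBlDr|rewrite ler_pdivlMr// mulrC lerBrDr].
    move: h1 h2; rewrite ler_pdivlMr// ltr_pdivrMr// mulrC => h1 h2.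
    by split; [rewrite -ltrBlDr|rewrite -lerBrDr].
  rewrite !lebesgue_measure_itv/= !lte_fin ltr_pM2r ?invr_gt0// ltrD2r.
  case: ifPn => xy; last by rewrite mule0.
  by rewrite -!EFinD -EFinM gtr0_norm//; congr (_%:E); field.
Qed.

Lemma ge0_integral_affine (D : set R) (f : R -> \bar R) :
  measurable D -> measurable_fun D f -> (forall x, D x -> (0 <= f x)%E) ->
  (\int[mu]_(x in D) f x =
   `|a|%:E * \int[mu]_(x in [set x : R | D (a * x + b)%R]) f (a * x + b)%R)%E.
Proof.
move=> mD mf f0.
rewrite (eq_measure_integral nu); last by move=> A mA _; exact: mu_nu.
rewrite ge0_integral_mscale//; congr (_ * _)%E.
by rewrite ge0_integral_pushforward// => y /set_mem; exact: f0.
Qed.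

Lemma ge0_integral_affineT (f : R -> \bar R) :
  measurable_fun [set: measurableTypeR R] f -> (forall x, (0 <= f x)%E) ->
  (\int[mu]_x f x = `|a|%:E * \int[mu]_x f (a * x + b)%R)%E.
Proof. by move=> mf f0; exact: ge0_integral_affine. Qed.

End affine_substitution.

Section dominated_Rintegral.
Local Open Scope classical_set_scope.
Context d (T : measurableType d) (R : realType).
Variables (mu : {measure set T -> \bar R}) (D : set T).
Hypothesis mD : measurable D.

Lemma integrable_mull (c : R) (h : T -> R) : mu.-integrable D (EFin \o h) ->
  mu.-integrable D (EFin \o (fun t => c * h t)).
Proof.
by move=> hi; have := integrableZl mD c hi; apply: eq_integrable.
Qed.

Lemma dominated_Rintegral (u : nat -> T -> R) (f g : T -> R) :
  (forall n, measurable_fun D (u n)) -> measurable_fun D f ->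
  {ae mu, forall x, D x -> u n x @[n --> \oo] --> f x} ->
  mu.-integrable D (EFin \o g) ->
  (forall n x, D x -> `|u n x| <= g x) ->
  mu.-integrable D (EFin \o f) /\
  Rintegral mu D (u n) @[n --> \oo] --> Rintegral mu D f.
Proof.
move=> mu_ mf uf gi ug.
have [||||fi _ h] := @dominated_convergence _ _ _ mu D mD
  (fun n x => (u n x)%:E) (EFin \o f) (EFin \o g) _ _ _ gi.
- by move=> n; exact/measurable_EFinP.
- exact/measurable_EFinP.
- by apply: filterS uf => x h Dx; apply: cvg_EFin; [exact: nearW|exact: h].
- by apply: aeW => x n Dx; rewrite lee_fin; exact: ug.
split => //; rewrite /Rintegral.
have := fine_cvg (f := fun n => (\int[mu]_(x in D) (u n x)%:E)%E)
  (a := fine (\int[mu]_(x in D) (f x)%:E)%E).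
by apply; rewrite fineK//; exact: integrable_fin_num.
Qed.

End dominated_Rintegral.

Section laplace_injective.
Local Open Scope classical_set_scope.
Context {R : realType}.
Local Notation mu := (@lebesgue_measure R).
Local Notation H := (@halfline R : set (measurableTypeR R)).

Lemma measurable_halfline : measurable H.
Proof. exact: measurable_itv. Qed.
Local Hint Resolve measurable_halfline : core.

Lemma integrable_mulr_bounded (g k : R -> R) (M : R) :
  mu.-integrable H (EFin \o g) -> measurable_fun H k ->
  (forall t, H t -> `|k t| <= M) -> mu.-integrable H (EFin \o (fun t => g t * k t)).
Proof.
move=> gi mk kM.
have mg : measurable_fun H g by apply/measurable_EFinP; exact: measurable_int gi.
have i : mu.-integrable H (EFin \o (fun t => M * `|g t|)).
  apply: integrable_mull => //; exact: integrable_norm gi.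
apply: (le_integrable _ _ _ i) => //.
  exact/measurable_EFinP/measurable_funM.
move=> t Ht /=; rewrite lee_fin normrM mulrC (le_trans _ (ler_norm _))//.
by rewrite ler_wpM2r// kM.
Qed.

Lemma measurable_fun_ltr_nat (a : R) : measurable_fun H (fun t : R => (a < t)%R%:R : R).
Proof.
have -> : (fun t : R => (a < t)%R%:R : R) = \1_(`]a, +oo[).
  apply/funext => t; rewrite indicE; congr (nat_of_bool _)%:R.
  by apply/idP/idP => [h|/set_mem]; [apply/mem_set|]; rewrite /= in_itv/= andbT.
by apply: measurable_indic; exact: measurable_itv.
Qed.

Variable g : R -> R.
Hypothesis gi : mu.-integrable H (EFin \o g).
Hypothesis g0 : forall n : nat, Rintegral mu H (fun t => g t * expR (- (n%:R * t))) = 0.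

Let mg : measurable_fun H g.
Proof. by apply/measurable_EFinP; exact: measurable_int gi. Qed.

Let mexp (c : R) : measurable_fun H (fun t : R => expR (- (c * t))).
Proof.
by do 2 apply: measurableT_comp => //.
Qed.

(** As m grows this tends to the indicator of t > a; for fixed m it is a power series in exp (- m
    t), so only moments at natural numbers are involved. *)
Let cut a m t : R := expR (- expR (m%:R * (a - t))).

Let mcut a m : measurable_fun H (cut a m).
Proof.
apply: measurableT_comp => //; apply: measurableT_comp => //.
apply: measurableT_comp => //; apply: measurable_funM => //.
by apply: measurable_funB.
Qed.

(** Each partial sum of the exponential series is a combination of the functions exp (- m k t),
    against which [g] integrates to zero; on the half-line these sums are bounded by exp (exp (m
    a)), which allows the limit. *)
Let cut_moment a m : Rintegral mu H (fun t => g t * cut a m t) = 0.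
Proof.
pose s N t := \sum_(0 <= k < N) exp_coeff (- expR (m%:R * (a - t))) k.
have sE N t : s N t = \sum_(0 <= k < N)
   ((-1) ^+ k * expR (m%:R * a) ^+ k / k`!%:R * expR (- ((m * k)%N%:R * t))).
  apply: eq_bigr => k _; rewrite /exp_coeff/= mulrBr expRD (exprNn (expR _ * expR _)) exprMn.
  have -> : expR (- ((m * k)%N%:R * t)) = expR (- (m%:R * t)) ^+ k.
    by rewrite -expRM_natl natrM; congr expR; ring.
  by ring.
have ms N : measurable_fun H (s N).
  rewrite (funext (sE N)).
  apply: measurable_sum => k; apply: measurable_funM => //; exact: mexp.
have sb N t : H t -> `|s N t| <= expR (expR (m%:R * a)).
  move=> Ht; have t0 : 0 < t by move: Ht; rewrite /halfline/= in_itv/= andbT.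
  apply: (@le_trans _ _ (\sum_(0 <= k < N) exp_coeff (expR (m%:R * a)) k)).
    apply: (le_trans (ler_norm_sum _ _ _)); apply: ler_sum => k _.
    rewrite /exp_coeff/= normrM normrX normrN.
    rewrite !ger0_norm ?expR_ge0 ?invr_ge0// ler_wpM2r ?invr_ge0//.
    rewrite lerXn2r ?nnegrE ?expR_ge0// ler_expR ler_wpM2l//.
    by rewrite lerBlDr lerDl ltW.
  have := @nondecreasing_cvgn_le R (series (exp_coeff (expR (m%:R * a)))).
  rewrite /expR /series/=; apply; last exact: is_cvg_series_exp_coeff.
  apply/nondecreasing_seqP => n; rewrite /series/= big_nat_recr//= lerDl.
  by rewrite divr_ge0// exprn_ge0// expR_ge0.
have s0 N : Rintegral mu H (fun t => g t * s N t) = 0.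
  elim: N => [|N IH].
    under eq_Rintegral do rewrite sE big_geq// mulr0.
    by rewrite /Rintegral integral0.
  have E t : s N.+1 t = s N t + (-1) ^+ N * expR (m%:R * a) ^+ N / N`!%:R *
      expR (- ((m * N)%N%:R * t)) by rewrite !sE big_nat_recr.
  under eq_Rintegral do rewrite E mulrDr.
  have i1 : mu.-integrable H (EFin \o (fun t => g t * s N t)).
    exact: integrable_mulr_bounded (sb N).
  have i2 : mu.-integrable H (EFin \o (fun t => g t * expR (- ((m * N)%N%:R * t)))).
    apply: (integrable_mulr_bounded (M := 1)) => // t; rewrite /halfline/= in_itv/= andbT => t0.
    by rewrite ger0_norm ?expR_ge0// -expR0 ler_expR oppr_le0 mulr_ge0// ltW.
  set c := (-1) ^+ N * _ / _.
  have i3 : mu.-integrable H (EFin \o (fun t => g t * (c * expR (- ((m * N)%N%:R * t))))).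
    have := integrable_mull measurable_halfline c i2.
    by apply: eq_integrable => // t _; rewrite /= mulrCA.
  rewrite RintegralD// IH add0r.
  under eq_Rintegral do rewrite mulrCA.
  by rewrite RintegralZl// g0 mulr0.
have [|||||_ h] := @dominated_Rintegral _ _ _ mu H measurable_halfline (fun N t => g t * s N t)
  (fun t => g t * cut a m t) (fun t => expR (expR (m%:R * a)) * `|g t|).
- by move=> N; exact: measurable_funM.
- exact: measurable_funM.
- apply: aeW => t _; apply: cvgM; first exact: cvg_cst.
  exact: is_cvg_series_exp_coeff.
- by apply: integrable_mull => //; exact: integrable_norm gi.
- by move=> N t Ht; rewrite normrM mulrC ler_wpM2r// sb.
- move: h; under eq_fun do rewrite s0.
  move=> h; by apply: (cvg_unique _ h) => //; exact: cvg_cst.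
Qed.

Lemma laplace_moments_tail a : Rintegral mu H (fun t => g t * (a < t)%R%:R) = 0.
Proof.
have mlt := measurable_fun_ltr_nat a.
have [|||||_ h] := @dominated_Rintegral _ _ _ mu H measurable_halfline (fun m t => g t * cut a m t)
  (fun t => g t * (a < t)%R%:R) (fun t => `|g t|).
- by move=> N; exact: measurable_funM.
- exact: measurable_funM.
(* At t = a the cut-off is constantly 1/e instead of tending to 0; this single point is
   discarded. *)
- exists [set a]; split => //; first exact: lebesgue_measure_set1.
  move=> t /= ht; apply/eqP/negPn/negP => ta; apply: ht => _.
  apply: cvgM; first exact: cvg_cst.
  rewrite /cut.
  have [at_|at_|/eqP] := ltgtP a t; last by rewrite eq_sym (negbTE ta).
  + rewrite -[X in _ --> X](_ : expR (- 0) = _); last by rewrite oppr0 expR0.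
    apply: continuous_cvg; first exact: continuous_expR.
    apply: cvgN.
    have -> : (fun n : nat => expR (n%:R * (a - t))) = (fun n => expR (a - t) ^+ n).
      by apply/funext => n; rewrite expRM_natl.
    apply: cvg_expr; rewrite ger0_norm ?expR_ge0// -expR0 ltr_expR.
    by rewrite subr_lt0.
  (* For t < a compare with a geometric sequence: exp (- exp y) is at most exp (- y), here with y =
     m (a - t). *)
  + apply/cvgrPdist_lt => e e0.
    have := @cvg_expr R (expR (- (a - t))).
    rewrite ger0_norm ?expR_ge0// -expR0 ltr_expR oppr_lt0 subr_gt0 => /(_ at_).
    move=> /cvgrPdist_lt/(_ e e0); apply: filterS => n.
    rewrite !sub0r !normrN !ger0_norm ?expR_ge0 ?exprn_ge0 ?expR_ge0//.
    apply: le_lt_trans; rewrite -expRM_natl mulrN ler_expR lerNl opprK.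
    by rewrite expR0; apply: le_trans (expR_ge1Dx _); rewrite lerDr.
- exact: integrable_norm gi.
- move=> N t Ht; rewrite normrM -[leRHS]mulr1 ler_wpM2l//.
  by rewrite ger0_norm ?expR_ge0// -expR0 ler_expR oppr_le0 expR_ge0.
- move: h; under eq_fun do rewrite cut_moment.
  move=> h; by apply: (cvg_unique _ h) => //; exact: cvg_cst.
Qed.

End laplace_injective.

Section laplace_injective_ae.
Local Open Scope classical_set_scope.
Context {R : realType}.
Local Notation mu := (@lebesgue_measure R).
Local Notation H := (@halfline R : set (measurableTypeR R)).

(** All tail integrals of [g] vanish, so its primitive is zero; by Lebesgue differentiation [g] is
    almost everywhere the derivative of that primitive. *)
Lemma laplace_moments_eq0 (g : R -> R) : mu.-integrable H (EFin \o g) ->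
  (forall n : nat, Rintegral mu H (fun t => g t * expR (- (n%:R * t))) = 0) ->
  {ae mu, forall t, H t -> g t = 0}.
Proof.
move=> gi g0; have mH := @measurable_halfline R.
have mg : measurable_fun H g by apply/measurable_EFinP; exact: measurable_int gi.
pose G := g \_ H.
have GE : EFin \o G = (EFin \o g) \_ H by rewrite /G restrict_EFin.
have Gi : mu.-integrable setT (EFin \o G) by rewrite GE -integrable_mkcond.
have F0 x : Rintegral mu `]-oo, x] G = 0.
  rewrite Rintegral_mkcond.
  transitivity (Rintegral mu H (fun t => g t - g t * (x < t)%R%:R)).
    rewrite [RHS]Rintegral_mkcond; apply: eq_Rintegral => t _.
    rewrite /G !patchE; case: ifPn => [|] /=.
    - move=> /set_mem; rewrite /= in_itv/= leNgt => /negbTE ->.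
      by rewrite mulr0 subr0.
    - move=> /negP tx; have -> : x < t.
        by rewrite ltNge; apply/negP => h; apply: tx; apply/mem_set; rewrite /= in_itv.
      by rewrite mulr1 subrr; case: ifP.
  have tail a : Rintegral mu H (fun t => g t * (a < t)%R%:R) = 0.
    exact: laplace_moments_tail.
  have i1 : mu.-integrable H (EFin \o (fun t => g t * (x < t)%R%:R)).
    apply: (integrable_mulr_bounded (M := 1)) => //.
      exact: measurable_fun_ltr_nat.
    by move=> t _; case: (_ < _); rewrite ?normr1 ?normr0.
  (* The integral over the whole half-line is itself a tail, starting at any negative point. *)
  rewrite RintegralB// tail subr0 -(tail (-1)).
  apply: eq_Rintegral => t /set_mem; rewrite /halfline/= in_itv/= andbT => t0.
  by rewrite (lt_trans _ t0) ?mulr1// ltrN10.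
have := @FTC1Ny R G.
move=> /(_ _ _)/wrap[].
- by move=> y; apply: integrableS Gi.
- by apply: open_integrable_locally => //; exact: openT.
apply: (@filterS _ _ (ae_filter_ringOfSetsType mu)) => t /= [_ h] Ht.
have : G t = 0.
  rewrite -h (_ : (fun _ => _) = cst 0); last by apply/funext => y; exact: F0.
  by rewrite derive1_cst.
by rewrite /G patchE mem_set.
Qed.

End laplace_injective_ae.

Section laplace_injective2.
Local Open Scope classical_set_scope.
Context {R : realType}.
Local Notation mu := (@lebesgue_measure R).
Local Notation H := (@halfline R : set (measurableTypeR R)).

(** The one-variable result is used twice: for each n the inner moment vanishes for almost every x;
    a countable union of null sets being null, almost every section then has all its moments
    zero. *)
Lemma laplace_moments2_eq0 (g : R * R -> R) :
  leb2.-integrable (H `*` H) (EFin \o g) ->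
  (forall m n : nat, Rintegral mu H (fun x => Rintegral mu H
     (fun y => g (x, y) * expR (- (n%:R * y))) * expR (- (m%:R * x))) = 0) ->
  {ae leb2, forall p, (H `*` H) p -> g p = 0}.
Proof.
move=> gi g0; have mH := @measurable_halfline R.
have mHH : measurable (H `*` H) by exact: measurableX.
have mg : measurable_fun (H `*` H) g by apply/measurable_EFinP; exact: measurable_int gi.
have exp_le1 n (y : R) : H y -> `|expR (- (n%:R * y))| <= 1.
  rewrite /halfline/= in_itv/= andbT => y0.
  by rewrite ger0_norm ?expR_ge0// -expR0 ler_expR oppr_le0 mulr_ge0// ltW.
have gn n : leb2.-integrable (H `*` H) (EFin \o (fun p => g p * expR (- (n%:R * p.2)))).
  apply: (le_integrable mHH _ _ gi).
    apply/measurable_EFinP/measurable_funM => //.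
    apply: measurableT_comp => //; apply: measurableT_comp => //.
    by apply: measurable_funM => //; exact: measurable_funS measurable_snd.
  move=> p [_ p2]; rewrite lee_fin normrM -[leRHS]mulr1 ler_wpM2l//; exact: exp_le1.
have inner n : {ae mu, forall x, H x -> Rintegral mu H
     (fun y => g (x, y) * expR (- (n%:R * y))) = 0}.
  have [i1 _ _] := fubini_Rintegral mH mH (gn n).
  apply: laplace_moments_eq0 => // m; exact: g0.
have sec : {ae mu, forall x, H x -> mu.-integrable H (fun y => (g (x, y))%:E)}.
  by have [_ + _] := fubini_Rintegral mH mH gi.
have all_n : {ae mu, forall x, H x -> forall n : nat, Rintegral mu H
     (fun y => g (x, y) * expR (- (n%:R * y))) = 0}.
  have := @ae_foralln _ _ _ mu (fun n x => H x -> Rintegral mu H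
     (fun y => g (x, y) * expR (- (n%:R * y))) = 0) inner.
  by apply: filterS => x h Hx n; exact: h.
have sec0 : {ae mu, forall x, H x -> (\int[mu]_(y in H) `|(g (x, y))%:E| = 0)%E}.
  apply: filterS2 sec all_n => x h1 h2 Hx.
  have := laplace_moments_eq0 (h1 Hx) (h2 Hx) => h.
  have [_] := @ae_eq_integral_abs _ _ _ mu H mH (fun y => (g (x, y))%:E) (measurable_int _ (h1 Hx)).
  by apply; apply: filterS h => y hy Hy; rewrite hy.
have Z : (\int[leb2]_(p in H `*` H) `|(g p)%:E| = 0)%E.
  rewrite (tonelli1 _ _ mH mH)//; last by do 2 apply: measurableT_comp => //.
  rewrite -[RHS](integral0 mu H); apply: ae_eq_integral => //.
  apply: (@tonelli_measurable1 _ _ _ _ _ mu H H mH mH (fun p => `|(g p)%:E|)%E) => //.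
  by apply: measurableT_comp => //; exact/measurable_EFinP.
have [+ _] := @ae_eq_integral_abs _ _ _ leb2 _ mHH (EFin \o g) (measurable_int _ gi).
by move=> /(_ Z); apply: filterS => p h Hp; have [] := h Hp.
Qed.

End laplace_injective2.

(** * The logarithm on the upper half-plane and the action of SL2 *)

Section uhp_logarithm.
Local Open Scope complex_scope.
Local Open Scope classical_set_scope.
Context {R : realType}.
Implicit Types (z w zeta : R[i]) (t : R).
Local Notation uhp := (@upper_half_plane R).

Lemma cexpD z w : cexp (z + w) = cexp z * cexp w.
Proof.
apply: complex_eqP; rewrite /cexp !cplxE/= expRD cosD sinD; ring.
Qed.

Lemma cexp0 : cexp 0 = 1 :> R[i].
Proof. by apply: complex_eqP; rewrite /cexp !cplxE/= expR0 cos0 sin0; ring. Qed.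

Lemma cexpJ z : cexp (conjc z) = conjc (cexp z).
Proof. by apply: complex_eqP; rewrite /cexp !cplxE/= ?ImJ cosN// sinN; ring. Qed.

Lemma cexpNK z : cexp z * cexp (- z) = 1.
Proof. by rewrite -cexpD subrr cexp0. Qed.

Lemma cexp_neq0 z : cexp z != 0.
Proof. by apply/eqP => h; have := cexpNK z; rewrite h mul0r => /esym/eqP; rewrite oner_eq0. Qed.

Lemma cexpN z : cexp (- z) = (cexp z)^-1.
Proof. by apply: (mulfI (cexp_neq0 z)); rewrite cexpNK mulfV ?cexp_neq0. Qed.

Lemma cexpMn z (n : nat) : cexp (n%:R * z) = cexp z ^+ n.
Proof.
elim: n => [|n IH]; first by rewrite mul0r cexp0.
by rewrite exprS -IH -cexpD -[in LHS]natr1; congr cexp; ring.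
Qed.

Lemma Re_cexp z : complex.Re (cexp z) = expR (complex.Re z) * cos (complex.Im z).
Proof. by rewrite /cexp !cplxE/=; ring. Qed.

Lemma Im_cexp z : complex.Im (cexp z) = expR (complex.Re z) * sin (complex.Im z).
Proof. by rewrite /cexp !cplxE/=; ring. Qed.

Lemma csqn_cexp z : csqn (cexp z) = expR (complex.Re z) ^+ 2.
Proof. by rewrite /csqn Re_cexp Im_cexp !exprMn -mulrDr cos2Dsin2 mulr1. Qed.

Lemma norm_normc z : `|z| = (normc z)%:C.
Proof. by []. Qed.

(** The principal logarithm of - i zeta, a number with real part Im zeta > 0 and imaginary part - Re
    zeta; hence the arctangent, with values in ]-pi/2, pi/2[. *)
Definition uhp_log zeta : R[i] :=
  (ln (csqn zeta) / 2) -i* atan (complex.Re zeta / complex.Im zeta).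

Lemma uhp_log_uniq (psi zeta : R[i]) : uhp zeta -> cexp psi = - 'i * zeta ->
  - (pi / 2) < complex.Im psi < pi / 2 -> psi = uhp_log zeta.
Proof.
move=> z0 e im; rewrite /upper_half_plane/= in z0.
have s0 : 0 < csqn zeta.
  by rewrite /csqn ltr_wpDl ?sqr_ge0// exprn_gt0.
have c0 : 0 < cos (complex.Im psi) by exact: cos_gt0_pihalf.
have eR : expR (complex.Re psi) * cos (complex.Im psi) = complex.Im zeta.
  by rewrite -Re_cexp e !cplxE/=; ring.
have eI : expR (complex.Re psi) * sin (complex.Im psi) = - complex.Re zeta.
  by rewrite -Im_cexp e !cplxE/=; ring.
apply: complex_eqP => /=.
  have : csqn (cexp psi) = csqn zeta.
    by rewrite e csqnM /csqn/= !(oppr0, expr0n)/= add0r sqrrN expr1n mul1r.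
  by rewrite csqn_cexp => <-; rewrite -expRM_natl expRK mulrC mulrA mulVf ?mul1r.
have -> : complex.Re zeta / complex.Im zeta = - tan (complex.Im psi).
  rewrite /tan -eR -[complex.Re zeta]opprK -eI; field.
  by rewrite gt_eqF// gt_eqF ?expR_gt0.
rewrite atanN opprK tanK// in_itv/=.
Qed.

Lemma cexp_uhp_log zeta : uhp zeta -> cexp (uhp_log zeta) = - 'i * zeta.
Proof.
rewrite /upper_half_plane/= => z0.
have s0 : 0 < csqn zeta by rewrite /csqn ltr_wpDl ?sqr_ge0// exprn_gt0.
set b := complex.Re zeta; set a := complex.Im zeta.
have q : expR (ln (csqn zeta) / 2) ^+ 2 = csqn zeta.
  by rewrite -expRM_natl mulrC divfK// lnK.
have a0 : a != 0 by rewrite gt_eqF.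
have e : expR (ln (csqn zeta) / 2) * cos (atan (b / a)) = a.
  have h0 : 0 <= expR (ln (csqn zeta) / 2) * (Num.sqrt (1 + (b / a) ^+ 2))^-1.
    by rewrite mulr_ge0 ?expR_ge0// invr_ge0 sqrtr_ge0.
  rewrite cos_atan; apply/eqP; rewrite -(@eqrXn2 _ 2)//; last exact: ltW.
  rewrite exprMn q exprVn sqr_sqrtr ?addr_ge0 ?sqr_ge0//.
  rewrite /csqn -/a -/b; apply/eqP; field.
  by rewrite a0/= gt_eqF// ltr_wpDr ?sqr_ge0// exprn_gt0.
have c0 : 0 < cos (atan (b / a)).
  by rewrite cos_atan invr_gt0 sqrtr_gt0 ltr_wpDr ?sqr_ge0.
apply: complex_eqP; rewrite ?Re_cexp ?Im_cexp /uhp_log/= -/a -/b.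
  by rewrite cosN e !cplxE/= -/a -/b; ring.
have sn : sin (atan (b / a)) = b / a * cos (atan (b / a)).
  by have := atanK (b / a); rewrite /tan => h; rewrite -[X in _ = X * _]h divfK// gt_eqF.
by rewrite sinN sn mulrN mulrCA e !cplxE/= -/a -/b; field.
Qed.

(** Holomorphy of the logarithm chosen with g enters the proof only in this form, as continuity of
    its imaginary part along segments. *)
Lemma holomorphic_path (phi : R[i] -> R[i]) z w t : holomorphic_on uhp phi ->
  uhp (w + t%:C * (z - w)) ->
  {for t, continuous (fun t => complex.Im (phi (w + t%:C * (z - w))))}.
Proof.
move=> hol u0; have /derivable1_diffP/differentiable_continuous := hol _ u0.
set z0 := w + _ => hc; apply/cvgrPdist_lt => e e0.
move/cvgrPdist_lt : hc => /(_ e%:C); rewrite ltcR => /(_ e0).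
rewrite near_simpl => /nbhs_ballP[del del0 hd].
(* Balls of [R[i]] have radii in [R[i]]; a positive one has zero imaginary part. *)
have [r r0 delE] : exists2 r : R, 0 < r & del = r%:C.
  move: del0; rewrite /= ltcE => /andP[/eqP i0 r0]; exists (complex.Re del) => //.
  by apply: complex_eqP.
rewrite near_simpl; apply/nbhs_ballP.
have N0 : 0 < 1 + normc (z - w) by rewrite ltr_pwDl// normc_ge0.
exists (r / (1 + normc (z - w))) => /=; first exact: divr_gt0.
move=> s; rewrite /ball/= ltr_pdivlMr// => hs.
have /hd : ball (z0 : R[i]^o) del (w + s%:C * (z - w)).
  rewrite /ball/= delE.
  have -> : z0 - (w + s%:C * (z - w)) = (t - s)%:C * (z - w).
    by rewrite /z0 rmorphB/=; ring.
  rewrite norm_normc normcM normcC ltcR; apply: le_lt_trans hs.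
  by rewrite ler_wpM2l// lerDr.
rewrite /= norm_normc ltcR; apply: le_lt_trans.
by rewrite -ImN -ImD; exact: normr_Im_le.
Qed.

End uhp_logarithm.

(** * Moebius maps and the branch of the logarithm *)

Section mobius_action.
Local Open Scope complex_scope.
Local Open Scope classical_set_scope.
Context {R : realType}.
Variable g : universal_SL2 R.
Implicit Types (z w : R[i]).
Local Notation uhp := (@upper_half_plane R).
Local Notation phi := (SL2_log g).
Local Notation B := (invmx (SL2_mx g)).

Let a := B 0 0. Let b := B 0 1. Let c := B 1 0. Let d := B 1 1.

Let detB : a * d - b * c = 1.
Proof.
have : \det B = 1 by rewrite det_inv SL2_det invr1.
rewrite (expand_det_row _ ord0) !big_ord_recl big_ord0 /cofactor !det_mx11 !mxE /=.
rewrite addr0 expr0 expr1 !mul1r mulN1r mulrN => <-.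
by congr (B _ _ * B _ _ - B _ _ * B _ _); apply/val_inj.
Qed.

Let j z := c%:C * z + d%:C.

Let jE z : uhp z -> j z = cexp (phi z).
Proof. by move=> hz; rewrite SL2_logP. Qed.

Let j0 z : uhp z -> j z != 0.
Proof. by move=> hz; rewrite jE// cexp_neq0. Qed.

Let detC : a%:C * d%:C - b%:C * c%:C = 1 :> R[i].
Proof. by rewrite -!rmorphM -rmorphB detB. Qed.

Lemma mobius_subJ z w : uhp z -> uhp w ->
  mobius B z - conjc (mobius B w) = (z - conjc w) / (cexp (phi z) * conjc (cexp (phi w))).
Proof.
move=> hz hw; rewrite -!jE// /mobius -/a -/b -/c -/d.
rewrite conjcM conjc_inv conjcD conjcM !conjc_real.
rewrite -/(j z) -/(j w).
have jz := j0 hz; have jw : conjc (j w) != 0 by rewrite conjc_eq0 j0.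
(* Inserting the determinant turns the claim into an identity of rational functions. *)
rewrite (_ : z - conjc w = (z - conjc w) * (a%:C * d%:C - b%:C * c%:C)); last by rewrite detC mulr1.
have jwE : conjc (j w) = c%:C * conjc w + d%:C by rewrite /j conjcD conjcM !conjc_real.
move: jz jw; rewrite jwE /j => jz jw.
by field; rewrite jz jw.
Qed.

Lemma mobius_sub z w : uhp z -> uhp w ->
  mobius B z - mobius B w = (z - w) / (cexp (phi z) * cexp (phi w)).
Proof.
move=> hz hw; rewrite -!jE// /mobius -/a -/b -/c -/d.
rewrite (_ : z - w = (z - w) * (a%:C * d%:C - b%:C * c%:C)); last by rewrite detC mulr1.
by move: (j0 hz) (j0 hw); rewrite /j => jz jw; field; rewrite jz jw.
Qed.

Lemma uhp_subJ z w : uhp z -> uhp w -> uhp (z - conjc w).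
Proof.
rewrite /upper_half_plane/= => hz hw.
by rewrite !cplxE opprK addr_gt0.
Qed.

Lemma mobius_uhp z : uhp z -> uhp (mobius B z).
Proof.
move=> hz; have := mobius_subJ hz hz; rewrite mulcJ /upper_half_plane/=.
move: (mobius B z) => m /(congr1 (@complex.Im R)); rewrite -fmorphV !cplxE/= => h.
suff : 0 < complex.Im m *+ 2 by rewrite pmulrn_lgt0.
move: h; rewrite !opprK mulr0 add0r -mulr2n => ->.
rewrite mulr_gt0 ?addr_gt0//.
by rewrite invr_gt0 csqn_cexp exprn_gt0// expR_gt0.
Qed.

(** The preimage is the Moebius map of the adjugate matrix; its denominator could vanish in the
    half-plane only for c = a = 0, against the determinant. *)
Lemma mobius_surj z : uhp z -> exists2 z', uhp z' & mobius B z' = z.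
Proof.
move=> hz.
have k0 : - c%:C * z + a%:C != 0.
  apply/eqP => h.
  have c0 : c = 0.
    move: h => /(congr1 (@complex.Im R)).
    rewrite !cplxE/= !(oppr0, mul0r, addr0) mulNr => /eqP; rewrite oppr_eq0 mulf_eq0.
    by rewrite (gt_eqF hz) orbF => /eqP.
  have a0 : a = 0.
    move: h => /(congr1 (@complex.Re R)).
    by rewrite c0 !cplxE/= !(oppr0, mul0r, subr0, add0r).
  by move: detB; rewrite c0 a0 mul0r mulr0 subrr => /eqP; rewrite eq_sym oner_eq0.
exists ((d%:C * z - b%:C) / (- c%:C * z + a%:C)).
  rewrite /upper_half_plane/=.
  have -> : (d%:C * z - b%:C) / (- c%:C * z + a%:C) =
     (d%:C * z - b%:C) * conjc (- c%:C * z + a%:C) * (csqn (- c%:C * z + a%:C))^-1%:C.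
    rewrite -[RHS]mulrA; congr (_ * _); apply: (mulfI k0).
    by rewrite mulfV// mulrA mulcJ -rmorphM mulfV// csqn_eq0.
  have F (u : R[i]) (s : R) : complex.Im (u * s%:C) = complex.Im u * s.
    by case: u => x y /=; ring.
  rewrite F mulr_gt0//; last first.
    by rewrite invr_gt0 lt_neqAle eq_sym csqn_eq0 k0 csqn_ge0.
  have -> : complex.Im ((d%:C * z - b%:C) * conjc (- c%:C * z + a%:C)) =
      (a * d - b * c) * complex.Im z by rewrite !cplxE/=; ring.
  by rewrite detB mul1r.
rewrite /mobius -/a -/b -/c -/d.
have e : c%:C * ((d%:C * z - b%:C) / (- c%:C * z + a%:C)) + d%:C
   = (- c%:C * z + a%:C)^-1.
  by rewrite -[RHS]mul1r -detC; field.
rewrite e invrK mulrDl mulrA mulfVK//.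
have -> : a%:C * (d%:C * z - b%:C) + b%:C * (- c%:C * z + a%:C) =
    (a%:C * d%:C - b%:C * c%:C) * z by ring.
by rewrite detC mul1r.
Qed.

(** Both sides are logarithms of the same number. To see that they are the same branch, the
    imaginary part of the right-hand side is followed along the segment from w to z: it is 0 at w,
    and its cosine stays positive because the exponential has positive real part, so it never leaves
    ]-pi/2, pi/2[. *)
Lemma uhp_log_mobius z w : uhp z -> uhp w ->
  uhp_log (mobius B z - conjc (mobius B w)) =
  uhp_log (z - conjc w) - phi z - conjc (phi w).
Proof.
move=> hz hw; apply/esym; apply: uhp_log_uniq.
- by apply: uhp_subJ; exact: mobius_uhp.
- rewrite mobius_subJ// !cexpD !cexpN cexp_uhp_log; last exact: uhp_subJ.
  by rewrite cexpJ; field; rewrite !cexp_neq0 conjc_eq0 cexp_neq0.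
pose p t := w + t%:C * (z - w).
have hp t : 0 <= t <= 1 -> uhp (p t).
  move=> /andP[t0 t1]; rewrite /upper_half_plane/= /p !cplxE/= mul0r addr0.
  move: hz hw; rewrite /upper_half_plane/= => hz hw.
  rewrite (_ : _ + _ = (1 - t) * complex.Im w + t * complex.Im z); last by ring.
  have [->|tn0] := eqVneq t 0; first by rewrite subr0 mul1r mul0r addr0.
  apply: ltr_wpDl; first by apply: mulr_ge0; [rewrite subr_ge0|exact: ltW].
  by rewrite mulr_gt0// lt_neqAle eq_sym tn0.
pose psi t := complex.Im (uhp_log (p t - conjc w) - phi (p t) - conjc (phi w)).
have psi0 : psi 0 = 0.
  rewrite /psi /p mul0r addr0 /uhp_log !cplxE/= subrr mul0r atan0.
  by rewrite !(oppr0, add0r, opprK) addNr.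
have psi_neq t : 0 <= t <= 1 -> 0 < cos (psi t).
  move=> t01; have hpt := hp t t01.
  have hm : uhp (mobius B (p t) - conjc (mobius B w)).
    by apply: uhp_subJ; exact: mobius_uhp.
  have : cexp (uhp_log (p t - conjc w) - phi (p t) - conjc (phi w)) =
     - 'i * (mobius B (p t) - conjc (mobius B w)).
    rewrite mobius_subJ// !cexpD !cexpN cexp_uhp_log; last exact: uhp_subJ.
    by rewrite cexpJ; field; rewrite !cexp_neq0 conjc_eq0 cexp_neq0.
  move=> /(congr1 (@complex.Re R)); rewrite Re_cexp => h.
  rewrite -(pmulr_rgt0 _ (expR_gt0 (complex.Re
    (uhp_log (p t - conjc w) - phi (p t) - conjc (phi w))))) h.
  by rewrite ReM/= oppr0 mul0r mulN1r sub0r opprK.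
have cpsi : {within `[0, 1], continuous psi}.
  apply: continuous_in_subspaceT => t; rewrite inE/= in_itv/= => t01.
  have -> : psi = (fun t => - atan (complex.Re (p t - conjc w) / complex.Im (p t - conjc w))
      - complex.Im (phi (p t)) + complex.Im (phi w)).
    have E (u v x : R[i]) : complex.Im (u - v - conjc x) =
        complex.Im u - complex.Im v + complex.Im x by rewrite !cplxE opprK.
    by apply/funext => s; rewrite /psi E.
  apply: cvgD; last exact: cvg_cst.
  apply: cvgB; last first.
    by apply: holomorphic_path; [exact: SL2_log_holomorphic|exact: hp].
  apply: cvgN; apply: continuous_comp; last exact: continuous_atan.
  have aff (x y v : R) : {for t, continuous (fun s : R => x + s * y - v)}.
    apply: cvgB; last exact: cvg_cst.
    by apply: cvgD; [exact: cvg_cst|apply: cvgM; [exact: cvg_id|exact: cvg_cst]].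
  have cre : {for t, continuous (fun s : R => complex.Re (p s - conjc w))}.
    rewrite (_ : (fun s : R => _) = (fun s : R => complex.Re w + s * (complex.Re z - complex.Re w)
      - complex.Re w)); first exact: aff.
    by apply/funext => s; rewrite /p !cplxE/=; ring.
  have cim : {for t, continuous (fun s : R => complex.Im (p s - conjc w))}.
    rewrite (_ : (fun s : R => _) = (fun s : R => complex.Im w + s * (complex.Im z - complex.Im w)
      - - complex.Im w)); first exact: aff.
    by apply/funext => s; rewrite /p !cplxE/=; ring.
  apply: cvgM; first exact: cre.
  apply: cvgV; last exact: cim.
  by have := uhp_subJ (hp _ t01) hw; rewrite /upper_half_plane/= => /gt_eqF ->.
have -> : complex.Im (uhp_log (z - conjc w) - phi z - conjc (phi w)) = psi 1.
  by rewrite /psi /p mul1r [w + _]addrC subrK.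
have pi2 : 0 < pi / 2 :> R by rewrite divr_gt0// pi_gt0.
have nov v : cos v = 0 -> ~ (Num.min (psi 0) (psi 1) <= v <= Num.max (psi 0) (psi 1)).
  move=> cv hv; have [t + tv] := IVT ler01 cpsi hv.
  by rewrite in_itv/= => /psi_neq; rewrite tv cv ltxx.
have cpi : cos (pi / 2) = 0 :> R by exact: cos_pihalf.
apply/andP; split; rewrite ltNge; apply/negP => hv.
  apply: (nov (- (pi / 2))); first by rewrite cosN.
  by rewrite psi0 ge_min le_max hv orbT/= oppr_le0 ltW.
apply: (nov (pi / 2)) => //.
by rewrite psi0 ge_min le_max hv orbT andbT ltW.
Qed.

End mobius_action.

(** * Gamma integrals *)

Section halfline_calculus.
Local Open Scope classical_set_scope.
Context {R : realType}.
Local Notation mu := (@lebesgue_measure R).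
Local Notation H := (@halfline R : set (measurableTypeR R)).

Lemma halflineP (t : R) : H t <-> 0 < t.
Proof. by rewrite /halfline/= in_itv/= andbT. Qed.

Lemma powR_expR (m t : R) : 0 < t -> t `^ m = expR (m * ln t).
Proof. by move=> t0; rewrite /powR gt_eqF. Qed.

(** From ln x <= x - 1 at x = e t / m; the constant is (m / e)^m. *)
Lemma powR_le_expR (m e : R) : 0 < m -> 0 < e ->
  exists2 C, 0 < C & forall t, 0 < t -> t `^ m <= C * expR (e * t).
Proof.
move=> m0 e0; exists (expR (- (m * ln (e / m)))); first exact: expR_gt0.
move=> t t0; rewrite powR_expR// -expRD ler_expR.
have em : 0 < e / m by exact: divr_gt0.
have x0 : 0 < e / m * t by exact: mulr_gt0.
have := @le_ln1Dx R (e / m * t - 1).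
rewrite ltrBrDr addrC subrr addrC subrK => /(_ x0).
rewrite lnM ?posrE// => h.
have : m * (ln (e / m) + ln t) <= m * (e / m * t - 1) by rewrite ler_pM2l.
rewrite mulrDr mulrBr mulr1 mulrA [m * (e / m)]mulrC divfK ?gt_eqF// => h2.
by rewrite addrC lerBrDr addrC (le_trans h2)// lerBlDr lerDl ltW.
Qed.

Lemma measurable_powR_expRN (m a : R) :
  measurable_fun H (fun t : R => t `^ m * expR (- (a * t))).
Proof.
apply: measurable_funM; first by apply: measurable_funTS; exact: measurable_powR.
by do 2 apply: measurableT_comp => //.
Qed.

(** Half of the decay absorbs the power, leaving a multiple of the exponential density of rate a /
    2. *)
Lemma integrable_powR_expRN (m a : R) : 0 < m -> 0 < a ->
  mu.-integrable H (EFin \o (fun t : R => t `^ m * expR (- (a * t)))).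
Proof.
move=> m0 a0; have a2 : 0 < a / 2 by rewrite divr_gt0.
have [C C0 hC] := powR_le_expR m0 a2.
have i0 : mu.-integrable H (EFin \o exponential_pdf (a / 2)).
  by apply: integrableS (integrable_exponential_pdf a2) => //; exact: measurable_halfline.
have i1 := integrable_mull (@measurable_halfline R) (C / (a / 2)) i0.
apply: (le_integrable _ _ _ i1); first exact: measurable_halfline.
  by apply/measurable_EFinP; exact: measurable_powR_expRN.
move=> t /halflineP t0 /=; rewrite lee_fin ger0_norm ?mulr_ge0 ?powR_ge0 ?expR_ge0//.
rewrite (le_trans _ (ler_norm _))//.
rewrite /exponential_pdf patchE mem_set/=; last by rewrite in_itv/= andbT ltW.
have -> : C / (a / 2) * (a / 2 * expR (- (a / 2) * t)) = C * expR (- (a / 2) * t).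
  by rewrite mulrA divfK ?gt_eqF.
apply: (@le_trans _ _ (C * expR (a / 2 * t) * expR (- (a * t)))).
  by rewrite ler_wpM2r ?expR_ge0 ?hC//.
by rewrite -mulrA -expRD ler_wpM2l ?(ltW C0)// ler_expR; lra.
Qed.

(** The fundamental theorem on [1/(n+1), n+2], then dominated convergence. The upper end n + 2 keeps
    the interval nondegenerate at n = 0. *)
Lemma integral_halfline_derive (F f : R -> R) :
  (forall t : R, 0 < t -> is_derive t 1 F (f t)) ->
  (forall t : R, 0 < t -> {for t, continuous f}) ->
  mu.-integrable H (EFin \o f) ->
  F n.+1%:R^-1 @[n --> \oo] --> 0 -> F n.+2%:R @[n --> \oo] --> 0 ->
  Rintegral mu H f = 0.
Proof.
move=> dF cf fi F0 Foo.
pose u n t := f t * \1_(`[n.+1%:R^-1, n.+2%:R]%classic : set R) t.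
have mf : measurable_fun H f by apply/measurable_EFinP; exact: measurable_int fi.
have mu_ n : measurable_fun H (u n).
  by apply: measurable_funM => //; apply: measurable_indic; exact: measurable_itv.
have uE n : Rintegral mu H (u n) = F n.+2%:R - F n.+1%:R^-1.
  have e0 : 0 < n.+1%:R^-1 :> R by rewrite invr_gt0.
  have e1 : n.+1%:R^-1 < n.+2%:R :> R.
    by rewrite (@le_lt_trans _ _ 1)// ?invf_le1 ?ler1n ?ltr1n.
  have pos (t : R) : n.+1%:R^-1 <= t -> 0 < t by exact: lt_le_trans.
  have -> : Rintegral mu H (u n) = Rintegral mu `[n.+1%:R^-1, n.+2%:R] f.
    rewrite [LHS]Rintegral_mkcond [RHS]Rintegral_mkcond; apply: eq_Rintegral => t _.
    rewrite !patchE /u indicE; case: ifPn => tH; case: ifPn => tI.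
    - by rewrite mulr1.
    - by rewrite mulr0.
    - exfalso; move/negP: tH; apply; apply/mem_set/halflineP/pos.
      by move/set_mem: tI; rewrite /= in_itv/= => /andP[].
    - by [].
  rewrite /Rintegral (@continuous_FTC2 _ f F)//.
  - apply: continuous_in_subspaceT => t; rewrite inE/= in_itv/= => /andP[t1 _].
    by apply: cf; exact: pos.
  - have cF (t : R) : 0 < t -> {for t, continuous F}.
      move=> t0; apply: differentiable_continuous; apply/derivable1_diffP.
      by have [] := dF t t0.
    split.
    + move=> t; rewrite in_itv/= => /andP[t1 _].
      by have [] := dF t (pos _ (ltW t1)).
    + by apply: cvg_at_right_filter; exact: cF.
    + by apply: cvg_at_left_filter; apply: cF; exact: lt_trans e1.
  - move=> t; rewrite in_itv/= => /andP[t1 _].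
    by rewrite derive1E; have [_ ->] := dF t (pos _ (ltW t1)).
have [|||_ h] := @dominated_Rintegral _ _ _ mu H (@measurable_halfline R) u f
    (fun t => `|f t|) mu_ mf.
- apply: aeW => t /halflineP t0.
  have : \forall n \near \oo, u n t = f t.
    near=> n; rewrite /u indicE mem_set ?mulr1//= in_itv/=; apply/andP; split.
      rewrite -[leRHS]invrK lef_pV2 ?posrE ?invr_gt0//.
      apply: (@le_trans _ _ n%:R); last by rewrite ler_nat.
      by near: n; exact: nbhs_infty_ger.
    apply: (@le_trans _ _ n%:R); last by rewrite ler_nat leqW.
    by near: n; exact: nbhs_infty_ger.
  by move=> hn; apply: cvg_near_cst.
- exact: integrable_norm fi.
- move=> n t _; rewrite normrM -[leRHS]mulr1 ler_wpM2l//.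
  by rewrite indicE; case: (_ \in _); rewrite ?normr1 ?normr0.
have : Rintegral mu H (u n) @[n --> \oo] --> (0 - 0 : R).
  by under eq_fun do rewrite uE; apply: cvgB.
by rewrite subr0 => h0; apply: (cvg_unique _ h h0).
Unshelve. all: by end_near.
Qed.

Lemma powR_expRN_cvg0 (m a : R) (k : R -> R) : 0 < m -> 0 < a ->
  (forall t, `|k t| <= 1) ->
  (n.+1%:R^-1 `^ m * expR (- (a * n.+1%:R^-1)) * k n.+1%:R^-1 @[n --> \oo] --> (0 : R)) /\
  (n.+2%:R `^ m * expR (- (a * n.+2%:R)) * k n.+2%:R @[n --> \oo] --> (0 : R)).
Proof.
move=> m0 a0 k1.
have bnd x t : 0 <= x -> `|x * k t| <= x.
  by move=> x0; rewrite normrM ger0_norm// -[leRHS]mulr1 ler_wpM2l.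
have sq (v w : nat -> R) : (forall n, 0 <= v n) -> v n @[n --> \oo] --> 0 ->
    v n * k (w n) @[n --> \oo] --> 0.
  move=> v0 hv; apply: norm_cvg0.
  apply: (@squeeze_cvgr _ _ _ _ (fun=> 0) v) => //; last exact: cvg_cst.
  by near=> n; rewrite normr_ge0/=; exact: bnd.
split; apply: sq.
- by move=> n; rewrite mulr_ge0 ?powR_ge0 ?expR_ge0.
- apply: (@squeeze_cvgr _ _ _ _ (fun=> 0) (fun n => n.+1%:R^-1 `^ m)) => //.
  + near=> n; rewrite mulr_ge0 ?powR_ge0 ?expR_ge0//=.
    rewrite -[leRHS]mulr1 ler_wpM2l ?powR_ge0// -expR0 ler_expR oppr_le0.
    by rewrite mulr_ge0 ?invr_ge0 ?(ltW a0).
  + exact: cvg_cst.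
  + have /cvg_at_rightP := powR_cvg0 m0.
    by apply; split; [move=> n; rewrite invr_gt0|exact: cvg_harmonic].
- by move=> n; rewrite mulr_ge0 ?powR_ge0 ?expR_ge0.
- have a2 : 0 < a / 2 by rewrite divr_gt0.
  have [C C0 hC] := powR_le_expR m0 a2.
  apply: (@squeeze_cvgr _ _ _ _ (fun=> 0) (fun n => C * expR (- (a / 2)) ^+ n.+2)) => //.
  + near=> n; rewrite mulr_ge0 ?powR_ge0 ?expR_ge0//=.
    apply: (@le_trans _ _ (C * expR (a / 2 * n.+2%:R) * expR (- (a * n.+2%:R)))).
      by rewrite ler_wpM2r ?expR_ge0 ?hC//.
    by rewrite -mulrA -expRD -expRM_natl ler_wpM2l ?(ltW C0)// ler_expR; lra.
  + exact: cvg_cst.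
  + rewrite -(mulr0 C); apply: cvgM; first exact: cvg_cst.
    have h : expR (- (a / 2)) ^+ n @[n --> \oo] --> 0.
      apply: cvg_expr.
      by rewrite ger0_norm ?expR_ge0// -[X in _ < X]expR0 ltr_expR oppr_lt0.
    by move: h; rewrite -(cvg_shiftn 2); under eq_fun do rewrite addn2.
Unshelve. all: by end_near.
Qed.

End halfline_calculus.

(** * Gamma integrals with an oscillating factor *)

Section oscillating_gamma.
Local Open Scope classical_set_scope.
Context {R : realType}.
Local Notation mu := (@lebesgue_measure R).
Local Notation H := (@halfline R : set (measurableTypeR R)).
Variable a : R.
Hypothesis a0 : 0 < a.

(** For [k] the cosine and the sine these are the real and imaginary parts of the integral of t^m
    exp (i zeta t) with zeta = b + i a; keeping [k] abstract treats both at once. *)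
Definition osc_gamma (k : R -> R) (m b : R) : R :=
  Rintegral mu H (fun t => t `^ m * expR (- (a * t)) * k (b * t)).

Lemma powRS (t m : R) : 0 < t -> t `^ (m + 1) = t `^ m * t.
Proof.
move=> t0; rewrite powRD; last by apply/implyP => _; rewrite gt_eqF.
by rewrite powRr1// ltW.
Qed.

Section one_kernel.
Variables k k1 : R -> R.
Hypothesis dk : forall x : R, is_derive x 1 k (k1 x).
Hypotheses (kb : forall x, `|k x| <= 1) (k1b : forall x, `|k1 x| <= 1).
Hypotheses (ck : continuous k) (ck1 : continuous k1).

Lemma measurable_mull_continuous (h : R -> R) (b : R) : continuous h ->
  measurable_fun H (fun t => h (b * t)).
Proof.
move=> ch; apply: measurableT_comp; first exact: continuous_measurable_fun.
exact: measurable_funM.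
Qed.

Lemma osc_gamma_integrable (h : R -> R) (m b : R) : 0 < m ->
  continuous h -> (forall x, `|h x| <= 1) ->
  mu.-integrable H (EFin \o (fun t => t `^ m * expR (- (a * t)) * h (b * t))).
Proof.
move=> m0 ch hb; apply: (integrable_mulr_bounded (M := 1)) => //.
  exact: integrable_powR_expRN.
exact: measurable_mull_continuous.
Qed.

Lemma osc_gamma_derive (m b : R) : 0 < m ->
  is_derive b 1 (osc_gamma k m) (osc_gamma k1 (m + 1) b).
Proof.
move=> m0; have m1 : 0 < m + 1 by rewrite addr_gt0.
pose f (b t : R) := t `^ m * expR (- (a * t)) * k (b * t).
have df (x t : R) : is_derive x 1 (f ^~ t)
    (t `^ m * expR (- (a * t)) * (k1 (x * t) * t)).
  have d1 : is_derive x (1 : R) (fun x : R => x * t) t.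
    by apply: is_derive_eq; rewrite /GRing.scale/=; ring.
  have d2 := @is_derive1_comp _ k (fun x => x * t) x _ _ (dk (x * t)) d1.
  exact: is_deriveZ.
have p1E (x t : R) : partial1of2 f x t = t `^ m * expR (- (a * t)) * (k1 (x * t) * t).
  by rewrite /partial1of2 derive1E; have [_ ->] := df x t.
pose G (t : R) := t `^ (m + 1) * expR (- (a * t)).
have mH := @measurable_halfline R.
have bI : `]b - 1, b + 1[%classic b by rewrite /= in_itv/= ltrBlDr ltrDl ltr01.
have h1 (x : R) : `]b - 1, b + 1[%classic x -> mu.-integrable H (EFin \o f x).
  by move=> _; exact: osc_gamma_integrable.
have h2 (x t : R) : `]b - 1, b + 1[%classic x -> H t -> derivable (f^~ t) x 1.
  by move=> _ _; have [] := df x t.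
have h3 t : 0 <= G t by rewrite mulr_ge0 ?powR_ge0 ?expR_ge0.
have h4 : mu.-integrable H (EFin \o G) by exact: integrable_powR_expRN.
have h5 (x t : R) : `]b - 1, b + 1[%classic x -> H t -> `|partial1of2 f x t| <= G t.
  move=> _ /halflineP t0; rewrite p1E /G powRS// !normrM.
  rewrite (ger0_norm (powR_ge0 _ _)) (ger0_norm (expR_ge0 _)) (gtr0_norm t0).
  rewrite (_ : t `^ m * t * expR (- (a * t)) = t `^ m * expR (- (a * t)) * (1 * t)); last by ring.
  rewrite ler_wpM2l ?mulr_ge0 ?powR_ge0 ?expR_ge0//.
  by rewrite ler_wpM2r// ltW.
have D1 := derivable_under_integral mH bI h1 h2 h3 h4 h5.
have D2 := differentiation_under_integral mH bI h1 h2 h3 h4 h5.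
split; first exact: D1.
rewrite -derive1E [LHS]D2; apply: eq_Rintegral => t /set_mem/halflineP t0.
by rewrite p1E powRS//; ring.
Qed.

(** The derivative of t^(m+1) exp (- a t) k (b t) has integral zero over the half-line, as the
    function tends to 0 at both ends. *)
Lemma osc_gamma_parts (m b : R) : 0 < m ->
  (m + 1) * osc_gamma k m b =
  a * osc_gamma k (m + 1) b - b * osc_gamma k1 (m + 1) b.
Proof.
move=> m0; have m1 : 0 < m + 1 by rewrite addr_gt0.
have mH := @measurable_halfline R.
pose F t := t `^ (m + 1) * expR (- (a * t)) * k (b * t).
pose A t := t `^ m * expR (- (a * t)) * k (b * t).
pose B t := t `^ (m + 1) * expR (- (a * t)) * k1 (b * t).
pose f t := (m + 1) * A t - (a * F t - b * B t).
have iA : mu.-integrable H (EFin \o A) by exact: osc_gamma_integrable.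
have iB : mu.-integrable H (EFin \o B) by exact: osc_gamma_integrable.
have iF : mu.-integrable H (EFin \o F) by exact: osc_gamma_integrable.
have iA' := integrable_mull mH (m + 1) iA.
have iF' := integrable_mull mH a iF.
have iB' := integrable_mull mH b iB.
have iFB : mu.-integrable H (EFin \o (fun t => a * F t - b * B t)).
  exact: (integrableB mH iF' iB').
have fi : mu.-integrable H (EFin \o f) by exact: (integrableB mH iA' iFB).
have dF (t : R) : 0 < t -> is_derive t 1 F (f t).
  move=> t0.
  have d1 := is_derive1_powR (m + 1) t0.
  have d0 (c : R) : is_derive t (1 : R) (fun x : R => c * x) c.
    by apply: is_derive_eq; rewrite /GRing.scale/=; ring.
  have d2 : is_derive t 1 (fun x => expR (- (a * x))) (expR (- (a * t)) * - a).
    exact: (@is_derive1_comp _ expR (fun x => - (a * x))).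
  have d3 := @is_derive1_comp _ k (fun x => b * x) t _ _ (dk (b * t)) (d0 b).
  have d12 := is_deriveM d1 d2.
  have d123 := is_deriveM d12 d3.
  apply: (is_derive_eq d123).
  rewrite /f /A /B /F /GRing.scale/= addrK !fctE /=; ring.
have cf (t : R) : 0 < t -> {for t, continuous f}.
  move=> t0.
  have cp (n : R) : {for t, continuous (fun x : R => x `^ n)}.
    apply: differentiable_continuous; apply/derivable1_diffP.
    by have [] := is_derive1_powR n t0.
  have cl (c : R) : {for t, continuous (fun x : R => c * x)}.
    by apply: cvgM; [exact: cvg_cst|exact: cvg_id].
  have ce : {for t, continuous (fun x => expR (- (a * x)))}.
    by apply: continuous_comp; [apply: cvgN; exact: cl|exact: continuous_expR].
  have cK (h : R -> R) : continuous h -> {for t, continuous (fun x => h (b * x))}.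
    by move=> ch; apply: continuous_comp; [exact: cl|exact: ch].
  have cc (n : R) (h : R -> R) : continuous h ->
      {for t, continuous (fun x => x `^ n * expR (- (a * x)) * h (b * x))}.
    move=> ch; apply: cvgM; [apply: cvgM; [exact: cp|exact: ce]|exact: cK].
  apply: cvgB; first by apply: cvgM; [exact: cvg_cst|exact: cc].
  by apply: cvgB; (apply: cvgM; [exact: cvg_cst|exact: cc]).
have [z1 z2] := @powR_expRN_cvg0 R (m + 1) a (fun t => k (b * t)) m1 a0 (fun t => kb _).
have := integral_halfline_derive dF cf fi z1 z2.
rewrite RintegralB// RintegralB// !RintegralZl// => /eqP.
by rewrite subr_eq0 => /eqP.
Qed.

End one_kernel.

End oscillating_gamma.

(** * Closed form of the Gamma integrals *)

Section gamma_closed_form.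
Local Open Scope complex_scope.
Local Open Scope classical_set_scope.
Context {R : realType}.
Local Notation mu := (@lebesgue_measure R).
Local Notation H := (@halfline R : set (measurableTypeR R)).

Definition gammaR (x : R) : R := Rintegral mu H (fun t => t `^ (x - 1) * expR (- t)).

Let cb (x : R) : `|cos x| <= 1. Proof. by rewrite ler_norml cos_geN1 cos_le1. Qed.
Let sb (x : R) : `|sin x| <= 1. Proof. by rewrite ler_norml sin_geN1 sin_le1. Qed.
Let cc : continuous (@cos R). Proof. exact: continuous_cos. Qed.
Let cs : continuous (@sin R). Proof. exact: continuous_sin. Qed.
Let csN : continuous (fun x : R => - sin x).
Proof. by move=> x; apply: cvgN; exact: continuous_sin. Qed.
Let sbN (x : R) : `|- sin x| <= 1. Proof. by rewrite normrN. Qed.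

Section fixed_parameters.
Variables (a m : R).
Hypotheses (a0 : 0 < a) (m0 : 0 < m).

Let C := osc_gamma a cos m.
Let S := osc_gamma a sin m.
Let C1 := osc_gamma a cos (m + 1).
Let S1 := osc_gamma a sin (m + 1).

Let m1 : 0 < m + 1. Proof. by rewrite addr_gt0. Qed.

Let osc_sinN (b : R) : osc_gamma a (fun x : R => - sin x) (m + 1) b = - S1 b.
Proof.
rewrite /S1 /osc_gamma -mulN1r -RintegralZl//; last exact: osc_gamma_integrable.
  by apply: eq_Rintegral => t _; ring.
exact: measurable_halfline.
Qed.

Let dC (b : R) : is_derive b 1 C (- S1 b).
Proof. by rewrite -osc_sinN; apply: osc_gamma_derive. Qed.

Let dS (b : R) : is_derive b 1 S (C1 b).
Proof. by apply: osc_gamma_derive. Qed.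

Let pC (b : R) : (m + 1) * C b = a * C1 b + b * S1 b.
Proof.
have := @osc_gamma_parts R a a0 cos (fun x : R => - sin x) _ cb sbN cc csN m b m0.
by rewrite osc_sinN mulrN opprK; exact.
Qed.

Let pS (b : R) : (m + 1) * S b = a * S1 b - b * C1 b.
Proof. by apply: (@osc_gamma_parts R a a0 sin cos _ sb cb cs cc m b m0). Qed.

Let rho (b : R) := a ^+ 2 + b ^+ 2.
Let rho_gt0 (b : R) : 0 < rho b.
Proof. by rewrite ltr_wpDr ?sqr_ge0// exprn_gt0. Qed.

Let rho_neq0 (b : R) : rho b != 0. Proof. by rewrite gt_eqF. Qed.

(** The two integrations by parts are a linear system for [C1] and [S1] with determinant a^2 + b^2;
    solving it turns [dC] and [dS] into a differential equation in b for [C] and [S]. *)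
Let C1E (b : R) : C1 b = (m + 1) * (a * C b - b * S b) / rho b.
Proof.
apply: (mulIf (rho_neq0 b)); rewrite divfK//.
rewrite (_ : (m + 1) * (a * C b - b * S b) = a * ((m + 1) * C b) - b * ((m + 1) * S b)).
  by rewrite pC pS /rho; ring.
by ring.
Qed.

Let S1E (b : R) : S1 b = (m + 1) * (b * C b + a * S b) / rho b.
Proof.
apply: (mulIf (rho_neq0 b)); rewrite divfK//.
rewrite (_ : (m + 1) * (b * C b + a * S b) = b * ((m + 1) * C b) + a * ((m + 1) * S b)).
  by rewrite pC pS /rho; ring.
by ring.
Qed.

Let th (b : R) := (m + 1) * atan (b / a).
Let r (b : R) := expR ((m + 1) / 2 * ln (rho b)).

Let dth (b : R) : is_derive b 1 th ((m + 1) * a / rho b).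
Proof.
have d0 : is_derive b 1 (fun x : R => x / a) a^-1.
  by apply: is_derive_eq; rewrite /GRing.scale/=; ring.
have d1 := @is_derive1_comp _ atan (fun x => x / a) b _ _ (is_derive1_atan (b / a)) d0.
have d2 := is_deriveZ (m + 1) d1.
apply: (is_derive_eq d2); rewrite /GRing.scale/= /rho.
by field; rewrite !gt_eqF// ltr_wpDr ?sqr_ge0// exprn_gt0.
Qed.

Let dr (b : R) : is_derive b 1 r (r b * ((m + 1) * b / rho b)).
Proof.
have d0 : is_derive b 1 rho (2 * b).
  by apply: is_derive_eq; rewrite /GRing.scale/=; ring.
have d1 := @is_derive1_comp _ (@ln R) rho b _ _ (is_derive1_ln (rho_gt0 b)) d0.
have d2 := is_deriveZ ((m + 1) / 2) d1.
have d3 := @is_derive1_comp _ expR (fun x => (m + 1) / 2 * ln (rho x)) b _ _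
  (is_derive_expR _) d2.
apply: (is_derive_eq d3); rewrite /GRing.scale/= /r.
by congr (_ * _); field; exact: rho_neq0.
Qed.

Let dcos (b : R) : is_derive b 1 (fun x => cos (th x)) (- sin (th b) * ((m + 1) * a / rho b)).
Proof. exact: (@is_derive1_comp _ cos th b _ _ (is_derive_cos _) (dth b)). Qed.
Let dsin (b : R) : is_derive b 1 (fun x => sin (th x)) (cos (th b) * ((m + 1) * a / rho b)).
Proof. exact: (@is_derive1_comp _ sin th b _ _ (is_derive_sin _) (dth b)). Qed.

(** X + i Y is (a - i b)^(m+1) (C + i S), the first factor having modulus [r] and argument [- th].
    It will turn out to be constant in b, so its value at b = 0 gives C + i S. *)
Let X (b : R) := r b * (C b * cos (th b) + S b * sin (th b)).
Let Y (b : R) := r b * (S b * cos (th b) - C b * sin (th b)).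

Let dX (b : R) : is_derive b 1 X 0.
Proof.
have d := is_deriveM (dr b) (is_deriveD (is_deriveM (dC b) (dcos b)) (is_deriveM (dS b) (dsin b))).
apply: (is_derive_eq d); rewrite /GRing.scale/= !fctE/= C1E S1E.
by field; exact: rho_neq0.
Qed.

Let dY (b : R) : is_derive b 1 Y 0.
Proof.
have d := is_deriveM (dr b) (is_deriveB (is_deriveM (dS b) (dcos b)) (is_deriveM (dC b) (dsin b))).
apply: (is_derive_eq d); rewrite /GRing.scale/= !fctE/= C1E S1E.
by field; exact: rho_neq0.
Qed.

Let th0 : th 0 = 0. Proof. by rewrite /th mul0r atan0 mulr0. Qed.

Let S0 : S 0 = 0.
Proof.
rewrite /S /osc_gamma; under eq_Rintegral do rewrite mul0r sin0 mulr0.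
by rewrite /Rintegral integral0.
Qed.

Let C0 : C 0 = a `^ (- (m + 1)) * gammaR (m + 1).
Proof.
have mH := @measurable_halfline R.
rewrite /C /osc_gamma; under eq_Rintegral do rewrite mul0r cos0 mulr1.
rewrite /gammaR addrK.
have i1 := integrable_powR_expRN m0 (@ltr01 R).
have E : (\int[mu]_(t in H) (t `^ m * expR (- t))%:E =
   (a `^ (m + 1))%:E * \int[mu]_(t in H) (t `^ m * expR (- (a * t)))%:E)%E.
  rewrite (@ge0_integral_affine _ a 0 (lt0r_neq0 a0) H)//; last 2 first.
  - apply/measurable_EFinP; have := @measurable_powR_expRN R m 1.
    by apply: eq_measurable_fun => t _; rewrite mul1r.
  - by move=> t _; rewrite lee_fin mulr_ge0 ?powR_ge0 ?expR_ge0.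
  have -> : [set x : R | H (a * x + 0)] = H.
    by apply/seteqP; split=> t /=; rewrite /halfline/= !in_itv/= !andbT addr0 pmulr_rgt0.
  rewrite gtr0_norm//.
  rewrite [X in (_ * X)%E](_ : _ = (a `^ m)%:E * \int[mu]_(t in H) (t `^ m * expR (- (a * t)))%:E)%E.
    by rewrite muleA -EFinM powRS// [a * _]mulrC.
  rewrite -integralZl//; last exact: (integrable_powR_expRN m0 a0).
  apply: eq_integral => t /set_mem/halflineP t0.
  by rewrite addr0 powRM ?ltW// -EFinM mulrA.
rewrite /Rintegral E fineM//; last exact: integrable_fin_num (integrable_powR_expRN m0 a0).
by rewrite /= mulrA -powRD ?addNr ?powRr0 ?mul1r//; apply/implyP => _; rewrite gt_eqF.
Qed.

Let r0 : r 0 = a `^ (m + 1).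
Proof.
rewrite /r /rho expr0n addr0 powR_expR// lnXn//; congr expR.
by rewrite -[ln a *+ 2]mulr_natl; field.
Qed.

Let X0 : X 0 = gammaR (m + 1).
Proof.
rewrite /X th0 cos0 sin0 mulr1 mulr0 addr0 r0 C0 mulrA -powRD.
  by rewrite subrr powRr0 mul1r.
by apply/implyP => _; rewrite gt_eqF.
Qed.

Let Y0 : Y 0 = 0.
Proof. by rewrite /Y th0 cos0 sin0 S0 mul0r mulr0 subrr mulr0. Qed.

Lemma osc_gamma_cos_sin b :
  osc_gamma a cos m b = gammaR (m + 1) * expR (- ((m + 1) / 2 * ln (a ^+ 2 + b ^+ 2)))
    * cos ((m + 1) * atan (b / a)) /\
  osc_gamma a sin m b = gammaR (m + 1) * expR (- ((m + 1) / 2 * ln (a ^+ 2 + b ^+ 2)))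
    * sin ((m + 1) * atan (b / a)).
Proof.
have Xb : X b = gammaR (m + 1) by rewrite -X0; exact: is_derive_0_is_cst.
have Yb : Y b = 0 by rewrite -Y0; exact: is_derive_0_is_cst.
rewrite -/(C b) -/(S b) expRN -/(rho b) -/(r b) -/(th b) -Xb.
have rn0 : r b != 0 by rewrite gt_eqF// expR_gt0.
have Yb' : S b * cos (th b) - C b * sin (th b) = 0.
  by apply: (mulfI rn0); rewrite mulr0; exact: Yb.
have cs1 : cos (th b) ^+ 2 + sin (th b) ^+ 2 = 1 by exact: cos2Dsin2.
rewrite /X; split.
  (* Rotating back: as Y = 0, C equals cos th times C cos th + S sin th. *)
  have -> : C b = C b * (cos (th b) ^+ 2 + sin (th b) ^+ 2)
     + sin (th b) * (S b * cos (th b) - C b * sin (th b)).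
    by rewrite cs1 Yb'; ring.
  by rewrite [in RHS]cs1 [in RHS]Yb' mulr1 mulr0 addr0; field.
have -> : S b = S b * (cos (th b) ^+ 2 + sin (th b) ^+ 2)
   - cos (th b) * (S b * cos (th b) - C b * sin (th b)).
  by rewrite cs1 Yb'; ring.
by rewrite [in RHS]cs1 [in RHS]Yb' mulr1 mulr0 subr0; field.
Qed.

End fixed_parameters.

(** Integration by parts at a = 1 and b = 0. *)
Lemma gammaRS (x : R) : 1 < x -> gammaR (x + 1) = x * gammaR x.
Proof.
move=> x1; have m0 : 0 < x - 1 by rewrite subr_gt0.
have := @osc_gamma_parts R 1 ltr01 cos (fun x : R => - sin x) _ cb sbN cc csN (x - 1) 0 m0.
rewrite subrK mul1r mul0r subr0 => h.
have E y : osc_gamma 1 cos (y - 1) 0 = gammaR y.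
  by apply: eq_Rintegral => t _; rewrite mul0r cos0 mulr1 mul1r.
by rewrite -!E addrK -h// subrK.
Qed.

(** A zero integral would make the positive integrand vanish almost everywhere, hence the half-line
    a null set. *)
Lemma gammaR_gt0 (x : R) : 1 < x -> 0 < gammaR x.
Proof.
move=> x1; have m0 : 0 < x - 1 by rewrite subr_gt0.
have i1 := integrable_powR_expRN m0 (@ltr01 R).
have ge0 : 0 <= gammaR x.
  by apply: Rintegral_ge0 => t _; rewrite mulr_ge0 ?powR_ge0 ?expR_ge0.
rewrite lt_neqAle ge0 andbT; apply/negP => /eqP/esym g0.
have mH := @measurable_halfline R.
have [+ _] := @ae_eq_integral_abs _ _ _ mu H mH _ (measurable_int _ i1).
have -> : (\int[mu]_(t in H) `|(EFin \o (fun t : R => t `^ (x - 1) * expR (- (1 * t)))%R) t| = 0)%E.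
  rewrite -[RHS]/(0%:E) -g0 /gammaR /Rintegral.
  have E : (\int[mu]_(t in H) (t `^ (x - 1) * expR (- t))%:E =
      \int[mu]_(t in H) (t `^ (x - 1) * expR (- (1 * t)))%:E)%E.
    by apply: eq_integral => t _; rewrite mul1r.
  rewrite E fineK; last exact: integrable_fin_num i1.
  apply: eq_integral => t _ /=.
  by rewrite ger0_norm ?mulr_ge0 ?powR_ge0 ?expR_ge0.
move=> /(_ erefl) [N [mN N0 hN]].
have : (mu H <= mu N)%E.
  apply: le_measure; rewrite ?inE// => t Ht; apply: hN => /= h.
  have /= [] := h Ht => /eqP; rewrite mulf_eq0 gt_eqF ?powR_gt0 ?gt_eqF ?expR_gt0//.
  by move: Ht => /halflineP.
by rewrite N0 /halfline lebesgue_measure_itv/= ltry addye// leye_eq.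
Qed.

Lemma cexp_kernelE (zeta : R[i]) (t : R) : cexp ('i%C * zeta * t%:C) =
  (expR (- (complex.Im zeta * t)))%:C *
  (cos (complex.Re zeta * t) +i* sin (complex.Re zeta * t)).
Proof.
rewrite /cexp; congr (_%:C * (cos _ +i* sin _)); try congr expR;
  by rewrite !cplxE/=; ring.
Qed.

(** The value is Gamma(x) (- i zeta)^(-x) in the principal branch; all Gram matrices are computed
    from it. *)
Lemma gamma_integral (x : R) (zeta : R[i]) : 1 < x -> upper_half_plane zeta ->
  cintegrable mu H (fun t => (t `^ (x - 1))%:C * cexp ('i%C * zeta * t%:C)) /\
  cintegral mu H (fun t => (t `^ (x - 1))%:C * cexp ('i%C * zeta * t%:C)) =
  (gammaR x)%:C * cexp (- (x%:C * uhp_log zeta)).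
Proof.
move=> x1; rewrite /upper_half_plane/= => a0.
have m0 : 0 < x - 1 by rewrite subr_gt0.
set a := complex.Im zeta; set b := complex.Re zeta.
have reE t : complex.Re ((t `^ (x - 1))%:C * cexp ('i%C * zeta * t%:C)) =
   t `^ (x - 1) * expR (- (a * t)) * cos (b * t).
  by rewrite cexp_kernelE !cplxE/= -/a -/b; ring.
have imE t : complex.Im ((t `^ (x - 1))%:C * cexp ('i%C * zeta * t%:C)) =
   t `^ (x - 1) * expR (- (a * t)) * sin (b * t).
  by rewrite cexp_kernelE !cplxE/= -/a -/b; ring.
split.
  split.
    by under eq_fun do rewrite reE; exact: osc_gamma_integrable.
  by under eq_fun do rewrite imE; exact: osc_gamma_integrable.
have [hc hs] := osc_gamma_cos_sin a0 m0 b.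
rewrite subrK in hc hs.
have lnE : csqn zeta = a ^+ 2 + b ^+ 2 by rewrite /csqn addrC.
apply: complex_eqP.
  transitivity (osc_gamma a cos (x - 1) b); first by apply: eq_Rintegral => t _; exact: reE.
  rewrite hc ReM Re_cexp !cplxE/= -/a -/b lnE !(mul0r, subr0, addr0, mulrN, opprK).
  by rewrite mulrA; congr (_ * expR _ * _); ring.
transitivity (osc_gamma a sin (x - 1) b); first by apply: eq_Rintegral => t _; exact: imE.
rewrite hs ImM Im_cexp !cplxE/= -/a -/b lnE !(mul0r, subr0, addr0, mulrN, opprK).
by rewrite mulrA; congr (_ * expR _ * _); ring.
Qed.

End gamma_closed_form.

(** * The Laplace models of the representations *)

Section laplace_model.
Local Open Scope complex_scope.
Local Open Scope classical_set_scope.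
Context {R : realType}.
Local Notation mu := (@leb R).
Local Notation H := (@halfline R : set (measurableTypeR R)).
Local Notation uhp := (@upper_half_plane R).
Variable lambda : R.
Hypothesis l1 : 1 < lambda.

Definition lap_weight (t : R) : R := t `^ (1 - lambda).

Definition lap_ker (z : R[i]) (t : R) : R[i] :=
  (t `^ (lambda - 1))%:C * conjc (cexp ('i%C * z * t%:C)).

Let mH := @measurable_halfline R.

Lemma lap_weightE t : lap_weight t = (t `^ (lambda - 1))^-1.
Proof. by rewrite -powRN opprB. Qed.

Lemma lap_weight_gt0 t : H t -> 0 < lap_weight t.
Proof. by move=> /halflineP t0; rewrite powR_gt0. Qed.

Lemma measurable_lap_weight : measurable_fun H lap_weight.
Proof. by apply: measurable_funTS; exact: measurable_powR. Qed.

Lemma cexp_kernel_csqn (z : R[i]) (t : R) :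
  csqn (cexp ('i%C * z * t%:C)) = expR (- (2 * complex.Im z * t)).
Proof. by rewrite csqn_cexp -expRM_natl !cplxE/=; congr expR; ring. Qed.

Lemma cmeasurable_cexp_kernel (z : R[i]) : cmeasurable H (fun t => cexp ('i%C * z * t%:C)).
Proof.
have m (h : R -> R) (b : R) : continuous h -> measurable_fun H (fun t => h (b * t)).
  exact: measurable_mull_continuous.
have me : measurable_fun H (fun t : R => expR (- (complex.Im z * t))).
  have := m _ (- complex.Im z) (@continuous_expR R).
  by apply: eq_measurable_fun => t _; rewrite mulNr.
have := @cmeasurableM _ _ R H _ _ (cmeasurableC me)
  (_ : cmeasurable H (fun t => cos (complex.Re z * t) +i* sin (complex.Re z * t))).
move=> h; apply: eq_cmeasurable (h _).
  by move=> t _; rewrite cexp_kernelE.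
by split => /=; apply: m; [exact: continuous_cos|exact: continuous_sin].
Qed.

Lemma cmeasurable_lap_ker z : cmeasurable H (lap_ker z).
Proof.
apply: cmeasurableM; last exact/cmeasurable_conj/cmeasurable_cexp_kernel.
by apply: cmeasurableC; apply: measurable_funTS; exact: measurable_powR.
Qed.

Lemma lap_ker_csqn z t : 0 < t -> csqn (lap_ker z t) * lap_weight t =
  t `^ (lambda - 1) * expR (- (2 * complex.Im z * t)).
Proof.
move=> t0; rewrite /lap_ker csqnM csqnJ cexp_kernel_csqn csqnC lap_weightE.
have p0 : t `^ (lambda - 1) != 0 by rewrite gt_eqF// powR_gt0.
by field.
Qed.

Lemma L2_lap_ker z : uhp z -> L2R lambda (lap_ker z).
Proof.
move=> z0; apply: (@L2_dominated _ _ _ mu H lap_weight mH measurable_lap_weight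
    (@lap_weight_gt0) _ _ (cmeasurable_lap_ker z)
    (integrable_powR_expRN (m := lambda - 1) (a := 2 * complex.Im z) _ _)).
- by rewrite subr_gt0.
- by rewrite mulr_gt0.
- by move=> t /halflineP t0; rewrite lap_ker_csqn.
Qed.

(** The power in [lap_ker] cancels the weight of the space. *)
Lemma laplace_cip h z : laplace h z = cip mu H lap_weight h (lap_ker z).
Proof.
apply: eq_cintegral => t /set_mem/halflineP t0.
rewrite /lap_ker conjcM conjcK conjc_real lap_weightE.
have p0 : (t `^ (lambda - 1))%:C != 0 :> R[i].
  by apply/eqP => -[/eqP]; rewrite gt_eqF// powR_gt0.
by rewrite fmorphV; field.
Qed.

Lemma lap_ker_gram z w : uhp z -> uhp w ->
  laplace (lap_ker w) z = (gammaR lambda)%:C * cexp (- (lambda%:C * uhp_log (z - conjc w))).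
Proof.
move=> hz hw; have [_ <-] := gamma_integral l1 (uhp_subJ hz hw).
apply: eq_cintegral => t _; rewrite /lap_ker -mulrA; congr (_ * _).
rewrite -cexpJ -cexpD; congr cexp.
have -> : conjc ('i%C * w * t%:C) = - 'i%C * conjc w * t%:C :> R[i].
  by apply: complex_eqP; rewrite !cplxE/=; ring.
by ring.
Qed.

Section action.
Variable g : universal_SL2 R.
Local Notation phi := (SL2_log g).
Local Notation B := (invmx (SL2_mx g)).

(** Pairing with this function evaluates at z the transform moved by g; the factor is conjugated
    because [cip] is antilinear in its second argument. *)
Definition lap_ker_act (z : R[i]) (t : R) : R[i] :=
  conjc (cexp (- (lambda%:C * phi z))) * lap_ker (mobius B z) t.

Lemma L2_lap_ker_act z : uhp z -> L2R lambda (lap_ker_act z).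
Proof.
move=> hz; apply: L2Z => //.
- exact: measurable_lap_weight.
- exact: lap_weight_gt0.
- by apply: L2_lap_ker; exact: mobius_uhp.
Qed.

Lemma disc_series_cip h z : L2R lambda h -> uhp z ->
  disc_series lambda g (laplace h) z = cip mu H lap_weight h (lap_ker_act z).
Proof.
move=> Lh hz; rewrite cipZr//; first by rewrite conjcK -laplace_cip.
- exact: measurable_lap_weight.
- exact: lap_weight_gt0.
- by apply: L2_lap_ker; exact: mobius_uhp.
Qed.

(** By [uhp_log_mobius] the automorphy factors at z and w cancel, so the kernels and their images
    under g have equal Gram matrices. *)
Lemma lap_ker_act_gram z w : uhp z -> uhp w ->
  disc_series lambda g (laplace (lap_ker_act w)) z = laplace (lap_ker w) z.
Proof.
move=> hz hw; have hgz := mobius_uhp g hz; have hgw := mobius_uhp g hw.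
rewrite /disc_series.
have -> : laplace (lap_ker_act w) (mobius B z) =
  conjc (cexp (- (lambda%:C * phi w))) * laplace (lap_ker (mobius B w)) (mobius B z).
  rewrite !laplace_cip cipZl//.
  - exact: measurable_lap_weight.
  - exact: lap_weight_gt0.
  - exact: L2_lap_ker.
  - exact: L2_lap_ker.
rewrite !lap_ker_gram// uhp_log_mobius// -cexpJ.
have E (x y u v : R[i]) : x * (y * (u * v)) = u * (x * y * v) by ring.
rewrite E -!cexpD; congr (_ * cexp _).
have -> : conjc (- (lambda%:C * phi w)) = - (lambda%:C * conjc (phi w)).
  by apply: complex_eqP; rewrite !cplxE/=; ring.
by ring.
Qed.

(** Transport between the kernels and their images: the range of the Laplace transform is stable
    under the action. *)
Lemma disc_series_transport h : L2R lambda h ->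
  exists2 h', L2R lambda h' &
    forall z, uhp z -> laplace h' z = disc_series lambda g (laplace h) z.
Proof.
move=> Lh; pose I := {z : R[i] | uhp z}.
have i0 : I by exists 'i%C; rewrite /upper_half_plane/=.
have [||| h' Lh' hh] := @L2_transport _ _ R mu H lap_weight mH
  measurable_lap_weight (@lap_weight_gt0) I
  (fun z => lap_ker (proj1_sig z)) (fun z => lap_ker_act (proj1_sig z)) i0 _ _ _ h Lh.
- by move=> [z hz]; exact: L2_lap_ker.
- by move=> [z hz]; exact: L2_lap_ker_act.
- move=> [w hw] [z hz] /=.
  rewrite -laplace_cip -disc_series_cip ?lap_ker_act_gram//; exact: L2_lap_ker_act.
exists h' => // z hz; rewrite disc_series_cip// laplace_cip.
exact: (hh (exist _ z hz)).
Qed.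

(** [laplace_inv] selects by [xget]; there is an element to select by the preceding lemma, so the
    selection has the defining property. *)
Lemma hat_piP h : L2R lambda h -> L2R lambda (hat_pi lambda g h) /\
  forall z, uhp z -> laplace (hat_pi lambda g h) z = disc_series lambda g (laplace h) z.
Proof.
move=> Lh; have [h' Lh' hh'] := disc_series_transport Lh.
rewrite /hat_pi /laplace_inv /inverse_on /=.
set S := [set _ | _].
by have : S (xget (fun=> 0) S) by apply: xgetPex; exists h'.
Qed.

End action.

(** At z = i (n + 1) the transform is the n-th moment of h(t) exp (- t); the extra exponential makes
    this function integrable, as the moment lemma demands. *)
Lemma laplace_inj h : L2R lambda h -> (forall z, uhp z -> laplace h z = 0) ->
  eq_ae mu H h (fun=> 0).
Proof.
move=> Lh h0.
pose g t := h t * cexp ('i%C * 'i%C * t%:C).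
have ui n : uhp ((n%:R : R)%:C * 'i%C + 'i%C).
  by rewrite /upper_half_plane/= !(mulr0, mul0r, add0r, addr0, mulr1) ltr_wpDl.
have gE n t : h t * cexp ('i%C * ((n%:R : R)%:C * 'i%C + 'i%C) * t%:C) =
   g t * (expR (- (n%:R * t)))%:C.
  rewrite /g -[RHS]mulrA; congr (_ * _).
  have -> : (expR (- (n%:R * t)))%:C = cexp ((- (n%:R * t))%:C).
    by rewrite /cexp/= cos0 sin0 complexr0 mulr1.
  rewrite -cexpD; congr cexp; apply: complex_eqP; rewrite !cplxE/=; ring.
have gi : cintegrable mu H g.
  have := L2_cintegrable mH measurable_lap_weight (@lap_weight_gt0) Lh (L2_lap_ker (ui 0)).
  apply: (eq_cintegrable mH) => t /set_mem/halflineP t0.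
  rewrite /lap_ker conjcM conjcK conjc_real lap_weightE mul0r add0r.
  rewrite /g.
  have p0 : (t `^ (lambda - 1))%:C != 0 :> R[i].
    by apply/eqP => -[/eqP]; rewrite gt_eqF// powR_gt0.
  by rewrite fmorphV; field.
have g0 n : cintegral mu H (fun t => g t * (expR (- (n%:R * t)))%:C) = 0.
  by rewrite -[RHS](h0 _ (ui n)); apply: eq_cintegral => t _; rewrite gE.
have [gr gm] := gi.
have zr : {ae mu, forall t, H t -> complex.Re (g t) = 0}.
  apply: laplace_moments_eq0 => // n.
  have := congr1 (@complex.Re R) (g0 n); rewrite /= => <-.
  by apply: eq_Rintegral => t _; rewrite !cplxE/=; ring.
have zi : {ae mu, forall t, H t -> complex.Im (g t) = 0}.
  apply: laplace_moments_eq0 => // n.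
  have := congr1 (@complex.Im R) (g0 n); rewrite /= => <-.
  by apply: eq_Rintegral => t _; rewrite !cplxE/=; ring.
apply: filterS2 zr zi => t hr hi Ht.
have : g t = 0 by apply: complex_eqP; [exact: hr|exact: hi].
by move=> /eqP; rewrite mulf_eq0 (negbTE (cexp_neq0 _)) orbF => /eqP.
Qed.

End laplace_model.

(** * Products and sections of functions on a rectangle *)

Section product_integrals.
Local Open Scope complex_scope.
Local Open Scope classical_set_scope.
Context d1 d2 (T1 : measurableType d1) (T2 : measurableType d2) (R : realType).
Variables (m1 : {sigma_finite_measure set T1 -> \bar R})
  (m2 : {sigma_finite_measure set T2 -> \bar R}).
Variables (D1 : set T1) (D2 : set T2).
Hypotheses (mD1 : measurable D1) (mD2 : measurable D2).
Local Notation m12 := (m1 \x m2)%E.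

Let mD : measurable (D1 `*` D2). Proof. exact: measurableX. Qed.

Lemma measurable_rect_fst d (T : measurableType d) (f : T1 -> T) :
  measurable_fun D1 f -> measurable_fun (D1 `*` D2) (fun p => f p.1).
Proof.
move=> mf; apply: (measurable_comp (F := D1) mD1 _ mf).
  by move=> _ [p [p1 _] <-].
by apply: measurable_funTS; exact: measurable_fst.
Qed.

Lemma measurable_rect_snd d (T : measurableType d) (f : T2 -> T) :
  measurable_fun D2 f -> measurable_fun (D1 `*` D2) (fun p => f p.2).
Proof.
move=> mf; apply: (measurable_comp (F := D2) mD2 _ mf).
  by move=> _ [p [_ p2] <-].
by apply: measurable_funTS; exact: measurable_snd.
Qed.

Lemma cmeasurable_rect_fst (f : T1 -> R[i]) :
  cmeasurable D1 f -> cmeasurable (D1 `*` D2) (fun p => f p.1).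
Proof.
by move=> [f1 f2]; split; [exact: measurable_rect_fst f1|exact: measurable_rect_fst f2].
Qed.

Lemma cmeasurable_rect_snd (f : T2 -> R[i]) :
  cmeasurable D2 f -> cmeasurable (D1 `*` D2) (fun p => f p.2).
Proof.
by move=> [f1 f2]; split; [exact: measurable_rect_snd f1|exact: measurable_rect_snd f2].
Qed.

Lemma integrable_product (f1 : T1 -> R) (f2 : T2 -> R) :
  m1.-integrable D1 (EFin \o f1) -> m2.-integrable D2 (EFin \o f2) ->
  m12.-integrable (D1 `*` D2) (EFin \o (fun p => f1 p.1 * f2 p.2)).
Proof.
move=> i1 i2.
have mf1 : measurable_fun D1 f1 by apply/measurable_EFinP; exact: measurable_int i1.
have mf2 : measurable_fun D2 f2 by apply/measurable_EFinP; exact: measurable_int i2.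
apply: tonelli_integrable => //.
  by apply/measurable_EFinP/measurable_funM;
    [exact: measurable_rect_fst|exact: measurable_rect_snd].
have /integrableP[_ b2] := i2; have /integrableP[_ b1] := i1.
have E x : (\int[m2]_(y in D2) `|(EFin \o (fun p => f1 p.1 * f2 p.2)%R) (x, y)| =
    `|(f1 x)%:E| * \int[m2]_(y in D2) `|(f2 y)%:E|)%E.
  rewrite -ge0_integralZl//; last by apply: measurableT_comp => //; exact/measurable_EFinP.
  by apply: eq_integral => y _; rewrite /= normrM.
under eq_integral do rewrite E.
rewrite ge0_integralZr//; last 2 first.
- by apply: measurableT_comp => //; exact/measurable_EFinP.
- exact: integral_ge0.
by rewrite lte_mul_pinfty// ?integral_ge0// ge0_fin_numE// integral_ge0.
Qed.

(** Integrability is not assumed: the integral is the difference of those of the positive and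
    negative parts, and Tonelli applies to each. *)
Lemma measurable_Rintegral_section (g : T1 * T2 -> R) : measurable_fun (D1 `*` D2) g ->
  measurable_fun D1 (fun x => Rintegral m2 D2 (fun y => g (x, y))).
Proof.
move=> mg; apply: measurableT_comp => //.
have mG : measurable_fun (D1 `*` D2) (EFin \o g) by exact/measurable_EFinP.
have mP := measurable_funepos mG; have mN := measurable_funeneg mG.
have hP := tonelli_measurable1 m2 mD1 mD2 mP (fun p _ => funepos_ge0 (EFin \o g) p).
have hN := tonelli_measurable1 m2 mD1 mD2 mN (fun p _ => funeneg_ge0 (EFin \o g) p).
have hPN := emeasurable_funB hP hN.
apply: eq_measurable_fun hPN => x _; rewrite [RHS]integralE.
by congr (_ - _)%E; apply: eq_integral => y _; rewrite ?funeposE ?funenegE.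
Qed.

(** Only the product is integrable. Where [e x] is nonzero, the section of [f] is integrable by
    division for almost every x; where it is zero both sides vanish, whatever the inner integral of
    [f] is. *)
Lemma fubini_cintegral_pull (f : T1 * T2 -> R[i]) (e : T1 -> R[i]) :
  cmeasurable (D1 `*` D2) f -> cmeasurable D1 e ->
  cintegrable m12 (D1 `*` D2) (fun p => f p * e p.1) ->
  cintegral m12 (D1 `*` D2) (fun p => f p * e p.1) =
  cintegral m1 D1 (fun x => cintegral m2 D2 (fun y => f (x, y)) * e x).
Proof.
move=> [mf1 mf2] me fi.
have [i1 ae ->] := fubini_cintegral mD1 mD2 fi.
apply: ae_eq_cintegral => //.
- exact: cintegrable_measurable i1.
- apply: cmeasurableM => //.
  split => /=; first exact: (measurable_Rintegral_section mf1).
  exact: (measurable_Rintegral_section mf2).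
apply: filterS ae => x h D1x; have h' := h D1x.
have [->|e0] := eqVneq (e x) 0.
  rewrite mulr0; under eq_cintegral do rewrite mulr0.
  by apply: complex_eqP => /=; rewrite /Rintegral integral0.
have fix_ : cintegrable m2 D2 (fun y => f (x, y)).
  have := cintegrableZ mD2 (e x)^-1 h'.
  by apply: eq_cintegrable => // y _; rewrite /= mulrC mulfK.
by rewrite mulrC -cintegralZ//; apply: eq_cintegral => y _; rewrite mulrC.
Qed.

Lemma ae_rectangle_eq (f g : T1 * T2 -> R[i]) :
  cmeasurable (D1 `*` D2) f -> cmeasurable (D1 `*` D2) g ->
  {ae m1, forall x, D1 x -> {ae m2, forall y, D2 y -> f (x, y) = g (x, y)}} ->
  eq_ae m12 (D1 `*` D2) f g.
Proof.
move=> mf mg h.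
pose s p := csqn (f p - g p).
have ms : measurable_fun (D1 `*` D2) s.
  apply: cmeasurable_csqn; have := cmeasurableD mf (cmeasurableM (cmeasurable_cst _ (-1)) mg).
  by apply: eq_cmeasurable => p _; rewrite mulN1r.
have ms' : measurable_fun (D1 `*` D2) (EFin \o s) by exact/measurable_EFinP.
have Z : (\int[m12]_(p in D1 `*` D2) `|(EFin \o s) p| = 0)%E.
  rewrite tonelli1//; last exact: measurableT_comp.
  rewrite -[RHS](integral0 m1 D1); apply: ae_eq_integral => //.
    apply: (@tonelli_measurable1 _ _ _ _ _ m2 D1 D2 mD1 mD2 (fun p => `|(EFin \o s) p|)%E) => //.
    exact: measurableT_comp.
  apply: filterS h => x hx D1x.
  rewrite -[RHS](integral0 m2 D2); apply: ae_eq_integral => //.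
    apply: (@measurable_section1 _ _ _ _ D1 D2 mD1 mD2 _ _ (fun p => `|(EFin \o s) p|%E)) => //.
    exact: measurableT_comp.
  apply: filterS (hx D1x) => y hy D2y.
  by rewrite /s /= hy// subrr /csqn/= expr0n addr0 normr0.
have [+ _] := @ae_eq_integral_abs _ _ _ m12 _ mD _ ms'.
move=> /(_ Z); apply: filterS => p hp Dp; apply/eqP; rewrite -subr_eq0 -csqn_eq0.
by have [/eqP] := hp Dp.
Qed.

End product_integrals.

(** * The Laplace model in two variables *)

Section laplace_model2.
Local Open Scope complex_scope.
Local Open Scope classical_set_scope.
Context {R : realType}.
Local Notation H := (@halfline R : set (measurableTypeR R)).
Local Notation HH := (H `*` H).
Local Notation uhp := (@upper_half_plane R).
Variables lambda1 lambda2 : R.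
Hypotheses (l1 : 1 < lambda1) (l2 : 1 < lambda2).

Let mH := @measurable_halfline R.

Lemma measurable_quadrant : measurable HH.
Proof. exact: measurableX. Qed.
Let mHH := measurable_quadrant.

Definition lap_weight2 (p : R * R) : R :=
  lap_weight lambda1 p.1 * lap_weight lambda2 p.2.

Definition lap_ker2 (z : R[i] * R[i]) (p : R * R) : R[i] :=
  lap_ker lambda1 z.1 p.1 * lap_ker lambda2 z.2 p.2.

Lemma lap_weight2_gt0 p : HH p -> 0 < lap_weight2 p.
Proof. by move=> [h1 h2]; rewrite mulr_gt0// lap_weight_gt0. Qed.

Lemma measurable_lap_weight2 : measurable_fun HH lap_weight2.
Proof.
apply: measurable_funM.
  exact: (measurable_rect_fst mH (@measurable_lap_weight R lambda1)).
exact: (measurable_rect_snd mH (@measurable_lap_weight R lambda2)).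
Qed.

Local Notation cip2 := (cip leb2 HH lap_weight2).
Local Notation LQ := (@L2R2 R lambda1 lambda2).

Lemma L2_lap_ker2 z : uhp z.1 -> uhp z.2 -> LQ (lap_ker2 z).
Proof.
move=> h1 h2.
have i1 : leb.-integrable H (EFin \o (fun t => t `^ (lambda1 - 1) * expR (- (2 * complex.Im z.1 * t)))).
  by apply: integrable_powR_expRN; rewrite ?subr_gt0// mulr_gt0.
have i2 : leb.-integrable H (EFin \o (fun t => t `^ (lambda2 - 1) * expR (- (2 * complex.Im z.2 * t)))).
  by apply: integrable_powR_expRN; rewrite ?subr_gt0// mulr_gt0.
apply: (@L2_dominated _ _ _ leb2 HH lap_weight2 mHH measurable_lap_weight2
  lap_weight2_gt0 _ _ _ (integrable_product mH mH i1 i2)).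
  apply: cmeasurableM.
    exact: (cmeasurable_rect_fst H mH (cmeasurable_lap_ker lambda1 z.1)).
  exact: (cmeasurable_rect_snd H mH (cmeasurable_lap_ker lambda2 z.2)).
move=> p [/halflineP p1 /halflineP p2].
by rewrite -!lap_ker_csqn// /lap_ker2 csqnM mulrACA.
Qed.

Lemma lap_ker_conj_weight lambda (z : R[i]) t : 0 < t ->
  conjc (lap_ker lambda z t) * (lap_weight lambda t)%:C = cexp ('i%C * z * t%:C).
Proof.
move=> t0; rewrite /lap_ker conjcM conjcK conjc_real lap_weightE fmorphV.
have p0 : (t `^ (lambda - 1))%:C != 0 :> R[i].
  by apply/eqP => -[/eqP]; rewrite gt_eqF// powR_gt0.
by field.
Qed.

Lemma lap_ker2_conj_weight (f : R * R -> R[i]) z p : HH p ->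
  f p * conjc (lap_ker2 z p) * (lap_weight2 p)%:C =
  f p * cexp ('i%C * z.2 * p.2%:C) * cexp ('i%C * z.1 * p.1%:C).
Proof.
move=> [/halflineP p1 /halflineP p2].
rewrite -(lap_ker_conj_weight lambda1 z.1 p1) -(lap_ker_conj_weight lambda2 z.2 p2).
by rewrite /lap_ker2 /lap_weight2 conjcM (rmorphM (real_complex R)); ring.
Qed.

(** Being a [tensor_op], [laplace2] is an iterated integral; Fubini identifies it with a double
    integral, and so with a pairing. *)
Lemma laplace2_cip f z : LQ f -> uhp z.1 -> uhp z.2 ->
  laplace2 f z = cip2 f (lap_ker2 z).
Proof.
move=> Lf h1 h2; have mf : cmeasurable HH f by have [? ? _] := Lf; split.
have gi : cintegrable leb2 HH
    (fun p => f p * cexp ('i%C * z.2 * p.2%:C) * cexp ('i%C * z.1 * p.1%:C)).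
  have := L2_cintegrable mHH measurable_lap_weight2 lap_weight2_gt0 Lf (L2_lap_ker2 h1 h2).
  by apply: (eq_cintegrable mHH) => p /set_mem; exact: lap_ker2_conj_weight.
have := @fubini_cintegral_pull _ _ _ _ R _ _ H H mH mH
   (fun p => f p * cexp ('i%C * z.2 * p.2%:C)) (fun x => cexp ('i%C * z.1 * x%:C)) _ _ gi.
move=> h; rewrite /laplace2 /tensor_op /laplace -h.
- by apply: eq_cintegral => p /set_mem Hp; rewrite lap_ker2_conj_weight.
- apply: cmeasurableM => //.
  exact: (cmeasurable_rect_snd H mH (cmeasurable_cexp_kernel z.2)).
- exact: cmeasurable_cexp_kernel.
Qed.

Lemma laplace_cintegrable lambda h z : 1 < lambda -> L2R lambda h -> uhp z ->
  cintegrable leb H (fun t => h t * cexp ('i%C * z * t%:C)).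
Proof.
move=> lam Lh hz.
have := L2_cintegrable mH (@measurable_lap_weight R lambda) (@lap_weight_gt0 R lambda) Lh (L2_lap_ker lam hz).
apply: (eq_cintegrable mH) => t /set_mem/halflineP t0.
by rewrite -mulrA lap_ker_conj_weight.
Qed.

Lemma laplaceZ lambda (c : R[i]) h z : 1 < lambda -> L2R lambda h -> uhp z ->
  laplace (fun t => c * h t) z = c * laplace h z.
Proof.
move=> lam Lh hz; rewrite /laplace -cintegralZ//; last exact: laplace_cintegrable Lh hz.
by apply: eq_cintegral => t _; rewrite mulrA.
Qed.

Lemma laplace2_product (h1 h2 : R -> R[i]) z : L2R lambda1 h1 -> L2R lambda2 h2 ->
  uhp z.1 -> uhp z.2 ->
  laplace2 (fun p => h1 p.1 * h2 p.2) z = laplace h1 z.1 * laplace h2 z.2.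
Proof.
move=> L1 L2 z1 z2; rewrite /laplace2 /tensor_op /=.
rewrite (_ : (fun x1 => _) = (fun x1 => laplace h2 z.2 * h1 x1)).
  by rewrite (laplaceZ _ l1)// mulrC.
by apply/funext => x; rewrite (laplaceZ _ l2)// mulrC.
Qed.

Section action.
Variable g : universal_SL2 R.
Local Notation phi := (SL2_log g).
Local Notation B := (invmx (SL2_mx g)).

Definition lap_ker2_act (z : R[i] * R[i]) (p : R * R) : R[i] :=
  lap_ker_act lambda1 g z.1 p.1 * lap_ker_act lambda2 g z.2 p.2.

Lemma lap_ker2_actE z p : lap_ker2_act z p =
  conjc (cexp (- (lambda1%:C * phi z.1)) * cexp (- (lambda2%:C * phi z.2))) *
  lap_ker2 (mobius B z.1, mobius B z.2) p.
Proof. by rewrite /lap_ker2_act /lap_ker_act /lap_ker2 conjcM; ring. Qed.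

Lemma L2_lap_ker2_act z : uhp z.1 -> uhp z.2 -> LQ (lap_ker2_act z).
Proof.
move=> z1 z2; rewrite (funext (lap_ker2_actE z)); apply: L2Z => //.
- exact: measurable_lap_weight2.
- exact: lap_weight2_gt0.
- by apply: L2_lap_ker2; exact: mobius_uhp.
Qed.

Lemma disc_series2_cip f z : LQ f -> uhp z.1 -> uhp z.2 ->
  disc_series2 lambda1 lambda2 g (laplace2 f) z = cip2 f (lap_ker2_act z).
Proof.
move=> Lf z1 z2; rewrite (funext (lap_ker2_actE z)) cipZr//; last first.
- by apply: L2_lap_ker2; exact: mobius_uhp.
- exact: lap_weight2_gt0.
- exact: measurable_lap_weight2.
rewrite conjcK -laplace2_cip//; try exact: mobius_uhp.
by rewrite /disc_series2 /tensor_op /disc_series mulrA.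
Qed.

Lemma lap_ker2_act_gram z w : uhp z.1 -> uhp z.2 -> uhp w.1 -> uhp w.2 ->
  disc_series2 lambda1 lambda2 g (laplace2 (lap_ker2_act w)) z = laplace2 (lap_ker2 w) z.
Proof.
move=> z1 z2 w1 w2.
rewrite [RHS]laplace2_product//; [|exact: L2_lap_ker|exact: L2_lap_ker].
have hz1 := mobius_uhp g z1; have hz2 := mobius_uhp g z2.
rewrite -(lap_ker_act_gram l1 g z1 w1) -(lap_ker_act_gram l2 g z2 w2).
rewrite /disc_series2 /tensor_op /disc_series.
rewrite [laplace2 _ _]laplace2_product//; [|exact: L2_lap_ker_act|exact: L2_lap_ker_act].
by rewrite /=; ring.
Qed.

Lemma disc_series2_transport f : LQ f ->
  exists2 f', LQ f' & forall z, uhp z.1 -> uhp z.2 ->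
    laplace2 f' z = disc_series2 lambda1 lambda2 g (laplace2 f) z.
Proof.
move=> Lf; pose I := {z : R[i] * R[i] | uhp z.1 /\ uhp z.2}.
have i0 : I by exists ('i%C, 'i%C); rewrite /upper_half_plane/=.
have [||| f' Lf' hf] := @L2_transport _ _ R leb2 HH lap_weight2 mHH
  measurable_lap_weight2 lap_weight2_gt0 I
  (fun z => lap_ker2 (proj1_sig z)) (fun z => lap_ker2_act (proj1_sig z)) i0 _ _ _ f Lf.
- by move=> [z [z1 z2]]; exact: L2_lap_ker2.
- by move=> [z [z1 z2]]; exact: L2_lap_ker2_act.
- move=> [w [w1 w2]] [z [z1 z2]] /=.
  rewrite -laplace2_cip//; last exact: L2_lap_ker2.
  rewrite -disc_series2_cip//; last exact: L2_lap_ker2_act.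
  by rewrite lap_ker2_act_gram.
exists f' => // z z1 z2; rewrite disc_series2_cip// laplace2_cip//.
exact: (hf (exist _ z (conj z1 z2))).
Qed.

Lemma hat_pi2P f : LQ f -> LQ (hat_pi2 lambda1 lambda2 g f) /\
  forall z, uhp z.1 -> uhp z.2 ->
    laplace2 (hat_pi2 lambda1 lambda2 g f) z =
    disc_series2 lambda1 lambda2 g (laplace2 f) z.
Proof.
move=> Lf; have [f' Lf' hf'] := disc_series2_transport Lf.
rewrite /hat_pi2 /laplace2_inv /inverse_on /=.
set S := [set _ | _].
have [S1 S2] : S (xget (fun=> 0) S).
  by apply: xgetPex; exists f'; split => // z [z1 z2]; exact: hf'.
split; first exact: S1.
by move=> z z1 z2; exact: (S2 z (conj z1 z2)).
Qed.

End action.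

Lemma laplace2_inj f : LQ f ->
  (forall z, uhp z.1 -> uhp z.2 -> laplace2 f z = 0) -> eq_ae leb2 HH f (fun=> 0).
Proof.
move=> Lf f0; have mf : cmeasurable HH f by have [? ? _] := Lf; split.
pose u n : R[i] := (n%:R : R)%:C * 'i%C + 'i%C.
have ui n : uhp (u n).
  by rewrite /upper_half_plane/= !(mulr0, mul0r, add0r, addr0, mulr1) ltr_wpDl.
have uE n t : cexp ('i%C * u n * t%:C) =
   cexp ('i%C * 'i%C * t%:C) * (expR (- (n%:R * t)))%:C.
  have -> : (expR (- (n%:R * t)))%:C = cexp ((- (n%:R * t))%:C).
    by rewrite /cexp/= cos0 sin0 complexr0 mulr1.
  rewrite -cexpD; congr cexp; apply: complex_eqP; rewrite !cplxE/=; ring.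
pose G p := f p * cexp ('i%C * 'i%C * p.2%:C) * cexp ('i%C * 'i%C * p.1%:C).
have kerE m n p : HH p -> f p * conjc (lap_ker2 (u m, u n) p) * (lap_weight2 p)%:C =
   G p * (expR (- (n%:R * p.2)))%:C * (expR (- (m%:R * p.1)))%:C.
  by move=> Hp; rewrite lap_ker2_conj_weight// !uE /G; ring.
have Gmn m n : cintegrable leb2 HH
    (fun p => G p * (expR (- (n%:R * p.2)))%:C * (expR (- (m%:R * p.1)))%:C).
  have := L2_cintegrable mHH measurable_lap_weight2 lap_weight2_gt0 Lf
    (L2_lap_ker2 (z := (u m, u n)) (ui m) (ui n)).
  by apply: (eq_cintegrable mHH) => p /set_mem; exact: kerE.
have Gi : cintegrable leb2 HH G.
  have := Gmn 0 0; apply: (eq_cintegrable mHH) => p _.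
  by rewrite !mul0r oppr0 expR0 !mulr1.
have G0 m n : cintegral leb2 HH
    (fun p => G p * (expR (- (n%:R * p.2)))%:C * (expR (- (m%:R * p.1)))%:C) = 0.
  rewrite -[RHS](f0 (u m, u n) (ui m) (ui n)) laplace2_cip//=.
  by apply: eq_cintegral => p /set_mem Hp; rewrite kerE.
have mexp (c : R) : measurable_fun H (fun t : R => expR (- (c * t))).
  by do 2 apply: measurableT_comp => //.
(* [r] selects the real or the imaginary part of [G], which are treated alike. *)
have part (r : R -> R -> R) (g := fun p => r (complex.Re (G p)) (complex.Im (G p))) :
    leb2.-integrable HH (EFin \o g) ->
    (forall m n, Rintegral leb2 HH
      (fun p => g p * expR (- (n%:R * p.2)) * expR (- (m%:R * p.1))) = 0) ->
    {ae leb2, forall p, HH p -> g p = 0}.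
  move=> gi g0; apply: laplace_moments2_eq0 => // m n.
  have mg : measurable_fun HH g by apply/measurable_EFinP; exact: measurable_int gi.
  have mgn : measurable_fun HH (fun p => g p * expR (- (n%:R * p.2))).
    by apply: measurable_funM => //; exact: (measurable_rect_snd mH (mexp _)).
  have gmi : cintegrable leb2 HH
      (fun p => (g p * expR (- (n%:R * p.2)))%:C * (expR (- (m%:R * p.1)))%:C).
    apply: (@cintegrable_le _ _ _ leb2 HH mHH _ (fun p => `|g p|)).
    - apply: cmeasurableM; apply: cmeasurableC => //.
      exact: (measurable_rect_fst mH (mexp _)).
    - exact: integrable_norm gi.
    - move=> p [/halflineP p1 /halflineP p2].
      have e1 (c x : R) : 0 <= c -> 0 < x -> `|expR (- (c * x))| <= 1.
        move=> c0 x0; rewrite ger0_norm ?expR_ge0// -[leRHS]expR0 ler_expR oppr_le0.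
        by rewrite mulr_ge0// ltW.
      rewrite normcM !normcC normrM -mulrA -[leRHS]mulr1 ler_wpM2l//.
      by rewrite mulr_ile1// e1.
  have := @fubini_cintegral_pull _ _ _ _ R _ _ H H mH mH
    (fun p => (g p * expR (- (n%:R * p.2)))%:C) (fun x => (expR (- (m%:R * x)))%:C)
    (cmeasurableC mgn) (cmeasurableC (mexp _)) gmi.
  move=> h.
  transitivity (complex.Re (cintegral leb H (fun x => cintegral leb H
      (fun y => (g (x, y) * expR (- (n%:R * y)))%:C) * (expR (- (m%:R * x)))%:C))).
    by apply: eq_Rintegral => x _; rewrite [RHS]ReM/= mulr0 subr0.
  rewrite -h -[RHS](g0 m n).
  by apply: eq_Rintegral => p _; rewrite [LHS]ReM/= mulr0 subr0.
have [gr gm] := Gi.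
have zr : {ae leb2, forall p, HH p -> complex.Re (G p) = 0}.
  apply: (part (fun x y => x)) => // m n.
  transitivity (complex.Re (cintegral leb2 HH (fun p =>
      G p * (expR (- (n%:R * p.2)))%:C * (expR (- (m%:R * p.1)))%:C))); last by rewrite G0.
  apply: eq_Rintegral => p _; move: (G p) (expR _) (expR _) => z x y.
  by rewrite !cplxE/=; ring.
have zi : {ae leb2, forall p, HH p -> complex.Im (G p) = 0}.
  apply: (part (fun x y => y)) => // m n.
  transitivity (complex.Im (cintegral leb2 HH (fun p =>
      G p * (expR (- (n%:R * p.2)))%:C * (expR (- (m%:R * p.1)))%:C))); last by rewrite G0.
  apply: eq_Rintegral => p _; move: (G p) (expR _) (expR _) => z x y.
  by rewrite !cplxE/=; ring.
apply: filterS2 zr zi => p hr hi Hp.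
have : G p = 0 by apply: complex_eqP; [exact: hr|exact: hi].
move=> /eqP; rewrite /G mulf_eq0 (negbTE (cexp_neq0 _)) orbF.
by rewrite mulf_eq0 (negbTE (cexp_neq0 _)) orbF => /eqP.
Qed.

End laplace_model2.

(** * The stratified model *)

Section iota_substitution.
Local Open Scope complex_scope.
Local Open Scope classical_set_scope.
Context {R : realType}.
Local Notation mu := (@lebesgue_measure R).
Local Notation H := (@halfline R : set (measurableTypeR R)).
Local Notation HH := (H `*` H).
Local Notation I := (`]-1, 1[%classic : set (measurableTypeR R)).
Local Notation S := (H `*` I).
Local Notation iota := (@iota_strat R).
Local Notation iota_inv := (@iota_strat_inv R).

Lemma measurable_strat : measurable S.
Proof. by apply: measurableX; exact: measurable_itv. Qed.

Lemma stratP (p : R * R) : S p <-> 0 < p.1 /\ -1 < p.2 < 1.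
Proof. by split=> -[/halflineP ? ?]; split => //; exact/halflineP. Qed.

Lemma iota_quadrant (p : R * R) : HH (iota p) <-> S p.
Proof.
rewrite stratP /iota_strat; split=> [[/halflineP/= h1 /halflineP/= h2]|[p1 /andP[v1 v2]]].
  have p1 : 0 < p.1.
    have : 0 < p.1 / 2 * (1 - p.2) + p.1 / 2 * (1 + p.2) by rewrite addr_gt0.
    by rewrite -mulrDr addrACA addNr addr0 -mulr2n -mulr_natl mulr1 divfK.
  have p2 : 0 < p.1 / 2 by rewrite divr_gt0.
  split => //; move: h1 h2; rewrite !pmulr_rgt0// => h1 h2.
  by apply/andP; split; lra.
have p2 : 0 < p.1 / 2 by rewrite divr_gt0.
by split; apply/halflineP; rewrite /= mulr_gt0//; lra.
Qed.

Lemma iota_strat_invK (q : R * R) : HH q -> iota (iota_inv q) = q.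
Proof.
case: q => x y [/halflineP/= x0 /halflineP/= y0].
have s0 : x + y != 0 by rewrite gt_eqF// addr_gt0.
by rewrite /iota_strat /iota_strat_inv/=; congr (_, _); field.
Qed.

Lemma iota_stratK (p : R * R) : S p -> iota_inv (iota p) = p.
Proof.
case: p => t v /stratP[/= t0 _]; rewrite /iota_strat /iota_strat_inv/=.
have tn0 : t != 0 by rewrite gt_eqF.
have -> : t / 2 * (1 - v) + t / 2 * (1 + v) = t by field.
have -> : t / 2 * (1 + v) - t / 2 * (1 - v) = t * v by field.
by rewrite mulrAC mulfV// mul1r.
Qed.

Lemma iota_inv_strat (q : R * R) : HH q -> S (iota_inv q).
Proof. by move=> hq; apply/iota_quadrant; rewrite iota_strat_invK. Qed.

Let mT := [set: measurableTypeR R * measurableTypeR R].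

Lemma measurable_iota : measurable_fun mT
  (iota : measurableTypeR R * measurableTypeR R -> measurableTypeR R * measurableTypeR R).
Proof.
apply: measurable_fun_pair; apply: measurable_funM.
- by apply: measurable_funM => //; exact: measurable_fst.
- by apply: measurable_funB => //; exact: measurable_snd.
- by apply: measurable_funM => //; exact: measurable_fst.
- by apply: measurable_funD => //; exact: measurable_snd.
Qed.

Lemma measurable_comp_iota d (T : measurableType d) (f : R * R -> T) :
  measurable_fun HH f -> measurable_fun S (fun p => f (iota p)).
Proof.
move=> mf; apply: (measurable_comp (F := HH)) mf _; first exact: measurable_quadrant.
  by move=> _ [p /iota_quadrant hp <-].
by apply: measurable_funTS; exact: measurable_iota.
Qed.

Lemma measurable_comp_iota_inv d (T : measurableType d) (f : R * R -> T) :
  measurable_fun S f -> measurable_fun HH (fun q => f (iota_inv q)).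
Proof.
move=> mf; apply: (measurable_comp (F := S)) mf _; first exact: measurable_strat.
  by move=> _ [q hq <-]; exact: iota_inv_strat.
have m1 : measurable_fun mT (fun q => q.1 + q.2).
  by apply: measurable_funD; [exact: measurable_fst|exact: measurable_snd].
have m2 : measurable_fun mT (fun q => q.2 - q.1).
  by apply: measurable_funB; [exact: measurable_snd|exact: measurable_fst].
have m3 : measurable_fun mT (fun q => (q.1 + q.2) `^ (-1)).
  by apply: (measurableT_comp (f := fun x : R => x `^ (-1))) m1; exact: measurable_powR.
have m4 := measurable_fun_pair m1 (measurable_funM m2 m3).
apply: (eq_measurable_fun _ _ (measurable_funTS m4)) => q /set_mem[/halflineP q1 /halflineP q2].
by rewrite /= powRN powRr1// addr_ge0// ltW.
Qed.

(** A shear followed by a scaling: y is replaced by t = x + y at fixed x, the order of integration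
    is exchanged, and at fixed t one puts x = t (1 - v) / 2, which contributes the Jacobian t /
    2. *)
Lemma ge0_integral_iota (F : R * R -> \bar R) : measurable_fun HH F ->
  (forall p, HH p -> (0 <= F p)%E) ->
  (\int[leb2]_(p in HH) F p = \int[leb2]_(p in S) ((p.1 / 2)%:E * F (iota p)))%E.
Proof.
move=> mF F0; have mHH := @measurable_quadrant R.
pose G : measurableTypeR R * measurableTypeR R -> \bar R := F \_ HH.
have mG : measurable_fun mT G by apply/(measurable_restrictT _ mHH).
have G0 p : (0 <= G p)%E by rewrite /G patchE; case: ifPn => // /set_mem /F0.
have Gz (x y : R) : x + y <= 0 -> G (x, y) = 0%E.
  move=> xy; rewrite /G patchE; case: ifPn => // /set_mem[/halflineP/= x0 /halflineP/= y0].
  by move: xy; rewrite leNgt addr_gt0.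
rewrite [LHS]integral_mkcond -/G.
rewrite (@fubini_tonelli1 _ _ _ _ R mu mu G mG G0).
pose K (p : measurableTypeR R * measurableTypeR R) := G (p.1, p.2 - p.1).
have mK : measurable_fun mT K.
  apply: measurableT_comp mG _; apply: measurable_fun_pair; first exact: measurable_fst.
  by apply: measurable_funB; [exact: measurable_snd|exact: measurable_fst].
have K0 p : (0 <= K p)%E by exact: G0.
have sec (L : measurableTypeR R * measurableTypeR R -> \bar R) x :
    measurable_fun mT L -> measurable_fun [set: measurableTypeR R] (fun y => L (x, y)).
  by move=> mL; apply: measurableT_comp mL _; apply: measurable_fun_pair.
have sec2 (L : measurableTypeR R * measurableTypeR R -> \bar R) y :
    measurable_fun mT L -> measurable_fun [set: measurableTypeR R] (fun x => L (x, y)).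
  by move=> mL; apply: measurableT_comp mL _; apply: measurable_fun_pair.
transitivity (\int[mu]_x \int[mu]_t K (x, t))%E.
  apply: eq_integral => x _; rewrite /fubini_F.
  rewrite (@ge0_integral_affineT _ 1 (- x) (oner_neq0 _) (fun y => G (x, y)))//; last exact: sec.
  rewrite normr1 mul1e; apply: eq_integral => t _.
  by rewrite /K /= mul1r.
rewrite (@fubini_tonelli _ _ _ _ R mu mu K mK K0).
pose M (p : measurableTypeR R * measurableTypeR R) := (`|p.1 / 2|%:E * G (iota p))%E.
have mM : measurable_fun mT M.
  apply: emeasurable_funM; last by apply: measurableT_comp mG _; exact: measurable_iota.
  apply/measurable_EFinP; apply: measurableT_comp => //.
  by apply: measurable_funM => //; exact: measurable_fst.
have M0 p : (0 <= M p)%E by rewrite mule_ge0// lee_fin.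
transitivity (\int[mu]_t \int[mu]_v M (t, v))%E.
  apply: eq_integral => t _; have [t0|t0] := leP t 0.
    (* For t <= 0 neither integrand meets the open quadrant. *)
    rewrite !integral0_eq// => [v _|x _].
      rewrite /M /iota_strat Gz ?mule0//=.
      by rewrite -mulrDr addrACA addNr addr0 -mulr2n -mulr_natl mulr1 divfK.
    by rewrite /K Gz//= addrC subrK.
  have t2 : - (t / 2) != 0 by rewrite oppr_eq0 gt_eqF// divr_gt0.
  rewrite (@ge0_integral_affineT _ (- (t / 2)) (t / 2) t2 (fun x => K (x, t)))//; last exact: sec2.
  rewrite normrN -ge0_integralZl//; last first.
    apply: (measurableT_comp (f := fun x : measurableTypeR R => K (x, t))); first exact: sec2.
    by apply: measurable_funD => //; exact: measurable_funM.
  apply: eq_integral => v _; rewrite /M /K/= /iota_strat/=; by congr (_ * G (_, _))%E; field.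
transitivity (integral (@leb2 R) mT M).
  by rewrite (@fubini_tonelli1 _ _ _ _ R mu mu M mM M0).
rewrite [RHS]integral_mkcond.
apply: eq_integral => p _; rewrite patchE /M /G patchE; case: ifPn => hp.
  move/set_mem/iota_quadrant: hp => hp; rewrite mem_set//.
  by rewrite gtr0_norm// divr_gt0//; move/stratP: hp => [].
rewrite mule0; case: ifPn => // /set_mem/iota_quadrant hq.
by move/negP: hp; case; apply/mem_set.
Qed.

Lemma integrable_iota (g : R * R -> R) : measurable_fun HH g ->
  leb2.-integrable HH (EFin \o g) <->
  leb2.-integrable S (EFin \o (fun p => p.1 / 2 * g (iota p))).
Proof.
move=> mg.
have mg' : measurable_fun S (fun p => p.1 / 2 * g (iota p)).
  apply: measurable_funM; last exact: measurable_comp_iota.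
  by apply: measurable_funTS; apply: measurable_funM => //; exact: measurable_fst.
have E : (\int[leb2]_(p in HH) `|(EFin \o g) p| =
    \int[leb2]_(p in S) `|(EFin \o (fun p => (p.1 / 2 * g (iota p))%R)) p|)%E.
  rewrite ge0_integral_iota//; last by apply: measurableT_comp => //; exact/measurable_EFinP.
  apply: eq_integral => p /set_mem/stratP[p1 _].
  by rewrite /= normrM gtr0_norm ?EFinM// divr_gt0.
split=> /integrableP[_ h]; apply/integrableP; split; try exact/measurable_EFinP.
  by rewrite -E.
by rewrite E.
Qed.

Lemma Rintegral_iota (g : R * R -> R) : leb2.-integrable HH (EFin \o g) ->
  Rintegral leb2 HH g = Rintegral leb2 S (fun p => p.1 / 2 * g (iota p)).
Proof.
move=> gi; have mG := measurable_int _ gi; rewrite /Rintegral; congr fine.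
rewrite [LHS]integralE [RHS]integralE; congr (_ - _)%E.
- rewrite ge0_integral_iota//; last exact: measurable_funepos.
  apply: eq_integral => p /set_mem/stratP[p1 _].
  have p2 : 0 <= p.1 / 2 by rewrite divr_ge0// ltW.
  by rewrite !funeposE/= EFinM maxe_pMr ?mule0// lee_fin.
- rewrite ge0_integral_iota//; last exact: measurable_funeneg.
  apply: eq_integral => p /set_mem/stratP[p1 _].
  have p2 : 0 <= p.1 / 2 by rewrite divr_ge0// ltW.
  rewrite !funenegE maxe_pMr ?lee_fin// mule0; congr maxe.
  by rewrite muleN -EFinM.
Qed.

Lemma cintegral_iota (f : R * R -> R[i]) : cintegrable leb2 HH f ->
  cintegral leb2 HH f = cintegral leb2 S (fun p => (p.1 / 2)%:C * f (iota p)).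
Proof.
move=> [f1 f2]; apply: complex_eqP => /=.
  by rewrite (Rintegral_iota f1); apply: eq_Rintegral => p _; rewrite ReM/= mul0r subr0.
by rewrite (Rintegral_iota f2); apply: eq_Rintegral => p _; rewrite ImM/= mul0r addr0.
Qed.

End iota_substitution.

(** * [T_iota] as a similarity of weighted L2 spaces *)

Section stratified_transform.
Local Open Scope complex_scope.
Local Open Scope classical_set_scope.
Context {R : realType}.
Local Notation H := (@halfline R : set (measurableTypeR R)).
Local Notation HH := (H `*` H).
Local Notation I := (`]-1, 1[%classic : set (measurableTypeR R)).
Local Notation S := (H `*` I).
Local Notation iota := (@iota_strat R).
Local Notation iota_inv := (@iota_strat_inv R).
Variables lambda1 lambda2 : R.

Local Notation wS := (strat_weight lambda1 lambda2).
Local Notation wQ := (lap_weight2 lambda1 lambda2).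
Local Notation LS := (@L2strat R lambda1 lambda2).
Local Notation LQ := (@L2R2 R lambda1 lambda2).
Local Notation T := (T_iota lambda1 lambda2).
Local Notation Ti := (T_iota_inv lambda1 lambda2).

Let mS := @measurable_strat R.
Let mHH := @measurable_quadrant R.
Let mwQ := @measurable_lap_weight2 R lambda1 lambda2.
Let wQ0 := @lap_weight2_gt0 R lambda1 lambda2.
Let mT := [set: measurableTypeR R * measurableTypeR R].

(** The factor by which [T_iota] multiplies squared norms: the stratified weight has a power of t
    where the substitution produces t / 2. *)
Definition strat_constant : R := 2 `^ (lambda1 + lambda2 - 1).

Lemma strat_constant_gt0 : 0 < strat_constant.
Proof. by rewrite powR_gt0. Qed.

Lemma cintegral0 d (X : measurableType d) (mu : {measure set X -> \bar R}) (D : set X) :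
  cintegral mu D (fun=> 0 : R[i]) = 0.
Proof. by apply: complex_eqP; rewrite /= /Rintegral integral0. Qed.

(** All factors reduce to this one: along [iota], [T_iota] divides by it, [T_iota_inv] multiplies by
    it, the weight of the quadrant is its inverse, and the stratified weight is [strat_constant]
    times t / 2 times it. *)
Let A (q : R * R) : R := q.1 `^ (lambda1 - 1) * q.2 `^ (lambda2 - 1).

Let A_gt0 p : S p -> 0 < A (iota p).
Proof.
by move=> /iota_quadrant[/halflineP q1 /halflineP q2]; rewrite mulr_gt0// powR_gt0.
Qed.

Let AE p : S p -> A (iota p) =
  (p.1 / 2) `^ (lambda1 + lambda2 - 2) * jacobi_weight lambda1 lambda2 p.2.
Proof.
move=> /stratP[p1 /andP[v1 v2]]; have p2 : 0 < p.1 / 2 by rewrite divr_gt0.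
rewrite /A /iota_strat /=; move: (p.1 / 2) p2 => x x0.
have e : x `^ (lambda1 + lambda2 - 2) = x `^ (lambda1 - 1) * x `^ (lambda2 - 1).
  rewrite -powRD; first by congr (_ `^ _); ring.
  by apply/implyP => _; rewrite gt_eqF.
have v1' : 0 <= 1 - p.2 by lra.
have v2' : 0 <= 1 + p.2 by lra.
by rewrite e (powRM _ (ltW x0) v1') (powRM _ (ltW x0) v2') /jacobi_weight; ring.
Qed.

Lemma jacobi_weight_gt0 (v : R) : -1 < v < 1 -> 0 < jacobi_weight lambda1 lambda2 v.
Proof. by move=> /andP[v1 v2]; rewrite mulr_gt0// powR_gt0; lra. Qed.

Let T_E f p : S p -> T f p = (A (iota p))^-1%:C * f (iota p).
Proof.
move=> Sp; have /stratP[p1 /andP[v1 v2]] := Sp.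
rewrite AE// /T_iota; congr (_%:C * _).
rewrite invfM /jacobi_weight invfM -!powRN !opprB mulrA; congr (_ `^ _ * _ * _); ring.
Qed.

Let wQE p : wQ (iota p) = (A (iota p))^-1.
Proof. by rewrite /lap_weight2 !lap_weightE /A invfM. Qed.

Let wSE p : S p -> wS p = strat_constant * (p.1 / 2) * A (iota p).
Proof.
move=> Sp; have /stratP[p1 _] := Sp; have p2 : 0 < p.1 / 2 by rewrite divr_gt0.
rewrite AE// /strat_weight.
have -> : p.1 `^ (lambda1 + lambda2 - 1) = (p.1 / 2) `^ (lambda1 + lambda2 - 1) * strat_constant.
  by rewrite -powRM ?divfK// ltW.
have -> : (p.1 / 2) `^ (lambda1 + lambda2 - 1) = (p.1 / 2) `^ (lambda1 + lambda2 - 2) * (p.1 / 2).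
  by rewrite -powRS//; congr (_ `^ _); ring.
by ring.
Qed.

Let TiE h p : S p -> Ti h (iota p) = (A (iota p))%:C * h p.
Proof. by move=> Sp; rewrite /T_iota_inv iota_stratK. Qed.

Lemma T_iotaK h p : S p -> T (Ti h) p = h p.
Proof.
move=> Sp; rewrite T_E// TiE// mulrA -rmorphM mulVf ?mul1r//.
by rewrite gt_eqF// A_gt0.
Qed.

Lemma T_iota_invK f q : HH q -> Ti (T f) q = f q.
Proof.
move=> Hq; have Sq := iota_inv_strat Hq.
rewrite /T_iota_inv T_E// iota_strat_invK// mulrA -rmorphM mulfV ?mul1r//.
by have := A_gt0 Sq; rewrite iota_strat_invK// => /gt_eqF ->.
Qed.

Lemma strat_weight_gt0 p : S p -> 0 < wS p.
Proof.
move=> Sp; rewrite wSE// mulr_gt0 ?A_gt0// mulr_gt0 ?strat_constant_gt0//.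
by rewrite divr_gt0//; have /stratP[] := Sp.
Qed.

Lemma measurable_jacobi_weight :
  measurable_fun [set: measurableTypeR R] (jacobi_weight lambda1 lambda2).
Proof.
have m1 : measurable_fun [set: measurableTypeR R] (fun v : measurableTypeR R => 1 - v).
  exact: measurable_funB.
have m2 : measurable_fun [set: measurableTypeR R] (fun v : measurableTypeR R => 1 + v).
  exact: measurable_funD.
apply: measurable_funM.
  by apply: (measurableT_comp (f := fun x : R => x `^ (lambda1 - 1))) m1; exact: measurable_powR.
by apply: (measurableT_comp (f := fun x : R => x `^ (lambda2 - 1))) m2; exact: measurable_powR.
Qed.

Lemma measurable_strat_weight : measurable_fun S wS.
Proof.
have m1 := @measurable_fst _ _ (measurableTypeR R) (measurableTypeR R).
have m2 := @measurable_snd _ _ (measurableTypeR R) (measurableTypeR R).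
apply: measurable_funTS; apply: measurable_funM.
  by apply: (measurableT_comp (f := fun x : R => x `^ (lambda1 + lambda2 - 1))) m1;
    exact: measurable_powR.
exact: (measurableT_comp measurable_jacobi_weight m2).
Qed.

Let mA : measurable_fun HH A.
Proof.
have m1 := @measurable_fst _ _ (measurableTypeR R) (measurableTypeR R).
have m2 := @measurable_snd _ _ (measurableTypeR R) (measurableTypeR R).
apply: measurable_funTS; apply: measurable_funM.
  by apply: (measurableT_comp (f := fun x : R => x `^ (lambda1 - 1))) m1; exact: measurable_powR.
by apply: (measurableT_comp (f := fun x : R => x `^ (lambda2 - 1))) m2; exact: measurable_powR.
Qed.

Let cmT f : cmeasurable HH f -> cmeasurable S (T f).
Proof.
move=> [f1 f2].
have h : cmeasurable S (fun p => (wQ (iota p))%:C * f (iota p)).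
  apply: cmeasurableM; last by split; [exact: (measurable_comp_iota f1)|exact: (measurable_comp_iota f2)].
  by apply: cmeasurableC; exact: (measurable_comp_iota mwQ).
by apply: eq_cmeasurable h => p /set_mem Sp; rewrite T_E// wQE.
Qed.

Let cmTi h : cmeasurable S h -> cmeasurable HH (Ti h).
Proof.
move=> [h1 h2]; apply: cmeasurableM.
  by apply: cmeasurableC; exact: mA.
split; [exact: (measurable_comp_iota_inv h1)|exact: (measurable_comp_iota_inv h2)].
Qed.

Lemma L2_T_iota f : LQ f -> LS (T f).
Proof.
move=> /(L2P leb2 mwQ wQ0 _)[mf fi].
apply/(L2P leb2 measurable_strat_weight strat_weight_gt0 _); split; first exact: cmT.
have mg : measurable_fun HH (fun p => csqn (f p) * wQ p).
  by apply: measurable_funM; [exact: cmeasurable_csqn|exact: mwQ].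
have /(integrable_iota mg) i1 := fi.
have i2 := integrable_mull mS strat_constant i1.
apply: eq_integrable i2 => // p /set_mem Sp /=.
have a0 : A (iota p) != 0 by rewrite gt_eqF// A_gt0.
by rewrite T_E// wQE wSE// csqnM csqnC; congr (_%:E); field.
Qed.

Lemma L2_T_iota_inv h : LS h -> LQ (Ti h).
Proof.
move=> /(L2P leb2 measurable_strat_weight strat_weight_gt0 _)[mh hi].
apply/(L2P leb2 mwQ wQ0 _).
have mTh := cmTi mh; split => //.
have mg : measurable_fun HH (fun p => csqn (Ti h p) * wQ p).
  by apply: measurable_funM; [exact: cmeasurable_csqn|exact: mwQ].
apply/(integrable_iota mg).
have i2 := integrable_mull mS strat_constant^-1 hi.
apply: eq_integrable i2 => // p /set_mem Sp /=.
have a0 : A (iota p) != 0 by rewrite gt_eqF// A_gt0.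
have c0 : strat_constant != 0 by rewrite gt_eqF// strat_constant_gt0.
by rewrite TiE// wQE wSE// csqnM csqnC; congr (_%:E); field; rewrite a0 c0.
Qed.

Lemma cip_T_iota f h : LQ f -> LS h ->
  cip leb2 S wS (T f) h = strat_constant%:C * cip leb2 HH wQ f (Ti h).
Proof.
move=> Lf Lh; have LT := L2_T_iota_inv Lh.
have i := L2_cintegrable mHH mwQ wQ0 Lf LT.
rewrite /cip (cintegral_iota i) -cintegralZ//; last first.
  have := L2_cintegrable mS measurable_strat_weight strat_weight_gt0 (L2_T_iota Lf) Lh.
  move=> /(cintegrableZ mS (strat_constant^-1)%:C).
  apply: (eq_cintegrable mS) => p /set_mem Sp.
  have a0 : (A (iota p))%:C != 0 :> R[i] by apply/eqP => -[/eqP]; rewrite gt_eqF// A_gt0.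
  have c0 : strat_constant%:C != 0 :> R[i].
    by apply/eqP => -[/eqP]; rewrite gt_eqF// strat_constant_gt0.
  rewrite T_E// TiE// wQE wSE//; move: (A (iota p)) a0 => a a0.
  rewrite conjcM conjc_real !(rmorphM (real_complex R)) !fmorphV.
  by field; rewrite a0 c0.
apply: eq_cintegral => p /set_mem Sp.
have a0 : (A (iota p))%:C != 0 :> R[i] by apply/eqP => -[/eqP]; rewrite gt_eqF// A_gt0.
rewrite T_E// TiE// wQE wSE//; move: (A (iota p)) a0 => a a0.
  rewrite conjcM conjc_real !(rmorphM (real_complex R)) !fmorphV.
by field.
Qed.

End stratified_transform.

(** * Jacobi polynomials *)

Section leibniz.
Local Open Scope classical_set_scope.
Context {R : realType}.

(** The inductive step of the Leibniz formula, by Pascal's rule. *)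
Lemma binomial_pascal_sum (x y : nat -> R) (k : nat) :
  \sum_(i < k.+1) 'C(k, i)%:R * (x i.+1 * y (k - i)%N + x i * y (k - i).+1) =
  \sum_(i < k.+2) 'C(k.+1, i)%:R * (x i * y (k.+1 - i)%N).
Proof.
rewrite [RHS]big_ord_recl bin0 subn0 /=.
under [in RHS]eq_bigr => i _.
  rewrite /bump/= add1n binS natrD subSS mulrDl; over.
rewrite big_split/= [X in _ + (X + _)]big_ord_recr/= bin_small// mul0r addr0.
under eq_bigr do rewrite mulrDr.
rewrite big_split/= [X in _ + X = _]big_ord_recl/= bin0 subn0.
rewrite addrCA; congr (_ + _).
rewrite addrC; congr (_ + _).
apply: eq_bigr => i _; rewrite /bump/= add1n; congr (_ * (_ * y _)).
by rewrite subnSK.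
Qed.

(** [G i] and [K i] are successive derivatives on ]a, b[ only. The interval is open, so the k-th
    derivative agrees with the sum near each of its points, which allows one more
    differentiation. *)
Lemma derive1n_leibniz (a b : R) (G K : nat -> R -> R) (l : nat) :
  (forall i (u : R), (i < l)%N -> a < u < b -> is_derive u 1 (G i) (G i.+1 u)) ->
  (forall i (u : R), (i < l)%N -> a < u < b -> is_derive u 1 (K i) (K i.+1 u)) ->
  forall k (u : R), (k <= l)%N -> a < u < b ->
  derive1n k (fun u => G 0%N u * K 0%N u) u =
  \sum_(i < k.+1) 'C(k, i)%:R * (G i u * K (k - i)%N u).
Proof.
move=> dG dK; elim=> [|k IH] u kl uab.
  by rewrite derive1n0 big_ord_recl big_ord0 addr0 mul1r.
rewrite derive1nS derive1E.
pose s v := \sum_(i < k.+1) 'C(k, i)%:R * (G i v * K (k - i)%N v).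
have near_s : {near u, derive1n k (fun u => G 0%N u * K 0%N u) =1 s}.
  have := @near_in_itvoo R a b u; rewrite in_itv/= => /(_ uab).
  by apply: filterS => v; rewrite in_itv/= => vab; exact: IH (ltnW kl) vab.
rewrite (near_eq_derive _ near_s) ?oner_neq0//.
have ds (i : 'I_k.+1) : is_derive u 1 (fun v => 'C(k, i)%:R * (G i v * K (k - i)%N v))
   ('C(k, i)%:R * (G i.+1 u * K (k - i)%N u + G i u * K (k - i).+1 u)).
  have il : (i < l)%N by rewrite (leq_trans _ kl)// ltnW// ltnS.
  have kil : (k - i < l)%N by rewrite (leq_ltn_trans (leq_subr _ _)).
  have d := is_deriveM (dG i u il uab) (dK (k - i)%N u kil uab).
  have d2 := is_deriveZ 'C(k, i)%:R d.
  by apply: (is_derive_eq d2); rewrite /GRing.scale/=; ring.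
have dsum := is_derive_sum ds.
have -> : s = \sum_(i < k.+1) (fun v => 'C(k, i)%:R * (G i v * K (k - i)%N v)).
  by apply/funext => v; rewrite fct_sumE.
have [_ ->] := dsum.
exact: (binomial_pascal_sum (G^~ u) (K^~ u)).
Qed.

End leibniz.

Section jacobi_polynomial.
Local Open Scope classical_set_scope.
Context {R : realType}.

(** The i-th derivative of (1 + s u)^a, with the falling factorial written as a quotient of Gamma
    values; used for s = 1 and s = -1. *)
Definition power_derivative (s a : R) (i : nat) (u : R) : R :=
  s ^+ i * (gammaR (a + 1) / gammaR (a + 1 - i%:R)) * (1 + s * u) `^ (a - i%:R).

Lemma is_derive_power_derivative (s a : R) (i : nat) (u : R) :
  0 < 1 + s * u -> i%:R + 1 < a ->
  is_derive u 1 (power_derivative s a i) (power_derivative s a i.+1 u).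
Proof.
move=> su ia.
have d0 : is_derive u (1 : R) (fun x : R => 1 + s * x) s.
  by apply: is_derive_eq; rewrite /GRing.scale/=; ring.
have d1 := @is_derive1_comp _ (fun x => x `^ (a - i%:R)) (fun x => 1 + s * x) u _ _
  (is_derive1_powR (a - i%:R) su) d0.
have d2 := is_deriveZ (s ^+ i * (gammaR (a + 1) / gammaR (a + 1 - i%:R))) d1.
apply: (is_derive_eq d2); rewrite /GRing.scale/= /power_derivative.
have ai : 1 < a - i%:R by rewrite ltrBrDr addrC.
have g0 : gammaR (a - i%:R) != 0 by rewrite gt_eqF// gammaR_gt0.
have ai0 : a - i%:R != 0 by rewrite gt_eqF// (lt_trans ltr01).
have -> : a + 1 - i%:R = (a - i%:R) + 1 by ring.
rewrite (gammaRS ai).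
have -> : a + 1 - i.+1%:R = a - i%:R by rewrite -natr1; ring.
have -> : a - i.+1%:R = a - i%:R - 1 by rewrite -natr1; ring.
by rewrite exprS; field; rewrite g0 ai0.
Qed.

Variables (lambda1 lambda2 : R) (l : nat).
Hypotheses (l1 : 1 < lambda1) (l2 : 1 < lambda2).

(** The denominators are the Gamma factors of the Gram matrices with parameters lambda1 + l - i and
    lambda2 + i; they cancel when kernels are transformed and leave signed binomial coefficients. *)
Definition jacobi_coef (i : nat) : R :=
  (-1) ^+ l / l`!%:R * (gammaR (lambda1 + l%:R) * gammaR (lambda2 + l%:R)) *
  ('C(l, i)%:R * (-1) ^+ i /
   (gammaR (lambda1 + (l - i)%:R) * gammaR (lambda2 + i%:R))).

Definition jacobi_poly (v : R) : R :=
  \sum_(i < l.+1) jacobi_coef i * (((1 - v) / 2) ^+ (l - i) * ((1 + v) / 2) ^+ i).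

(** Leibniz in the Rodrigues formula: if i derivatives fall on the power of 1 - u, then dividing by
    the weight leaves exponent l - i on 1 - v and i on 1 + v. *)
Lemma jacobiE (v : R) : -1 < v < 1 ->
  jacobi (lambda1 - 1) (lambda2 - 1) l v = jacobi_poly v.
Proof.
move=> vI; have /andP[v1 v2] := vI.
have vm : 0 < 1 - v by lra.
have vp : 0 < 1 + v by lra.
pose a := lambda1 - 1 + l%:R; pose b := lambda2 - 1 + l%:R.
have la : lambda1 + l%:R = a + 1 by rewrite /a; ring.
have lb : lambda2 + l%:R = b + 1 by rewrite /b; ring.
have l0 : 0 <= l%:R :> R by [].
have lt_a (i : nat) : (i < l)%N -> i%:R + 1 < a.
  move=> il; have h : i%:R + 1 <= l%:R :> R by rewrite natr1 ler_nat.
  by rewrite /a (le_lt_trans h)// -[ltLHS]add0r ltrD2r subr_gt0.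
have lt_b (i : nat) : (i < l)%N -> i%:R + 1 < b.
  move=> il; have h : i%:R + 1 <= l%:R :> R by rewrite natr1 ler_nat.
  by rewrite /b (le_lt_trans h)// -[ltLHS]add0r ltrD2r subr_gt0.
have D := @derive1n_leibniz R (-1) 1 (power_derivative (-1) a) (power_derivative 1 b) l.
have {}D : derive1n l (fun u => power_derivative (-1) a 0 u * power_derivative 1 b 0 u) v =
   \sum_(i < l.+1) 'C(l, i)%:R * (power_derivative (-1) a i v * power_derivative 1 b (l - i) v).
  apply: D => // i u il /andP[u1 u2]; apply: is_derive_power_derivative.
  - by lra.
  - exact: lt_a.
  - by lra.
  - exact: lt_b.
have ga : gammaR (a + 1) != 0 by rewrite gt_eqF// gammaR_gt0// -la (lt_le_trans l1)// lerDl.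
have gb : gammaR (b + 1) != 0 by rewrite gt_eqF// gammaR_gt0// -lb (lt_le_trans l2)// lerDl.
rewrite /jacobi.
have -> : (fun u : R => (1 - u) `^ (lambda1 - 1 + l%:R) * (1 + u) `^ (lambda2 - 1 + l%:R)) =
   (fun u => power_derivative (-1) a 0 u * power_derivative 1 b 0 u).
  apply/funext => u; rewrite /power_derivative !subr0 !divff// !expr0 !mul1r.
  by rewrite mulN1r.
rewrite D /jacobi_poly mulr_sumr; apply: eq_bigr => -[i /= il] _.
rewrite ltnS in il.
rewrite /power_derivative /jacobi_coef la lb expr1n mul1r mulN1r.
have -> : a + 1 - i%:R = lambda1 + (l - i)%:R by rewrite natrB// /a; ring.
have -> : b + 1 - (l - i)%:R = lambda2 + i%:R by rewrite natrB// /b; ring.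
have -> : a - i%:R = (lambda1 - 1) + (l - i)%:R by rewrite natrB// /a; ring.
have -> : b - (l - i)%:R = (lambda2 - 1) + i%:R by rewrite natrB// /b; ring.
have split (x c : R) n : 0 < x -> x `^ (- c) * x `^ (c + n%:R) = x ^+ n.
  move=> x0; rewrite -powRD; last by apply/implyP => _; rewrite gt_eqF.
  by rewrite addrA addNr add0r powR_mulrn// ltW.
rewrite !exprMn -(split _ (lambda1 - 1) _ vm) -(split _ (lambda2 - 1) _ vp).
have pw : 2^-1 ^+ (l - i) * 2^-1 ^+ i = (2 ^+ l)^-1 :> R by rewrite -exprD subnK// exprVn.
by rewrite !invfM -pw mul1r; ring.
Qed.

Lemma continuous_jacobi_poly : continuous jacobi_poly.
Proof.
pose t i (v : R) := jacobi_coef i * (((1 + -1 * v) / 2) ^+ (l - i) * ((1 + 1 * v) / 2) ^+ i).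
have c1 (c : R) : continuous (fun v : R => (1 + c * v) / 2).
  move=> v; apply: cvgM; last exact: cvg_cst.
  by apply: cvgD; [exact: cvg_cst|apply: cvgM; [exact: cvg_cst|exact: cvg_id]].
have ct i : continuous (t i).
  move=> v; apply: cvgM; first exact: cvg_cst.
  by apply: cvgM; [exact: (continuous_comp (c1 (-1) v) (@exprn_continuous R (l - i) _))
    |exact: (continuous_comp (c1 1 v) (@exprn_continuous R i _))].
have cs n : continuous (fun v : R => \sum_(i < n) t i v).
  elim: n => [|n IH].
    rewrite (_ : (fun v : R => _) = cst 0); first by move=> v; exact: cvg_cst.
    by apply/funext => v; rewrite big_ord0.
  rewrite (_ : (fun v : R => _) = (fun v : R => (\sum_(i < n) t i v) + t n v)).
    by move=> v; exact: cvgD (IH v) (ct n v).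
  by apply/funext => u; rewrite big_ord_recr.
rewrite (_ : jacobi_poly = (fun v : R => \sum_(i < l.+1) t i v)); first exact: cs.
by apply/funext => u; apply: eq_bigr => i _; rewrite /t mulN1r mul1r.
Qed.

(** Only the term i = l survives at v = 1. A nonzero value at the end point suffices for the norm on
    ]-1, 1[ to be positive. *)
Lemma jacobi_poly1 : jacobi_poly 1 != 0.
Proof.
rewrite /jacobi_poly big_ord_recr/= big1 => [|i _]; last first.
  by rewrite subrr mul0r expr0n subn_eq0 leqNgt ltn_ord/= mul0r mulr0.
rewrite add0r subnn expr0 mul1r (_ : (1 + 1) / 2 = 1 :> R) ?expr1n ?mulr1; last by field.
have g (x : R) n : 1 < x -> gammaR (x + n%:R) != 0.
  by move=> x1; rewrite gt_eqF// gammaR_gt0// (lt_le_trans x1)// lerDl.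
by rewrite /jacobi_coef binn subnn !mulf_neq0 ?invr_eq0 ?mulf_neq0 ?g ?signr_eq0 ?oner_neq0//.
Qed.

End jacobi_polynomial.

(** * The operator Theta and its adjoint *)

Section weighted_L2_more.
Local Open Scope complex_scope.
Local Open Scope classical_set_scope.
Context d (T : measurableType d) (R : realType).
Variables (mu : {measure set T -> \bar R}) (D : set T) (w : T -> R).
Hypotheses (mD : measurable D) (mw : measurable_fun D w)
  (w_gt0 : forall x, D x -> 0 < w x).

Lemma eq_in_ae (f g : T -> R[i]) : (forall x, D x -> f x = g x) -> eq_ae mu D f g.
Proof. by move=> fg; rewrite /eq_ae; exact: (@aeW _ _ _ mu (fun x => D x -> f x = g x)). Qed.

Lemma eq_L2 (f g : T -> R[i]) : {in D, f =1 g} -> L2 mu D w f -> L2 mu D w g.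
Proof.
move=> fg /(L2P mu mw w_gt0 _)[mf fi]; apply/(L2P mu mw w_gt0 _); split.
  exact: eq_cmeasurable fg mf.
by apply: eq_integrable fi => // x xD; rewrite fg.
Qed.

(** The real inequality for x and c y, where c is the complex pairing itself: the real pairing is
    then the full |c|^2. *)
Lemma cip_CS (x y : T -> R[i]) : L2 mu D w x -> L2 mu D w y ->
  csqn (cip mu D w x y) <= L2sq mu D w x * L2sq mu D w y.
Proof.
move=> Lx Ly; set c := cip mu D w x y.
have sH := L2_semi_hilbert mu mD mw w_gt0.
have Lcy := L2Z mD mw w_gt0 c Ly.
have := semi_hilbert_CS sH Lx Lcy.
have -> : rip mu D w x (fun t => c * y t) = csqn c.
  by rewrite /rip cipZr// -/c mulrC mulcJ.
have -> : rip mu D w (fun t => c * y t) (fun t => c * y t) = csqn c * L2sq mu D w y.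
  by rewrite /rip cipZl// cipZr// cip_sq// mulrA mulcJ -rmorphM.
rewrite {1}/rip cip_sq//=.
move=> h; have [->|c0] := eqVneq (csqn c) 0.
  by rewrite mulr_ge0// L2sq_ge0.
have cp : 0 < csqn c by rewrite lt_neqAle eq_sym c0 csqn_ge0.
rewrite -(ler_pM2l cp) -expr2; apply: le_trans h _.
by rewrite le_eqVlt; apply/orP; left; apply/eqP; ring.
Qed.

End weighted_L2_more.

Section theta_operators.
Local Open Scope complex_scope.
Local Open Scope classical_set_scope.
Context {R : realType}.
Local Notation H := (@halfline R : set (measurableTypeR R)).
Local Notation I := (`]-1, 1[%classic : set (measurableTypeR R)).
Local Notation S := (H `*` I).
Variables (lambda1 lambda2 lambda3 : R) (l : nat).
Hypotheses (l1 : 1 < lambda1) (l2 : 1 < lambda2)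
  (l3 : lambda3 = lambda1 + lambda2 + 2 * l%:R).

Local Notation wS := (strat_weight lambda1 lambda2).
Local Notation w := (jacobi_weight lambda1 lambda2).
Local Notation LS := (@L2strat R lambda1 lambda2).
Local Notation Lam := (@L2R R lambda3).
Local Notation w3 := (@lap_weight R lambda3).
Local Notation P := (jacobi (lambda1 - 1) (lambda2 - 1) l).
Local Notation N := (jacobi_norm lambda1 lambda2 l).
Local Notation Theta := (Theta lambda1 lambda2 l).
Local Notation m := (lambda1 + lambda2 + l%:R - 1).

Let mH := @measurable_halfline R.
Let mI : measurable I. Proof. exact: measurable_itv. Qed.
Let mS := @measurable_strat R.
Let mwS := @measurable_strat_weight R lambda1 lambda2.
Let wS0 := @strat_weight_gt0 R lambda1 lambda2.
Let mw3 := @measurable_lap_weight R lambda3.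
Let w30 := @lap_weight_gt0 R lambda3.

Let IP (v : R) : I v <-> -1 < v < 1. Proof. by rewrite /= in_itv. Qed.

Let mw : measurable_fun I w.
Proof. by apply: measurable_funTS; exact: measurable_jacobi_weight. Qed.
Let w0 v : I v -> 0 < w v. Proof. by move=> /IP; exact: jacobi_weight_gt0. Qed.

Let mP : measurable_fun I P.
Proof.
have h : measurable_fun I (jacobi_poly lambda1 lambda2 l).
  apply: measurable_funTS; apply: continuous_measurable_fun.
  exact: continuous_jacobi_poly.
by apply: eq_measurable_fun h => v /set_mem/IP vI; rewrite jacobiE.
Qed.

Let integrable_bounded (f : R -> R) (c : R) : measurable_fun I f ->
  (forall v, I v -> `|f v| <= c) -> leb.-integrable I (EFin \o f).
Proof.
move=> mf fc.
have ci : leb.-integrable I (EFin \o (fun=> c)).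
  apply/integrableP; split; first exact: measurable_cst.
  by rewrite integral_cst//= lebesgue_measure_itv/= lte_fin gtrN// -EFinB -EFinM ltry.
apply: (le_integrable mI _ _ ci); first exact/measurable_EFinP.
by move=> v Iv; rewrite /= lee_fin (le_trans (fc v Iv))// ler_norm.
Qed.

Let B := \sum_(i < l.+1) `|jacobi_coef lambda1 lambda2 l i|.

Let P_le v : I v -> `|P v| <= B.
Proof.
move=> /IP vI; have /andP[v1 v2] := vI; rewrite jacobiE//.
apply: le_trans (ler_norm_sum _ _ _) _; apply: ler_sum => i _.
rewrite normrM -[leRHS]mulr1 ler_wpM2l// normrM mulr_ile1// normrX exprn_ile1//.
  by rewrite ger0_norm; lra.
by rewrite ger0_norm; lra.
Qed.

Let w_le v : I v -> `|w v| <= 2 `^ (lambda1 - 1) * 2 `^ (lambda2 - 1).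
Proof.
move=> Iv; rewrite gtr0_norm ?w0//; move: Iv => /IP/andP[v1 v2].
rewrite /jacobi_weight ler_pM ?powR_ge0//; apply: ge0_ler_powR;
  rewrite ?nnegrE ?subr_ge0 ?ltW//; lra.
Qed.

Let P2w_integrable : leb.-integrable I (EFin \o (fun v => P v ^+ 2 * w v)).
Proof.
apply: (integrable_bounded (c := B ^+ 2 * (2 `^ (lambda1 - 1) * 2 `^ (lambda2 - 1)))).
  by apply: measurable_funM => //; exact: measurable_funX.
move=> v Iv; rewrite normrM ler_pM// ?w_le// normrX lerXn2r ?nnegrE ?P_le//.
by apply: sumr_ge0.
Qed.

Let N2 := Rintegral leb I (fun v => P v ^+ 2 * w v).

Let N2_ge0 : 0 <= N2.
Proof. by apply: Rintegral_ge0 => v Iv; rewrite mulr_ge0 ?sqr_ge0// ltW// w0. Qed.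

Let NE : N ^+ 2 = N2. Proof. by rewrite sqr_sqrtr. Qed.

Lemma jacobi_norm_gt0 : 0 < N.
Proof.
rewrite sqrtr_gt0 lt_neqAle N2_ge0 andbT; apply/negP => /eqP/esym z.
have [+ _] := @ae_eq_integral_abs _ _ _ leb I mI _ (measurable_int _ P2w_integrable).
have -> : (\int[leb]_(v in I) `|(EFin \o (fun v => P v ^+ 2 * w v)%R) v| = 0)%E.
  rewrite -[RHS]/(0%:E) -z /N2 /Rintegral fineK; last exact: integrable_fin_num P2w_integrable.
  apply: eq_integral => v /set_mem Iv /=.
  by rewrite ger0_norm// mulr_ge0 ?sqr_ge0// ltW// w0.
move=> /(_ erefl)[M [mM M0 hM]].
have q1 := jacobi_poly1 l l1 l2.
have /cvgrPdist_lt/(_ `|jacobi_poly lambda1 lambda2 l 1|) := @continuous_jacobi_poly R lambda1 lambda2 l 1.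
rewrite normr_gt0 => /(_ q1); rewrite near_simpl => /nbhs_ballP[e /= e0 he].
(* By continuity the polynomial has no zero on ]r, 1[, a set of positive measure; the maximum with 0
   keeps it inside ]-1, 1[. *)
pose r : R := Num.max (1 - e) 0.
have r1 : r < 1 by rewrite gt_max ltr01 andbT; lra.
pose K : set (measurableTypeR R) := `]r, 1[%classic.
have : (leb K <= leb M)%E.
  apply: le_measure; rewrite ?inE//; first exact: measurable_itv.
  move=> v; rewrite /K /= in_itv/= gt_max => /andP[/andP[rv v0] v1].
  have vI : -1 < v < 1 by apply/andP; split => //; lra.
  have : ball (1 : R) e (v : R) by rewrite /ball/= gtr0_norm; lra.
  move=> /he/= hv; apply: hM => /= h; have Iv : I v by exact/IP.
  move: (h Iv) => [] /eqP; rewrite mulf_eq0 (gt_eqF (w0 Iv)) orbF sqrf_eq0.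
  by rewrite jacobiE// => /eqP Pv; move: hv; rewrite Pv subr0 ltxx.
have -> : leb K = (1 - r)%:E.
  have := lebesgue_measure_itv (Interval (BRight r) (BLeft (1 : R))).
  by rewrite /= lte_fin r1.
rewrite M0 lee_fin.
by rewrite leNgt subr_gt0 r1.
Qed.

Let N0 : N != 0. Proof. by rewrite gt_eqF// jacobi_norm_gt0. Qed.

Let pwD t (a b : R) : 0 < t -> t `^ (a + b) = t `^ a * t `^ b.
Proof. by move=> t0; rewrite powRD//; apply/implyP => _; rewrite gt_eqF. Qed.

Let s := lambda1 + lambda2 - 1.

Let w3E t : 0 < t -> w3 t = t `^ (- m) * t `^ (- m) * t `^ s.
Proof. by move=> t0; rewrite -!pwD// /lap_weight l3 /s; congr (_ `^ _); ring. Qed.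

Let mpw (c : R) : measurable_fun H (fun t : R => t `^ c).
Proof. by apply: measurable_funTS; exact: measurable_powR. Qed.

Definition jacobi_coefficient (f : R * R -> R[i]) (t : R) : R[i] :=
  cintegral leb I (fun u => f (t, u) * (P u * w u)%:C).

(** The weight for lambda3 is t^(-2m) times the t-part of the stratified weight ([w3E]); moving the
    factor t^(-m) of [Theta] across the pairing therefore gives t^m. *)
Definition Theta_adjoint (f : R * R -> R[i]) (t : R) : R[i] :=
  (t `^ m / N)%:C * jacobi_coefficient f t.

Lemma cmeasurable_Theta h : cmeasurable H h -> cmeasurable S (Theta h).
Proof.
move=> mh; apply: cmeasurableM; last exact: (cmeasurable_rect_fst I mH mh).
apply: cmeasurableC; apply: measurable_funM.
  exact: (measurable_rect_fst mH (mpw _)).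
by apply: (measurable_rect_snd mI (f := fun v => P v / N)); exact: measurable_funM.
Qed.

Lemma L2_Theta h : Lam h -> LS (Theta h).
Proof.
move=> /(L2P leb mw3 w30 _)[mh hi]; apply/(L2P leb2 mwS wS0 _).
split; first exact: cmeasurable_Theta.
have i2 := integrable_mull mI (N ^+ 2)^-1 P2w_integrable.
have := integrable_product mH mI hi i2.
apply: eq_integrable => // p /set_mem/stratP[p1 p2] /=.
rewrite /Defs.Theta csqnM csqnC w3E// /strat_weight -/s; congr (_%:E).
by field; exact: N0.
Qed.

Lemma Theta_adjointK h t : 0 < t -> Theta_adjoint (Theta h) t = h t.
Proof.
move=> t0; rewrite /Theta_adjoint /jacobi_coefficient.
have -> : cintegral leb I (fun u => Theta h (t, u) * (P u * w u)%:C) =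
    (t `^ (- m) / N)%:C * h t * N2%:C.
  have ci : cintegrable leb I (fun u => (P u ^+ 2 * w u)%:C).
    split => //=; exact: integrable0.
  have -> : N2%:C = cintegral leb I (fun u => (P u ^+ 2 * w u)%:C).
    by apply: complex_eqP => //=; rewrite /Rintegral integral0.
  rewrite -cintegralZ//; apply: eq_cintegral => u _.
  by rewrite /Defs.Theta /=; apply: complex_eqP; rewrite !cplxE/=; ring.
have e : t `^ m * t `^ (- m) = 1 by rewrite -pwD// subrr powRr0.
rewrite (_ : _ * _ = (t `^ m / N * (t `^ (- m) / N) * N2)%:C * h t); last first.
  by rewrite !(rmorphM (real_complex R)); ring.
rewrite -NE (_ : t `^ m / N * (t `^ (- m) / N) * N ^+ 2 = t `^ m * t `^ (- m)).
  by rewrite e mul1r.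
by field.
Qed.

Let cmc f : cmeasurable S f -> cmeasurable S (fun p => f p * (P p.2 * w p.2)%:C).
Proof.
move=> mf; apply: cmeasurableM => //; apply: cmeasurableC.
by apply: (measurable_rect_snd mI (f := fun v => P v * w v)); exact: measurable_funM.
Qed.

Lemma cmeasurable_jacobi_coefficient f : cmeasurable S f ->
  cmeasurable H (jacobi_coefficient f).
Proof.
move=> /cmc[f1 f2]; split.
  exact: (measurable_Rintegral_section leb mH mI f1).
exact: (measurable_Rintegral_section leb mH mI f2).
Qed.

Lemma cmeasurable_Theta_adjoint f : cmeasurable S f -> cmeasurable H (Theta_adjoint f).
Proof.
move=> mf; apply: cmeasurableM; last exact: cmeasurable_jacobi_coefficient.
by apply: cmeasurableC; exact: measurable_funM.
Qed.

Let L2P_ : L2 leb I w (fun v => (P v)%:C).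
Proof.
apply/(L2P leb mw w0 _); split => //.
by apply: eq_integrable P2w_integrable => // v _; rewrite /= csqnC.
Qed.

Let L2sqP : L2sq leb I w (fun v => (P v)%:C) = N ^+ 2.
Proof. by rewrite NE; apply: eq_Rintegral => v _; rewrite csqnC. Qed.

(** Cauchy-Schwarz on each section bounds the squared Jacobi coefficient by N^2 times the squared
    norm of the section. The powers of t match, and Tonelli integrates the bound over t. *)
Lemma L2_Theta_adjoint f : LS f -> Lam (Theta_adjoint f).
Proof.
move=> /(L2P leb2 mwS wS0 _)[mf fi].
have mA := cmeasurable_Theta_adjoint mf.
apply/(L2P leb mw3 w30 _); split => //; apply/integrableP; split.
  by apply/measurable_EFinP/measurable_funM => //; exact: cmeasurable_csqn.
pose G t := (\int[leb]_(u in I) (csqn (f (t, u)) * wS (t, u))%:E)%E.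
have pos p : S p -> (0 <= (csqn (f p) * wS p)%:E)%E.
  by move=> Sp; rewrite lee_fin mulr_ge0 ?csqn_ge0// ltW// wS0.
have mF : measurable_fun S (fun p => (csqn (f p) * wS p)%:E) by exact: measurable_int fi.
have GT : (\int[leb]_(t in H) G t < +oo)%E.
  rewrite -(tonelli1 _ _ mH mI mF pos); move/integrableP : fi => [_].
  by congr (_ < _)%E; apply: eq_integral => p /set_mem Sp; rewrite gee0_abs// pos.
apply: le_lt_trans GT; apply: ge0_le_integral => //.
- apply: measurableT_comp => //.
  by apply/measurable_EFinP/measurable_funM => //; exact: cmeasurable_csqn.
- exact: (tonelli_measurable1 _ mH mI mF pos).
move=> t Ht; have t0 : 0 < t by apply/halflineP.
have St u : I u -> S (t, u) by [].
rewrite gee0_abs; last by rewrite lee_fin mulr_ge0 ?csqn_ge0// ltW// w30.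
have G0 : (0 <= G t)%E by apply: integral_ge0 => u Iu; apply: (pos (t, u)).
(* A section of infinite norm satisfies the bound trivially; any other lies in L2, where
   Cauchy-Schwarz applies. *)
have [->|Gfin] := eqVneq (G t) +oo%E; first exact: leey.
have mft : cmeasurable I (fun u => f (t, u)).
  case: mf => f1 f2; split; first exact: (measurable_section1 mH mI f1).
  exact: (measurable_section1 mH mI f2).
have ts0 := powR_gt0 s t0.
have i1 : leb.-integrable I (fun u => (csqn (f (t, u)) * wS (t, u))%:E).
  apply/integrableP; split; first exact: (measurable_section1 mH mI mF).
  rewrite (_ : integral _ _ _ = G t); first by rewrite ltey.
  by apply: eq_integral => u /set_mem Iu; rewrite gee0_abs//; apply: (pos (t, u)).
have i2 : leb.-integrable I (EFin \o (fun u => csqn (f (t, u)) * w u)).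
  have := integrable_mull mI (t `^ s)^-1 i1; apply: eq_integrable => // u _ /=.
  by rewrite /strat_weight -/s; congr (_%:E); field; rewrite gt_eqF.
have Lft : L2 leb I w (fun u => f (t, u)) by apply/(L2P leb mw w0 _).
have cs := cip_CS mI mw w0 Lft L2P_.
have -> : G t = (t `^ s * L2sq leb I w (fun u => f (t, u)))%:E.
  rewrite EFinM /L2sq /Rintegral fineK; last exact: (integrable_fin_num mI i2).
  rewrite -integralZl//; apply: eq_integral => u _.
  by rewrite /strat_weight -/s -EFinM; congr (_%:E); ring.
rewrite lee_fin /Theta_adjoint csqnM csqnC w3E//.
have -> : jacobi_coefficient f t = cip leb I w (fun u => f (t, u)) (fun v => (P v)%:C).
  by apply: eq_cintegral => u _; rewrite conjc_real rmorphM mulrA.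
have e : t `^ m * t `^ (- m) = 1 by rewrite -pwD// subrr powRr0.
rewrite L2sqP in cs; set c := csqn _ in cs *; set L := L2sq _ _ _ _ in cs *.
rewrite (_ : (t `^ m / N) ^+ 2 * c * (t `^ (- m) * t `^ (- m) * t `^ s) =
  (t `^ m * t `^ (- m)) ^+ 2 * t `^ s * (c / N ^+ 2)); last by field.
rewrite e expr1n mul1r ler_wpM2l ?(ltW ts0)//.
by rewrite ler_pdivrMr// exprn_gt0// jacobi_norm_gt0.
Qed.

Lemma Theta_adjointP f h : LS f -> Lam h ->
  cip leb H w3 (Theta_adjoint f) h = cip leb2 S wS f (Theta h).
Proof.
move=> Lf Lh.
have [mf1 mf2 _] := Lf; have [mh1 mh2 _] := Lh.
have mh : cmeasurable H h by split.
pose F p := f p * (P p.2 * w p.2)%:C.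
pose e t := (t `^ (- m) / N * t `^ s)%:C * conjc (h t).
have FE p : f p * conjc (Theta h p) * (wS p)%:C = F p * e p.1.
  rewrite /F /e /Defs.Theta conjcM conjc_real /strat_weight -/s.
  by rewrite !(rmorphM (real_complex R)); ring.
have fi := L2_cintegrable mS mwS wS0 Lf (L2_Theta Lh).
have fi' : cintegrable leb2 S (fun p => F p * e p.1).
  by apply: (eq_cintegrable mS) fi => p _; rewrite FE.
have me : cmeasurable H e.
  apply: cmeasurableM; last exact: cmeasurable_conj.
  by apply: cmeasurableC; apply: measurable_funM => //; exact: measurable_funM.
rewrite [RHS](_ : _ = cintegral leb2 S (fun p => F p * e p.1)); last first.
  by apply: eq_cintegral => p _; rewrite FE.
rewrite (fubini_cintegral_pull mH mI (cmc (conj mf1 mf2)) me fi').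
apply: eq_cintegral => t /set_mem/halflineP t0.
rewrite /Theta_adjoint -/(jacobi_coefficient f t) /e w3E//.
have e1 : t `^ m * t `^ (- m) = 1 by rewrite -pwD// subrr powRr0.
rewrite [LHS](_ : _ = jacobi_coefficient f t * conjc (h t) *
  (t `^ m / N * (t `^ (- m) * t `^ (- m) * t `^ s))%:C); last first.
  by rewrite [in RHS]rmorphM/=; ring.
rewrite (_ : t `^ m / N * (t `^ (- m) * t `^ (- m) * t `^ s) =
  t `^ m * t `^ (- m) * (t `^ (- m) / N * t `^ s)); last by ring.
by rewrite e1 mul1r; ring.
Qed.

Lemma J_lE f p : S p -> J_l lambda1 lambda2 l f p = Theta (Theta_adjoint f) p.
Proof.
move=> /stratP[p1 _]; rewrite /J_l /Defs.Theta /Theta_adjoint -/(jacobi_coefficient f p.1).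
have e : p.1 `^ (- m) * p.1 `^ m = 1 by rewrite -pwD// addNr powRr0.
rewrite mulrA -rmorphM; congr (_%:C * _).
rewrite (_ : p.1 `^ (- m) * (P p.2 / N) * (p.1 `^ m / N) =
  p.1 `^ (- m) * p.1 `^ m * (P p.2 / N ^+ 2)); last by field.
by rewrite e mul1r.
Qed.

Lemma V_l_Theta h : Lam h -> V_l lambda1 lambda2 l (Theta h).
Proof.
move=> Lh; split; first exact: L2_Theta.
move/(L2P leb mw3 w30 _): (Lh) => [mh hi].
exists (fun t => (t `^ (- m) / N)%:C * h t); split; last first.
  by apply: eq_in_ae => p _; rewrite /Defs.Theta; apply: complex_eqP; rewrite !cplxE/=; ring.
have mk : cmeasurable H (fun t => (t `^ (- m) / N)%:C * h t).
  by apply: cmeasurableM => //; apply: cmeasurableC; exact: measurable_funM.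
apply/(L2P leb (mpw s) (fun t Ht => powR_gt0 s (iffLR (halflineP t) Ht)) _).
split => //; have := integrable_mull mH (N ^+ 2)^-1 hi.
apply: eq_integrable => // t /set_mem/halflineP t0 /=.
by rewrite csqnM csqnC w3E//; congr (_%:E); field.
Qed.

(** The choice made by [inverse_on] is meaningful because a preimage exists: t^m N k(t), with k the
    radial factor provided by [V_l]. *)
Lemma V_l_Theta_inv f : V_l lambda1 lambda2 l f ->
  Lam (Theta_inv lambda1 lambda2 l lambda3 f) /\
  eq_ae leb2 S (Theta (Theta_inv lambda1 lambda2 l lambda3 f)) f.
Proof.
move=> [Lf [k [Lk fk]]].
rewrite /Theta_inv /inverse_on; set X := [set _ | _].
suff : X (xget (fun=> 0) X) by [].
apply: xgetPex; exists (fun t => (t `^ m * N)%:C * k t).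
move/(L2P leb (mpw s) (fun t Ht => powR_gt0 s (iffLR (halflineP t) Ht)) _) : Lk => [mk ki].
have mk' : cmeasurable H (fun t => (t `^ m * N)%:C * k t).
  by apply: cmeasurableM => //; apply: cmeasurableC; exact: measurable_funM.
split.
  apply/(L2P leb mw3 w30 _); split => //.
  have := integrable_mull mH (N ^+ 2) ki.
  apply: eq_integrable => // t /set_mem/halflineP t0 /=.
  have e : t `^ m * t `^ (- m) = 1 by rewrite -pwD// subrr powRr0.
  rewrite csqnM csqnC w3E//; congr (_%:E).
  rewrite (_ : (t `^ m * N) ^+ 2 * csqn (k t) * (t `^ (- m) * t `^ (- m) * t `^ s) =
    (t `^ m * t `^ (- m)) ^+ 2 * (N ^+ 2 * (csqn (k t) * t `^ s))); last by ring.
  by rewrite e expr1n mul1r.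
apply: filterS fk => p h Sp; rewrite h//; have /stratP[p1 _] := Sp.
have e : p.1 `^ (- m) * p.1 `^ m = 1 by rewrite -pwD// addNr powRr0.
rewrite /Defs.Theta mulrA -rmorphM mulrC; congr (_ * _%:C).
rewrite (_ : p.1 `^ (- m) * (P p.2 / N) * (p.1 `^ m * N) =
  p.1 `^ (- m) * p.1 `^ m * P p.2); last by field.
by rewrite e mul1r.
Qed.

End theta_operators.

(** * Covariance of the kernel *)

Section intertwining_kernel.
Local Open Scope complex_scope.
Local Open Scope classical_set_scope.
Context {R : realType}.
Local Notation H := (@halfline R : set (measurableTypeR R)).
Local Notation HH := (H `*` H).
Local Notation uhp := (@upper_half_plane R).

Lemma cintegral_sum d (T : measurableType d) (mu : {measure set T -> \bar R})
    (D : set T) (mD : measurable D) n (a : nat -> R[i]) (f : nat -> T -> R[i]) :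
  (forall i, cintegrable mu D (f i)) ->
  cintegral mu D (fun x => \sum_(i < n) a i * f i x) =
    \sum_(i < n) a i * cintegral mu D (f i).
Proof.
move=> fi; suff [] : cintegrable mu D (fun x => \sum_(i < n) a i * f i x) /\
    cintegral mu D (fun x => \sum_(i < n) a i * f i x) =
    \sum_(i < n) a i * cintegral mu D (f i) by [].
elim: n => [|n [IH1 IH2]].
  rewrite big_ord0 (_ : (fun=> _) = fun=> 0); last by apply/funext => x; rewrite big_ord0.
  by rewrite cintegral0; split => //; split; exact: integrable0.
rewrite big_ord_recr/= -IH2 (_ : (fun=> _) =
  fun x => \sum_(i < n) a i * f i x + a n * f n x); last first.
  by apply/funext => x; rewrite big_ord_recr.
have i2 := cintegrableZ mD (a n) (fi n).
by split; [exact: cintegrableD|rewrite cintegralD// cintegralZ].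
Qed.

Lemma laplace_sum n (a : nat -> R[i]) (la : nat -> R) (h : nat -> R -> R[i]) z :
  (forall i, 1 < la i) -> (forall i, L2R (la i) (h i)) -> uhp z ->
  laplace (fun t => \sum_(i < n) a i * h i t) z = \sum_(i < n) a i * laplace (h i) z.
Proof.
move=> hl Lh hz; have mH := @measurable_halfline R.
have := @cintegral_sum _ _ leb H mH n a (fun i t => h i t * cexp ('i%C * z * t%:C))
  (fun i => laplace_cintegrable (hl i) (Lh i) hz).
rewrite -[RHS]/(\sum_(i < n) a i * laplace (h i) z) => <-.
by apply: eq_cintegral => t _; rewrite mulr_suml; apply: eq_bigr => i _; rewrite !mulrA.
Qed.

Lemma laplace2_sum n (a : nat -> R[i]) (l1 l2 : nat -> R) (h1 h2 : nat -> R -> R[i]) z :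
  (forall i, 1 < l1 i) -> (forall i, 1 < l2 i) ->
  (forall i, L2R (l1 i) (h1 i)) -> (forall i, L2R (l2 i) (h2 i)) ->
  uhp z.1 -> uhp z.2 ->
  laplace2 (fun p => \sum_(i < n) a i * (h1 i p.1 * h2 i p.2)) z =
  \sum_(i < n) a i * (laplace (h1 i) z.1 * laplace (h2 i) z.2).
Proof.
move=> hl1 hl2 L1 L2 z1 z2.
transitivity (laplace (fun x => \sum_(i < n) (a i * laplace (h2 i) z.2) * h1 i x) z.1).
  rewrite /laplace2 /tensor_op /=; congr laplace; apply/funext => x.
  transitivity (\sum_(i < n) (a i * h1 i x) * laplace (h2 i) z.2).
    rewrite -(@laplace_sum n (fun i => a i * h1 i x) _ _ _ hl2 L2 z2).
    by congr laplace; apply/funext => y; apply: eq_bigr => i _; rewrite mulrA.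
  by apply: eq_bigr => i _; rewrite mulrAC.
rewrite (@laplace_sum n (fun i => a i * laplace (h2 i) z.2) _ _ _ hl1 L1 z1).
by apply: eq_bigr => i _; ring.
Qed.

Variables (lambda1 lambda2 lambda3 : R) (l : nat).
Hypotheses (l1 : 1 < lambda1) (l2 : 1 < lambda2)
  (l3 : lambda3 = lambda1 + lambda2 + 2 * l%:R).
Local Notation N := (jacobi_norm lambda1 lambda2 l).
Local Notation Theta := (Theta lambda1 lambda2 l).
Local Notation Ti := (T_iota_inv lambda1 lambda2).
Local Notation coef := (jacobi_coef lambda1 lambda2 l).

Let l31 : 1 < lambda3.
Proof.
rewrite l3; have h : 0 <= l%:R :> R by [].
by rewrite (lt_le_trans l1)// -addrA lerDl addr_ge0 ?(ltW (lt_trans ltr01 l2))// mulr_ge0.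
Qed.
Let l1D n : 1 < lambda1 + n%:R.
Proof. by rewrite (lt_le_trans l1)// lerDl. Qed.
Let l2D n : 1 < lambda2 + n%:R.
Proof. by rewrite (lt_le_trans l2)// lerDl. Qed.

Let pwD t (a b : R) : 0 < t -> t `^ (a + b) = t `^ a * t `^ b.
Proof. by move=> t0; rewrite powRD//; apply/implyP => _; rewrite gt_eqF. Qed.

(** With t = x + y and v = (y - x)/(x + y), the powers of (1 - v)/2 and (1 + v)/2 bring out (x +
    y)^(-l). The exponents of t in [Theta] and in the kernel add up to l, by the value of lambda3,
    and cancel it. *)
Lemma T_iota_inv_Theta_ker u q : HH q ->
  Ti (Theta (lap_ker lambda3 u)) q = \sum_(i < l.+1) (coef i / N)%:C *
    (lap_ker (lambda1 + (l - i)%:R) u q.1 * lap_ker (lambda2 + i%:R) u q.2).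
Proof.
move=> Hq; have /stratP[_ vI] := iota_inv_strat Hq.
case: q Hq vI => x y [/halflineP/= x0 /halflineP/= y0] vI.
have t0 : 0 < x + y by rewrite addr_gt0.
rewrite /T_iota_inv /Defs.Theta /= jacobiE// /lap_ker.
have -> : conjc (cexp ('i%C * u * (x + y)%:C)) =
    conjc (cexp ('i%C * u * x%:C)) * conjc (cexp ('i%C * u * y%:C)).
  by rewrite -conjcM -cexpD; congr (conjc (cexp _)); rewrite (rmorphD (real_complex R)); ring.
move: (conjc _) (conjc (cexp ('i%C * u * y%:C))) => ex ey.
transitivity ((\sum_(i < l.+1) coef i / N *
    (x `^ (lambda1 + (l - i)%:R - 1) * y `^ (lambda2 + i%:R - 1)))%:C * (ex * ey)); last first.
  rewrite rmorph_sum/= mulr_suml; apply: eq_bigr => i _.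
  by rewrite !(rmorphM (real_complex R)); ring.
rewrite !mulrA -!(rmorphM (real_complex R)) /=; congr (_%:C * _ * _).
have pl : (x + y) `^ (- (lambda1 + lambda2 + l%:R - 1)) * (x + y) `^ (lambda3 - 1) = (x + y) ^+ l.
  by rewrite -pwD// -powR_mulrn ?ltW//; congr (_ `^ _); rewrite l3; ring.
rewrite /jacobi_poly !(mulr_suml, mulr_sumr); apply: eq_bigr => i _.
have il : (i <= l)%N by rewrite -ltnS.
have -> : (1 - (y - x) / (x + y)) / 2 = x / (x + y) by field; rewrite gt_eqF.
have -> : (1 + (y - x) / (x + y)) / 2 = y / (x + y) by field; rewrite gt_eqF.
rewrite (addrAC lambda1 _ (-1)) (addrAC lambda2 _ (-1)).
rewrite (pwD (lambda1 - 1) _ x0) (pwD (lambda2 - 1) _ y0) !powR_mulrn ?ltW//.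
rewrite !exprMn !exprVn.
have e : (x + y) ^+ l = (x + y) ^+ (l - i) * (x + y) ^+ i by rewrite -exprD subnK.
rewrite [LHS](_ : _ = coef i / N * (x `^ (lambda1 - 1) * x ^+ (l - i) *
  (y `^ (lambda2 - 1) * y ^+ i)) * (((x + y) `^ (- (lambda1 + lambda2 + l%:R - 1)) *
  (x + y) `^ (lambda3 - 1)) / ((x + y) ^+ (l - i) * (x + y) ^+ i))); last first.
  by rewrite invfM; ring.
by rewrite pl e divff ?mulr1// mulf_neq0// expf_neq0// gt_eqF.
Qed.

Let K : R := (-1) ^+ l / l`!%:R * (gammaR (lambda1 + l%:R) * gammaR (lambda2 + l%:R)).

(** The Gamma factor of each transformed kernel cancels against [jacobi_coef]. With X_j = - i (z_j -
    conj u), what is left is the binomial expansion of (X_2 - X_1)^l, and u drops out of X_2 -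
    X_1. *)
Lemma laplace2_Theta_ker u z : uhp u -> uhp z.1 -> uhp z.2 ->
  laplace2 (Ti (Theta (lap_ker lambda3 u))) z =
  (K / N)%:C * (- 'i * (z.2 - z.1)) ^+ l *
  (cexp (- ((lambda1 + l%:R)%:C * uhp_log (z.1 - conjc u))) *
   cexp (- ((lambda2 + l%:R)%:C * uhp_log (z.2 - conjc u)))).
Proof.
move=> hu z1 z2.
have -> : laplace2 (Ti (Theta (lap_ker lambda3 u))) z =
   laplace2 (fun q => \sum_(i < l.+1) (coef i / N)%:C *
    (lap_ker (lambda1 + (l - i)%:R) u q.1 * lap_ker (lambda2 + i%:R) u q.2)) z.
  rewrite /laplace2 /tensor_op; apply: eq_cintegral => x /set_mem Hx; congr (_ * _).
  apply: eq_cintegral => y /set_mem Hy; congr (_ * _).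
  by rewrite T_iota_inv_Theta_ker.
rewrite (@laplace2_sum l.+1 (fun i => (coef i / N)%:C) (fun i => lambda1 + (l - i)%:R)
  (fun i => lambda2 + i%:R) (fun i => lap_ker (lambda1 + (l - i)%:R) u)
  (fun i => lap_ker (lambda2 + i%:R) u)) => //; try by move=> i; exact: L2_lap_ker.
have -> : - 'i * (z.2 - z.1) = cexp (uhp_log (z.2 - conjc u)) - cexp (uhp_log (z.1 - conjc u)).
  by rewrite !cexp_uhp_log; [ring|exact: uhp_subJ|exact: uhp_subJ].
rewrite exprBn mulr_sumr mulr_suml; apply: eq_bigr => i _.
have il : (i <= l)%N by rewrite -ltnS.
rewrite !lap_ker_gram//.
move: (uhp_log _) (uhp_log (z.2 - conjc u)) => L1 L2.
have e1 : cexp (- ((lambda1 + (l - i)%:R)%:C * L1)) =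
    cexp (- ((lambda1 + l%:R)%:C * L1)) * cexp L1 ^+ i.
  rewrite -cexpMn -cexpD; congr cexp.
  by rewrite natrB// !rmorphD/= rmorphN/= !rmorph_nat; ring.
have e2 : cexp (- ((lambda2 + i%:R)%:C * L2)) =
    cexp (- ((lambda2 + l%:R)%:C * L2)) * cexp L2 ^+ (l - i).
  rewrite -cexpMn -cexpD; congr cexp.
  by rewrite natrB// !rmorphD/= !rmorph_nat; ring.
rewrite e1 e2.
move: (cexp _) (cexp (- _)) (cexp L1) (cexp L2) => E1 E2 X1 X2.
have -> : (coef i / N)%:C = (K / N)%:C * ('C(l, i)%:R * (-1) ^+ i) /
   ((gammaR (lambda1 + (l - i)%:R))%:C * (gammaR (lambda2 + i%:R))%:C).
  have -> : coef i / N = K / N * ('C(l, i)%:R * (-1) ^+ i) *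
      (gammaR (lambda1 + (l - i)%:R) * gammaR (lambda2 + i%:R))^-1.
    by rewrite /jacobi_coef -/K; ring.
  have s1 : ((-1 : R) ^+ i)%:C = (-1) ^+ i by rewrite rmorphXn/= rmorphN1.
  rewrite (rmorphM (real_complex R)) fmorphV/= (rmorphM (real_complex R) _ (gammaR _)).
  rewrite (rmorphM (real_complex R) (K / N)) (rmorphM (real_complex R) _ ((-1) ^+ i)).
  by rewrite /= s1 (rmorph_nat (real_complex R)).
have g1 : (gammaR (lambda1 + (l - i)%:R))%:C != 0.
  by apply/eqP => -[/eqP]; rewrite gt_eqF// gammaR_gt0.
have g2 : (gammaR (lambda2 + i%:R))%:C != 0.
  by apply/eqP => -[/eqP]; rewrite gt_eqF// gammaR_gt0.
by rewrite -mulr_natl; move: (K / N)%:C => c; field; rewrite g1 g2.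

Qed.

Lemma L2_Theta_ker u : uhp u -> L2R2 lambda1 lambda2 (Ti (Theta (lap_ker lambda3 u))).
Proof. by move=> hu; apply/L2_T_iota_inv/(L2_Theta l1 l2 l3)/L2_lap_ker. Qed.

(** The power of z_2 - z_1 lowers the weights lambda1 + l and lambda2 + l in z_1 and z_2 by l, to
    those of the action, while the weights in u add up to lambda3. *)
Lemma laplace2_Theta_ker_act (g : universal_SL2 R) u z : uhp u -> uhp z.1 -> uhp z.2 ->
  disc_series2 lambda1 lambda2 g (laplace2 (Ti (Theta (lap_ker_act lambda3 g u)))) z =
  laplace2 (Ti (Theta (lap_ker lambda3 u))) z.
Proof.
move=> hu z1 z2; set B := invmx (SL2_mx g); set phi := SL2_log g.
have hBu := mobius_uhp g hu.
have hB1 := mobius_uhp g z1; have hB2 := mobius_uhp g z2.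
rewrite /disc_series2 /tensor_op /disc_series -/B -/phi.
have -> : Ti (Theta (lap_ker_act lambda3 g u)) =
    (fun q => conjc (cexp (- (lambda3%:C * phi u))) * Ti (Theta (lap_ker lambda3 (mobius B u))) q).
  by apply/funext => q; rewrite /T_iota_inv /Defs.Theta /lap_ker_act -/B -/phi; ring.
rewrite (_ : laplace2 _ _ = conjc (cexp (- (lambda3%:C * phi u))) *
   laplace2 (Ti (Theta (lap_ker lambda3 (mobius B u)))) (mobius B z.1, mobius B z.2)); last first.
  have LQ := L2_Theta_ker hBu.
  have mQ := @measurable_quadrant R; have mw := @measurable_lap_weight2 R lambda1 lambda2.
  have w0 := @lap_weight2_gt0 R lambda1 lambda2.
  rewrite !(laplace2_cip l1 l2)//; last exact: (L2Z mQ mw w0).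
  by rewrite (cipZl mQ mw w0)//; exact: L2_lap_ker2.
rewrite !laplace2_Theta_ker// !uhp_log_mobius// mobius_sub// -/phi -cexpJ.
rewrite [conjc (- _)](_ : _ = - (lambda3%:C * conjc (phi u))); last first.
  by move: (phi u) => w; apply: complex_eqP; rewrite !cplxE/=; ring.
move: (phi z.1) (phi z.2) (conjc (phi u)) (uhp_log _) (uhp_log (z.2 - conjc u)) => f1 f2 c L1 L2.
have e1 (la : R) f L : cexp (- ((la + l%:R)%:C * (L - f - c))) =
    cexp (- ((la + l%:R)%:C * L)) * cexp (la%:C * f) * cexp f ^+ l * cexp ((la + l%:R)%:C * c).
  by rewrite -cexpMn -!cexpD; congr cexp; rewrite !rmorphD/= !rmorph_nat; ring.
rewrite !e1.
have -> : cexp (- (lambda3%:C * c)) =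
    (cexp ((lambda1 + l%:R)%:C * c) * cexp ((lambda2 + l%:R)%:C * c))^-1.
  rewrite -cexpD -cexpN; congr cexp; congr (- _); rewrite -mulrDl -rmorphD/=.
  by rewrite l3; congr (_%:C * _); ring.
rewrite (cexpN (lambda1%:C * f1)) (cexpN (lambda2%:C * f2)).
have := cexp_neq0 ((lambda1 + l%:R)%:C * c); have := cexp_neq0 ((lambda2 + l%:R)%:C * c).
have := cexp_neq0 (lambda1%:C * f1); have := cexp_neq0 (lambda2%:C * f2).
have := cexp_neq0 f1; have := cexp_neq0 f2.
move: (cexp (- _)) (cexp (- ((lambda2 + l%:R)%:C * L2))) => E1 E2.
move: (cexp f1) (cexp f2) (cexp (lambda1%:C * f1)) (cexp (lambda2%:C * f2))
  (cexp ((lambda1 + l%:R)%:C * c)) (cexp ((lambda2 + l%:R)%:C * c)) => X1 X2 Y1 Y2 Z1 Z2.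
move=> /(expf_neq0 l) n2 /(expf_neq0 l) n1 n3 n4 n5 n6.
rewrite !exprMn exprVn exprMn.
move: (X1 ^+ l) (X2 ^+ l) ((- 'i) ^+ l) ((z.2 - z.1) ^+ l) (K / N)%:C n1 n2 => x1 x2 i y k n1 n2.
by field; rewrite n1 n2 n3 n4 n5 n6.
Qed.

End intertwining_kernel.

(** * Intertwining relations *)

Section weighted_L2_ae.
Local Open Scope complex_scope.
Local Open Scope classical_set_scope.
Context d (T : measurableType d) (R : realType).
Variables (mu : {measure set T -> \bar R}) (D : set T) (w : T -> R).
Hypotheses (mD : measurable D) (mw : measurable_fun D w)
  (w_gt0 : forall x, D x -> 0 < w x).
Local Notation L2 := (L2 mu D w).

Lemma eq_ae_sym (f g : T -> R[i]) : eq_ae mu D f g -> eq_ae mu D g f.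
Proof. by apply: filterS => x h Dx; rewrite h. Qed.

Lemma eq_ae_trans (f g h : T -> R[i]) : eq_ae mu D f g -> eq_ae mu D g h -> eq_ae mu D f h.
Proof. by apply: filterS2 => x h1 h2 Dx; rewrite h1// h2. Qed.

Lemma cipBl (f g h : T -> R[i]) : L2 f -> L2 g -> L2 h ->
  cip mu D w (fun x => f x - g x) h = cip mu D w f h - cip mu D w g h.
Proof.
move=> Lf Lg Lh; rewrite -[in RHS]mulN1r -cipZl// -cipDl//; last exact: L2Z.
by apply: eq_cip => // x _; rewrite mulN1r.
Qed.

Lemma cipBr (f g h : T -> R[i]) : L2 f -> L2 g -> L2 h ->
  cip mu D w h (fun x => f x - g x) = cip mu D w h f - cip mu D w h g.
Proof.
move=> Lf Lg Lh; rewrite (cipC mD mw w_gt0 (L2B mD mw w_gt0 Lf Lg) Lh) cipBl//.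
rewrite (cipC mD mw w_gt0 Lf Lh) (cipC mD mw w_gt0 Lg Lh).
by apply: complex_eqP; rewrite !cplxE/=; ring.
Qed.

Lemma L2sq_eq_ae (f g : T -> R[i]) : L2 f -> L2 g -> eq_ae mu D f g ->
  L2sq mu D w f = L2sq mu D w g.
Proof.
move=> Lf Lg fg; have mf := L2_cmeasurable mw w_gt0 Lf; have mg := L2_cmeasurable mw w_gt0 Lg.
apply: (congr1 (@complex.Re R) (_ : (L2sq mu D w f)%:C = (L2sq mu D w g)%:C)).
rewrite -(cip_sq Lf) -(cip_sq Lg) (ae_eq_cip mD mw mf mg mf fg).
rewrite (cipC mD mw w_gt0 Lf Lg) (ae_eq_cip mD mw mf mg mg fg).
by rewrite -(cipC mD mw w_gt0 Lg Lg).
Qed.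

Lemma L2sq_sub_eq0 (f g : T -> R[i]) : L2 f -> L2 g ->
  L2sq mu D w (fun x => f x - g x) = 0 -> eq_ae mu D f g.
Proof.
move=> Lf Lg /(L2sq_eq0 mD mw w_gt0 (L2B mD mw w_gt0 Lf Lg)).
by apply: filterS => x h Dx; apply/eqP; rewrite -subr_eq0; apply/eqP/h.
Qed.

Lemma eq_ae_L2sq0 (f : T -> R[i]) : L2 f -> eq_ae mu D f (fun=> 0) -> L2sq mu D w f = 0.
Proof.
move=> Lf f0; have L0 := L2Z mD mw w_gt0 0 Lf.
rewrite (@L2sq_eq_ae _ _ Lf L0).
  by rewrite /L2sq /Rintegral integral0_eq// => x _; rewrite mul0r /csqn/= expr0n/= addr0 mul0r.
by apply: filterS f0 => x h Dx; rewrite h// mul0r.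
Qed.

End weighted_L2_ae.

(** * Isometry and covariance in the Laplace models *)

Section unitary_actions.
Local Open Scope complex_scope.
Local Open Scope classical_set_scope.
Context {R : realType}.
Local Notation H := (@halfline R : set (measurableTypeR R)).
Local Notation HH := (H `*` H).
Local Notation uhp := (@upper_half_plane R).
Variable g : universal_SL2 R.
Local Notation B := (invmx (SL2_mx g)).

Let mH := @measurable_halfline R.
Let mHH := @measurable_quadrant R.
Let uhp_i : uhp 'i%C. Proof. exact: ltr01. Qed.

Section one_variable.
Variable lambda : R.
Hypothesis l1 : 1 < lambda.
Local Notation w := (@lap_weight R lambda).
Local Notation cip := (cip leb H w).
Let mw := @measurable_lap_weight R lambda.
Let w0 := @lap_weight_gt0 R lambda.

Lemma laplace_eq_ae h1 h2 : L2R lambda h1 -> L2R lambda h2 ->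
  (forall z, uhp z -> laplace h1 z = laplace h2 z) -> eq_ae leb H h1 h2.
Proof.
move=> L1 L2 h; have L12 := L2B mH mw w0 L1 L2.
apply: (L2sq_sub_eq0 mH mw w0) => //; apply: (eq_ae_L2sq0 mH mw w0) => //.
apply: (laplace_inj l1) => // z uz; rewrite (laplace_cip lambda).
rewrite (cipBl mH mw w0)//; last exact: L2_lap_ker.
by rewrite -!laplace_cip h// subrr.
Qed.

Lemma hat_pi_eq_ae h1 h2 : L2R lambda h1 -> L2R lambda h2 -> eq_ae leb H h1 h2 ->
  eq_ae leb H (hat_pi lambda g h1) (hat_pi lambda g h2).
Proof.
move=> L1 L2 h12; have [L1' e1] := hat_piP l1 g L1; have [L2' e2] := hat_piP l1 g L2.
apply: (laplace_eq_ae L1' L2') => z uz.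
rewrite (e1 z uz) (e2 z uz) /disc_series; congr (_ * _).
rewrite !(laplace_cip lambda); apply: (ae_eq_cip mH mw _ _ _ h12).
- exact: (L2_cmeasurable mw w0 L1).
- exact: (L2_cmeasurable mw w0 L2).
- exact: cmeasurable_lap_ker.
Qed.

Let idx := {z | uhp z}.
Let K (z : idx) := lap_ker lambda (proj1_sig z).
Let Ka (z : idx) := lap_ker_act lambda g (proj1_sig z).

(** The covariance principle with [hat_pi lambda g h] and h in both roles. The moved kernels are
    total because the Moebius map is onto. *)
Lemma hat_pi_isometry h : L2R lambda h ->
  L2sq leb H w (hat_pi lambda g h) = L2sq leb H w h.
Proof.
move=> Lh; have [Lh' e] := hat_piP l1 g Lh.
have LK z : L2R lambda (K z) by case: z => z uz; exact: L2_lap_ker.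
have LKa z : L2R lambda (Ka z) by case: z => z uz; exact: L2_lap_ker_act.
have tot f : L2R lambda f -> (forall z, uhp z -> laplace f z = 0) -> L2sq leb H w f = 0.
  by move=> Lf f0; apply: (eq_ae_L2sq0 mH mw w0) => //; exact: (laplace_inj l1).
have HF i : cip (hat_pi lambda g h) (K i) = cip h (Ka i).
  by case: i => z uz; rewrite /K /Ka/= -laplace_cip e// disc_series_cip.
apply: (congr1 (@complex.Re R) (_ : (L2sq leb H w _)%:C = (L2sq leb H w h)%:C)).
rewrite -!cip_sq//.
apply: (L2_covariant mH mw w0 (exist _ _ uhp_i : idx) LKa LK) => //.
- move=> [z uz] [v uv]; rewrite /K /Ka/= -laplace_cip -(lap_ker_act_gram l1 g)//.
  by rewrite disc_series_cip//; exact: L2_lap_ker_act.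
- move=> f Lf f0; apply: tot => // z uz; have [z' uz' <-] := mobius_surj g uz.
  have := f0 (exist _ z' uz'); rewrite /Ka/= -(disc_series_cip l1 g Lf uz') /disc_series.
  by move/eqP; rewrite mulf_eq0 (negbTE (cexp_neq0 _))/= => /eqP.
- move=> f Lf f0; apply: tot => // z uz.
  by have := f0 (exist _ z uz); rewrite /K/= -laplace_cip.
Qed.

End one_variable.

Section two_variables.
Variables lambda1 lambda2 : R.
Hypotheses (l1 : 1 < lambda1) (l2 : 1 < lambda2).
Local Notation w := (lap_weight2 lambda1 lambda2).
Local Notation cip := (cip leb2 HH w).
Local Notation LQ := (@L2R2 R lambda1 lambda2).
Let mw := @measurable_lap_weight2 R lambda1 lambda2.
Let w0 := @lap_weight2_gt0 R lambda1 lambda2.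

Let idx := {z : R[i] * R[i] | uhp z.1 /\ uhp z.2}.
Let K (z : idx) := lap_ker2 lambda1 lambda2 (proj1_sig z).
Let Ka (z : idx) := lap_ker2_act lambda1 lambda2 g (proj1_sig z).

(** The hypothesis says that p is the image of q under g; unitarity then takes the form of an
    adjoint relation in which the inverse of g does not occur. *)
Lemma hat_pi2_covariant F p q : LQ F -> LQ p -> LQ q ->
  (forall z, uhp z.1 -> uhp z.2 ->
     laplace2 p z = disc_series2 lambda1 lambda2 g (laplace2 q) z) ->
  cip (hat_pi2 lambda1 lambda2 g F) p = cip F q.
Proof.
move=> LF Lp Lq pq; have [LF' e] := hat_pi2P l1 l2 g LF.
have LK z : LQ (K z) by case: z => z [z1 z2]; exact: L2_lap_ker2.
have LKa z : LQ (Ka z) by case: z => z [z1 z2]; exact: L2_lap_ker2_act.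
have tot f : LQ f -> (forall z, uhp z.1 -> uhp z.2 -> laplace2 f z = 0) ->
    L2sq leb2 HH w f = 0.
  by move=> Lf f0; apply: (eq_ae_L2sq0 mHH mw w0) => //; exact: (laplace2_inj l1 l2).
have cov f1 f2 : LQ f1 -> LQ f2 -> (forall z, uhp z.1 -> uhp z.2 ->
     laplace2 f1 z = disc_series2 lambda1 lambda2 g (laplace2 f2) z) ->
     forall i, cip f1 (K i) = cip f2 (Ka i).
  move=> Lf1 Lf2 f12 [z [z1 z2]].
  by rewrite /K /Ka/= -(laplace2_cip l1 l2)// f12// disc_series2_cip.
apply: (L2_covariant mHH mw w0 (exist _ ('i%C, 'i%C) (conj uhp_i uhp_i) : idx) LKa LK) => //.
- move=> [z [z1 z2]] [v [v1 v2]]; rewrite /K /Ka/= -(laplace2_cip l1 l2)//; last exact: L2_lap_ker2.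
  rewrite -(lap_ker2_act_gram l1 l2 g)// disc_series2_cip//.
  exact: L2_lap_ker2_act.
- move=> f Lf f0; apply: tot => // z z1 z2.
  have [v1 u1 e1] := mobius_surj g z1; have [v2 u2 e2] := mobius_surj g z2.
  have := f0 (exist _ (v1, v2) (conj u1 u2)).
  rewrite -[cip _ _]/(cip f (lap_ker2_act lambda1 lambda2 g (v1, v2))).
  rewrite -(disc_series2_cip (z := (v1, v2)) l1 l2 g Lf u1 u2).
  rewrite -[LHS]/(cexp (- (lambda1%:C * SL2_log g v1)) * (cexp (- (lambda2%:C * SL2_log g v2)) *
    laplace2 f (mobius B v1, mobius B v2))) e1 e2.
  move/eqP; rewrite mulf_eq0 (negbTE (cexp_neq0 _)) mulf_eq0 (negbTE (cexp_neq0 _)) => /eqP.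
  by case: (z).
- move=> f Lf f0; apply: tot => // z z1 z2.
  by have := f0 (exist _ z (conj z1 z2)); rewrite /K/= -(laplace2_cip l1 l2).
- exact: cov.
- exact: cov.
Qed.

Lemma hat_pi2_isometry F : LQ F ->
  cip (hat_pi2 lambda1 lambda2 g F) (hat_pi2 lambda1 lambda2 g F) = cip F F.
Proof.
move=> LF; have [LF' e] := hat_pi2P l1 l2 g LF.
exact: hat_pi2_covariant.
Qed.

End two_variables.

End unitary_actions.

Section intertwining.
Local Open Scope complex_scope.
Local Open Scope classical_set_scope.
Context {R : realType}.
Local Notation H := (@halfline R : set (measurableTypeR R)).
Local Notation HH := (H `*` H).
Local Notation I := (`]-1, 1[%classic : set (measurableTypeR R)).
Local Notation S := (H `*` I).
Local Notation uhp := (@upper_half_plane R).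
Variables (lambda1 lambda2 lambda3 : R) (l : nat).
Hypotheses (l1 : 1 < lambda1) (l2 : 1 < lambda2)
  (l3 : lambda3 = lambda1 + lambda2 + 2 * l%:R).

Local Notation wS := (strat_weight lambda1 lambda2).
Local Notation wQ := (lap_weight2 lambda1 lambda2).
Local Notation w3 := (@lap_weight R lambda3).
Local Notation LS := (@L2strat R lambda1 lambda2).
Local Notation LQ := (@L2R2 R lambda1 lambda2).
Local Notation Lam := (@L2R R lambda3).
Local Notation cipS := (cip leb2 S wS).
Local Notation cipQ := (cip leb2 HH wQ).
Local Notation cip3 := (cip leb H w3).
Local Notation sqS := (L2sq leb2 S wS).
Local Notation sq3 := (L2sq leb H w3).
Local Notation Theta := (Theta lambda1 lambda2 l).
Local Notation Theta_inv := (Theta_inv lambda1 lambda2 l lambda3).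
Local Notation A := (Theta_adjoint lambda1 lambda2 l).
Local Notation J := (J_l lambda1 lambda2 l).
Local Notation V := (V_l lambda1 lambda2 l).
Local Notation T := (T_iota lambda1 lambda2).
Local Notation Ti := (T_iota_inv lambda1 lambda2).
Local Notation tau := (tau lambda1 lambda2).

Let mH := @measurable_halfline R.
Let mI : measurable I. Proof. exact: measurable_itv. Qed.
Let mS := @measurable_strat R.
Let mwS := @measurable_strat_weight R lambda1 lambda2.
Let wS0 := @strat_weight_gt0 R lambda1 lambda2.
Let mw3 := @measurable_lap_weight R lambda3.
Let w30 := @lap_weight_gt0 R lambda3.

Let l31 : 1 < lambda3.
Proof.
rewrite l3; have h : 0 <= l%:R :> R by [].
by rewrite (lt_le_trans l1)// -addrA lerDl addr_ge0 ?(ltW (lt_trans ltr01 l2))// mulr_ge0.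
Qed.

Let LTheta h : Lam h -> LS (Theta h). Proof. exact: L2_Theta. Qed.
Let LA f : LS f -> Lam (A f). Proof. exact: L2_Theta_adjoint. Qed.
Let AP f h : LS f -> Lam h -> cip3 (A f) h = cipS f (Theta h).
Proof. exact: Theta_adjointP. Qed.
Let Lker u : uhp u -> Lam (lap_ker lambda3 u). Proof. exact: L2_lap_ker. Qed.

Let laplaceA f u : LS f -> uhp u -> laplace (A f) u = cipS f (Theta (lap_ker lambda3 u)).
Proof. by move=> Lf hu; rewrite (laplace_cip lambda3) AP//; exact: Lker. Qed.

Lemma Theta_eq_ae h1 h2 : Lam h1 -> Lam h2 -> eq_ae leb H h1 h2 ->
  eq_ae leb2 S (Theta h1) (Theta h2).
Proof.
move=> L1 L2 h12; apply: (ae_rectangle_eq mH mI).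
- by apply: (cmeasurable_Theta l l1 l2); exact: (L2_cmeasurable mw3 w30 L1).
- by apply: (cmeasurable_Theta l l1 l2); exact: (L2_cmeasurable mw3 w30 L2).
apply: filterS h12 => t h Ht; apply: eq_in_ae => v _.
by rewrite /Defs.Theta /= h.
Qed.

(** The Laplace transforms are pairings with [Theta] of kernels, hence depend only on classes of
    functions; their injectivity concludes. *)
Lemma Theta_adjoint_eq_ae f1 f2 : LS f1 -> LS f2 -> eq_ae leb2 S f1 f2 ->
  eq_ae leb H (A f1) (A f2).
Proof.
move=> L1 L2 f12; apply: (laplace_eq_ae l31); [exact: LA|exact: LA|].
move=> u hu; rewrite !laplaceA//; apply: (ae_eq_cip mS mwS) => //.
- exact: (L2_cmeasurable mwS wS0 L1).
- exact: (L2_cmeasurable mwS wS0 L2).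
- exact: (L2_cmeasurable mwS wS0 (LTheta (Lker hu))).
Qed.

(** Pointwise linearity may fail at those t where a section is not integrable; comparing Laplace
    transforms avoids handling them. *)
Lemma Theta_adjoint_linear (a : R[i]) f1 f2 : LS f1 -> LS f2 ->
  eq_ae leb H (A (fun p => a * f1 p + f2 p)) (fun t => a * A f1 t + A f2 t).
Proof.
move=> L1 L2; have La1 := L2Z mS mwS wS0 a L1; have L12 := L2D mS mwS wS0 La1 L2.
have LaA := L2Z mH mw3 w30 a (LA L1).
apply: (laplace_eq_ae l31); [exact: LA|exact: (L2D mH mw3 w30 LaA (LA L2))|].
move=> u hu; have Lk := Lker hu; have LTk := LTheta Lk.
rewrite laplaceA// (cipDl mS mwS wS0 La1 L2 LTk) (cipZl mS mwS wS0 a L1 LTk).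
rewrite (laplace_cip lambda3) (cipDl mH mw3 w30 LaA (LA L2) Lk).
by rewrite (cipZl mH mw3 w30 a (LA L1) Lk) !AP.
Qed.

Lemma L2sq_Theta h : Lam h -> sqS (Theta h) = sq3 h.
Proof.
move=> Lh; apply: (congr1 (@complex.Re R) (_ : (sqS _)%:C = (sq3 h)%:C)).
rewrite -!cip_sq//; last exact: LTheta.
rewrite -AP//; last exact: LTheta.
by apply: eq_cip => // t /set_mem/halflineP t0; rewrite (Theta_adjointK l l1 l2).
Qed.

(** Pythagoras: by the adjoint relation both mixed terms and the squared norm of the projection are
    equal to [sq3 (A f)]. *)
Lemma L2sq_sub_projection f : LS f ->
  sqS (fun p => f p - Theta (A f) p) = sqS f - sq3 (A f).
Proof.
move=> Lf; have Lp := LTheta (LA Lf).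
have e : cipS f (Theta (A f)) = (sq3 (A f))%:C by rewrite -AP ?cip_sq//; exact: LA.
have e' : cipS (Theta (A f)) f = (sq3 (A f))%:C.
  by rewrite (cipC mS mwS wS0 Lf Lp) e conjc_real.
apply: (congr1 (@complex.Re R) (_ : (sqS _)%:C = (sqS f - sq3 (A f))%:C)).
rewrite -cip_sq; last exact: (L2B mS mwS wS0).
rewrite (cipBl mS mwS wS0 Lf Lp); last exact: (L2B mS mwS wS0).
rewrite (cipBr mS mwS wS0 Lf Lp Lf) (cipBr mS mwS wS0 Lf Lp Lp).
rewrite !cip_sq// e e' L2sq_Theta; last exact: LA.
by rewrite subrr subr0 -rmorphB.
Qed.

Let JE f : eq_ae leb2 S (J f) (Theta (A f)).
Proof. by apply: eq_in_ae => p Sp; exact: (J_lE l l1 l2). Qed.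

Lemma L2sq_Theta_adjoint_le f : LS f -> sq3 (A f) <= sqS f.
Proof.
by move=> Lf; rewrite -subr_ge0 -L2sq_sub_projection//; exact: (L2sq_ge0 leb2 wS0).
Qed.

Lemma V_l_J_l f : LS f -> V (J f).
Proof.
move=> Lf; have [Lp [k [Lk hk]]] := V_l_Theta l1 l2 l3 (LA Lf); split.
  by apply: (eq_L2 mS mwS wS0 _ Lp) => p /set_mem Sp; rewrite (J_lE l l1 l2).
by exists k; split => //; exact: (eq_ae_trans (JE f)).
Qed.

Lemma J_l_linear (a : R[i]) f1 f2 : LS f1 -> LS f2 ->
  eq_ae leb2 S (J (fun p => a * f1 p + f2 p)) (fun p => a * J f1 p + J f2 p).
Proof.
move=> L1 L2; apply: (eq_ae_trans (JE _)).
have L12 : LS (fun p => a * f1 p + f2 p) := L2D mS mwS wS0 (L2Z mS mwS wS0 a L1) L2.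
apply: (eq_ae_trans (Theta_eq_ae (LA L12) _ (Theta_adjoint_linear a L1 L2))).
  exact: (L2D mH mw3 w30 (L2Z mH mw3 w30 a (LA L1)) (LA L2)).
apply: eq_in_ae => p Sp; rewrite !(J_lE l l1 l2)// /Defs.Theta; ring.
Qed.

Lemma L2sq_J_l_sub f f' : LS f -> LS f' ->
  sqS (fun p => J f' p - J f p) <= sqS (fun p => f' p - f p).
Proof.
move=> L1 L2; have LB := L2B mS mwS wS0 L2 L1.
have [LJ1 _] := V_l_J_l L1; have [LJ2 _] := V_l_J_l L2.
have subE (h' h : R * R -> R[i]) : (fun p => h' p - h p) = fun p => -1 * h p + h' p.
  by apply/funext => p; rewrite mulN1r addrC.
have e : eq_ae leb2 S (J (fun p => f' p - f p)) (fun p => J f' p - J f p).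
  by rewrite (subE f') (subE (J f')); exact: J_l_linear.
have [LJ _] := V_l_J_l LB.
rewrite -(L2sq_eq_ae mS mwS wS0 LJ (L2B mS mwS wS0 LJ2 LJ1) e).
rewrite (L2sq_eq_ae mS mwS wS0 LJ (LTheta (LA LB)) (JE _)) L2sq_Theta; last exact: LA.
exact: L2sq_Theta_adjoint_le.
Qed.

(** The preimage chosen by [Theta_inv] is pinned down up to null sets by applying [A], a left
    inverse of [Theta]. *)
Lemma Theta_inv_eq_ae f h : V f -> Lam h -> eq_ae leb2 S f (Theta h) ->
  eq_ae leb H (Theta_inv f) h.
Proof.
move=> Vf Lh fh; have [Li ei] := V_l_Theta_inv l1 l2 l3 Vf.
have AK k : eq_ae leb H (A (Theta k)) k.
  by apply: eq_in_ae => t /halflineP t0; rewrite (Theta_adjointK l l1 l2).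
apply: (eq_ae_trans (eq_ae_sym (AK _))); apply: eq_ae_trans (AK h).
by apply: Theta_adjoint_eq_ae; [exact: LTheta|exact: LTheta|exact: eq_ae_trans ei fh].
Qed.

Variable g : universal_SL2 R.

Lemma L2_tau f : LS f -> LS (tau g f).
Proof.
by move=> Lf; apply: L2_T_iota; have [] := hat_pi2P l1 l2 g (L2_T_iota_inv Lf).
Qed.

Let cip_tau f h : LS f -> LS h ->
  cipS (tau g f) h = (strat_constant lambda1 lambda2)%:C *
    cipQ (hat_pi2 lambda1 lambda2 g (Ti f)) (Ti h).
Proof.
move=> Lf Lh; apply: cip_T_iota => //.
by have [] := hat_pi2P l1 l2 g (L2_T_iota_inv Lf).
Qed.

Let cip_Ti f h : LS f -> LS h ->
  cipS f h = (strat_constant lambda1 lambda2)%:C * cipQ (Ti f) (Ti h).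
Proof.
move=> Lf Lh; rewrite -cip_T_iota//; last exact: L2_T_iota_inv.
by apply: eq_cip => // p /set_mem Sp; rewrite T_iotaK.
Qed.

(** [strat_constant] appears on both sides, so that [T_iota] being a similarity suffices. *)
Lemma tau_isometry f : LS f -> sqS (tau g f) = sqS f.
Proof.
move=> Lf; have LF := L2_T_iota_inv Lf.
apply: (congr1 (@complex.Re R) (_ : (sqS _)%:C = (sqS f)%:C)).
rewrite -!cip_sq//; last exact: L2_tau.
rewrite cip_tau//; last exact: L2_tau.
rewrite (cip_Ti Lf Lf) -(hat_pi2_isometry g l1 l2 LF); congr (_ * _).
by apply: eq_cip => // q /set_mem Hq; rewrite /Defs.tau /= T_iota_invK.
Qed.

(** Both Laplace transforms at u become pairings with the transported kernel, on one side with
    [hat_pi2] acting on [T_iota_inv f], on the other with g acting on the kernel;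
    [laplace2_Theta_ker_act] is what the covariance principle needs to identify them. *)
Lemma Theta_adjoint_tau f : LS f ->
  eq_ae leb H (A (tau g f)) (hat_pi lambda3 g (A f)).
Proof.
move=> Lf; have LF := L2_T_iota_inv Lf; have Ltf := L2_tau Lf.
have [Lh e] := hat_piP l31 g (LA Lf).
apply: (laplace_eq_ae l31) => //; first exact: LA.
move=> u hu; rewrite e// (disc_series_cip l31 g (LA Lf) hu).
have LTk := LTheta (Lker hu).
have La : Lam (lap_ker_act lambda3 g u) by exact: L2_lap_ker_act.
have LTa := LTheta La.
rewrite laplaceA// AP// (cip_tau Lf LTk) (cip_Ti Lf LTa); congr (_ * _).
apply: (hat_pi2_covariant l1 l2) => //; [exact: L2_T_iota_inv|exact: L2_T_iota_inv|].
by move=> z z1 z2; rewrite (laplace2_Theta_ker_act l1 l2 l3).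
Qed.

Local Notation tau_l := (tau_l lambda1 lambda2 l lambda3 g).

Let tau_lE f h : V f -> Lam h -> eq_ae leb2 S f (Theta h) ->
  eq_ae leb2 S (tau_l f) (Theta (hat_pi lambda3 g h)).
Proof.
move=> Vf Lh fh; have [Li _] := V_l_Theta_inv l1 l2 l3 Vf.
have [L1 _] := hat_piP l31 g Li; have [L2 _] := hat_piP l31 g Lh.
apply: Theta_eq_ae => //; apply: (hat_pi_eq_ae g l31) => //.
exact: Theta_inv_eq_ae.
Qed.

(** [tau_l] at [J f] may be computed from [A f], since [J f] and [Theta (A f)] agree on the
    strip. *)
Lemma J_l_tau f : LS f -> eq_ae leb2 S (J (tau g f)) (tau_l (J f)).
Proof.
move=> Lf; have [Lh _] := hat_piP l31 g (LA Lf).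
apply: (eq_ae_trans (JE _)).
apply: (eq_ae_trans (Theta_eq_ae (LA (L2_tau Lf)) Lh (Theta_adjoint_tau Lf))).
by apply: eq_ae_sym; apply: tau_lE; [exact: V_l_J_l|exact: LA|exact: JE].
Qed.

(* tau g preserves norms, and so does the action of g on the image of the
   projection; hence tau g f is as far from V_l as f is. *)
Lemma tau_l_tau f : V f -> eq_ae leb2 S (tau_l f) (tau g f).
Proof.
move=> Vf; have [Lf _] := Vf; have [Li ei] := V_l_Theta_inv l1 l2 l3 Vf.
have LAf := LA Lf; have [Lh _] := hat_piP l31 g LAf; have Ltf := L2_tau Lf.
have iA : eq_ae leb H (Theta_inv f) (A f).
  apply: eq_ae_trans (Theta_adjoint_eq_ae (LTheta Li) Lf ei).
  by apply: eq_in_ae => t /halflineP t0; rewrite (Theta_adjointK l l1 l2).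
have fA : eq_ae leb2 S f (Theta (A f)).
  exact: eq_ae_trans (eq_ae_sym ei) (Theta_eq_ae Li LAf iA).
have LTA := LTheta LAf; have LAt := LA Ltf; have LTAt := LTheta LAt.
have LB := L2B mS mwS wS0 Lf LTA.
have d0 : sqS (fun p => f p - Theta (A f) p) = 0.
  apply: (eq_ae_L2sq0 mS mwS wS0 LB).
  by apply: filterS fA => p h Sp; rewrite h// subrr.
have At := Theta_adjoint_tau Lf.
have tA : eq_ae leb2 S (tau g f) (Theta (A (tau g f))).
  apply: (L2sq_sub_eq0 mS mwS wS0 Ltf LTAt).
  rewrite (L2sq_sub_projection Ltf) (tau_isometry Lf).
  rewrite (L2sq_eq_ae mH mw3 w30 LAt Lh At) (hat_pi_isometry g l31 LAf).
  by rewrite -(L2sq_sub_projection Lf).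
apply: (eq_ae_trans (tau_lE Vf LAf fA)); apply: eq_ae_sym.
exact: (eq_ae_trans tA (Theta_eq_ae LAt Lh At)).
Qed.

End intertwining.

Unset Implicit Arguments.

Theorem proposition4p3 (R : realType) (lambda1 lambda2 lambda3 : R) (l : nat)
    (hlambda1 : 1 < lambda1) (hlambda2 : 1 < lambda2)
    (hlambda3 : lambda3 = lambda1 + lambda2 + 2 * l%:R) :
  (* J_l is a symmetry breaking operator *)
  intertwining_operator lambda1 lambda2
    (L2strat lambda1 lambda2) (tau lambda1 lambda2)
    (V_l lambda1 lambda2 l) (tau_l lambda1 lambda2 l lambda3)
    (J_l lambda1 lambda2 l) /\
  (* the inclusion of V_l is a holographic operator *)
  intertwining_operator lambda1 lambda2
    (V_l lambda1 lambda2 l) (tau_l lambda1 lambda2 l lambda3)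
    (L2strat lambda1 lambda2) (tau lambda1 lambda2)
    id.
Proof.
have mS := @measurable_strat R; have mw := @measurable_strat_weight R lambda1 lambda2.
have w0 := @strat_weight_gt0 R lambda1 lambda2.
split; split.
- by move=> f; exact: (V_l_J_l hlambda1 hlambda2 hlambda3).
- by move=> a f1 f2; exact: (J_l_linear hlambda1 hlambda2 hlambda3).
(* The projection does not increase distances, so the radius can be the tolerance itself. *)
- move=> f Lf e e0; exists e => // f' Lf'.
  have [LJ _] := V_l_J_l hlambda1 hlambda2 hlambda3 Lf.
  have [LJ' _] := V_l_J_l hlambda1 hlambda2 hlambda3 Lf'.
  rewrite (L2norm_sq mS mw w0 (L2B mS mw w0 Lf' Lf)).
  rewrite (L2norm_sq mS mw w0 (L2B mS mw w0 LJ' LJ)) !lte_fin.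
  apply: le_lt_trans; rewrite ler_sqrt; last exact: (L2sq_ge0 leb2 w0).
  exact: (L2sq_J_l_sub hlambda1 hlambda2 hlambda3 Lf Lf').
- by move=> g f; exact: (J_l_tau hlambda1 hlambda2 hlambda3).
- by move=> f [].
- by move=> a f1 f2 _ _; apply: eq_in_ae.
- by move=> f Vf e e0; exists e.
- by move=> g f; exact: (tau_l_tau hlambda1 hlambda2 hlambda3).
Qed.
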